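(* Assume $\mathbb{E}\|X_1\|^2<\infty$. Let $K_1:=2\,\mathbb{E}\|X_1\|$, let $C_1>0$, let $\tau=\frac{1}{n\sqrt d}$ with $C_1>2d\tau$, let $\theta_0\in\mathbb{R}^d$ be the true parameter with $\|\theta_0\|_1\le C_1-2d\tau$ and $s^*:=\|\theta_0\|_0$, $1\le s^*<n$, and put $$\varepsilon_n=\frac{K_1\vee 4s^*\log\left(\frac{C_1 n\sqrt d}{s^*}\right)}{n},\qquad \mathcal{H}_\alpha=\begin{cases}\frac{2(\alpha+1)}{1-\alpha},&\alpha\in[0.5,1),\\ \frac{2(\alpha+1)}{\alpha},&\alpha\in(0,0.5).\end{cases}$$ Then for every $\alpha\in(0,1)$, $$\mathbb{P}\left[\int H^2(P_\theta,P_{\theta_0})\,\pi_{n,\alpha}(\mathrm{d}\theta)\le \mathcal{H}_\alpha\,\varepsilon_n\right]\ge 1-\frac{2}{n\varepsilon_n},$$ and $$\mathbb{P}\left[\int d_{TV}^2(P_\theta,P_{\theta_0})\,\pi_{n,\alpha}(\mathrm{d}\theta)\le \frac{4(\alpha+1)}{(1-\alpha)\alpha}\,\varepsilon_n\right]\ge 1-\frac{2}{n\varepsilon_n}.$$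
   Context: Model: $Z_i=(Y_i,X_i)\in\{-1,1\}\times\mathbb{R}^d$, $i=1,\dots,n$, are i.i.d. For $\theta\in\mathbb{R}^d$, $P_\theta$ is the joint law of $(Y,X)$ for which $X$ has a fixed marginal law not depending on $\theta$ and $p_\theta(y|x)=\mathbb{P}(Y=y\mid X=x,\theta)=\frac{e^{yx^\top\theta}}{1+e^{yx^\top\theta}}$. The data are drawn from $\mathbb{P}=P_{\theta_0}^{\otimes n}$ (well-specified case). $\|\cdot\|=\|\cdot\|_2$ is the Euclidean norm, $\|\cdot\|_1$ the $\ell_1$ norm, $\|\theta\|_0$ the number of nonzero entries of $\theta$, and $a\vee b=\max(a,b)$. Prior: for $C_1>0$, $\tau>0$, $\pi$ is the probability distribution supported on $B_1(C_1)=\{\theta\in\mathbb{R}^d:\|\theta\|_1\le C_1\}$ with density $\pi(\theta)\propto\prod_{i=1}^d(\tau^2+\theta_i^2)^{-2}$ on $B_1(C_1)$. Fractional posterior: $\pi_{n,\alpha}(\mathrm{d}\theta)\propto L_n(\theta)^\alpha\,\pi(\mathrm{d}\theta)$, where $L_n(\theta)=\prod_{i=1}^n p_\theta(Y_i|X_i)$; it depends on the data $Z_1,\dots,Z_n$. Distances: for probability measures $P,R$ with densities $f,g$ with respect to a common dominating measure $\mu$, $H^2(P,R)=\int(\sqrt f-\sqrt g)^2\,\mathrm{d}\mu$ is the squared Hellinger distance, and $d_{TV}(P,R)=\sup_A|P(A)-R(A)|$ is the total variation distance. *)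

(* Defs.v *)
From HB Require Import structures.
From mathcomp Require Import all_boot all_order all_algebra.
From mathcomp Require Import all_classical all_reals all_analysis.
From mathcomp Require Import measurable_realfun ring.

Set Implicit Arguments.
Unset Strict Implicit.
Unset Printing Implicit Defensive.

Import Order.TTheory GRing.Theory Num.Theory.
Import numFieldNormedType.Exports.

Local Open Scope classical_set_scope.
Local Open Scope ring_scope.

(* mpower mu n is the n-fold product of mu on n.-tuple T; mpower_box gives its *)
(* value on boxes.                                                            *)
Section product_power.
Context d (T : measurableType d) (R : realType).
Variable mu : {sigma_finite_measure set T -> \bar R}.

Definition tcons n (p : T * n.-tuple T) : n.+1.-tuple T :=
  [the n.+1.-tuple T of p.1 :: p.2].

Lemma measurable_tcons n : measurable_fun [set: T * n.-tuple T] (@tcons n).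
Proof. exact: measurable_cons. Qed.

Section step.
Variables (n : nat) (m : {sigma_finite_measure set (n.-tuple T) -> \bar R}).

Definition mcons : set (n.+1.-tuple T) -> \bar R :=
  pushforward (mu \x m)%E (@tcons n).

Let mcons0 : mcons set0 = 0%E.
Proof. by rewrite /mcons /pushforward preimage_set0 measure0. Qed.

Let mcons_ge0 A : (0 <= mcons A)%E.
Proof. by rewrite /mcons /pushforward measure_ge0. Qed.

Let mcons_sigma_additive : semi_sigma_additive mcons.
Proof.
move=> F mF tF mUF; rewrite /mcons /pushforward preimage_bigcup.
have mtc n' : measurable (tcons (n:=n) @^-1` F n').
  by rewrite -[X in measurable X]setTI; exact: measurable_tcons.
apply: measure_semi_sigma_additive => //.
- apply/trivIsetP => /= i j _ _ ij; rewrite -preimage_setI.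
  by move/trivIsetP : tF => /(_ _ _ _ _ ij) ->//; rewrite preimage_set0.
- exact: bigcup_measurable.
Qed.

HB.instance Definition _ := isMeasure.Build _ _ _ mcons
  mcons0 mcons_ge0 mcons_sigma_additive.

Definition tuncons (t : n.+1.-tuple T) : T * n.-tuple T :=
  (thead t, [tuple of behead t]).

Lemma tunconsK : cancel tuncons (@tcons n).
Proof. by move=> t; rewrite [RHS](tuple_eta t). Qed.

Lemma tconsK : cancel (@tcons n) tuncons.
Proof. by move=> [x t]; congr (_, _); exact/val_inj. Qed.

Lemma measurable_tuncons : measurable_fun [set: n.+1.-tuple T] tuncons.
Proof.
apply: measurable_fun_pair; last exact: measurable_behead.
exact: measurable_tnth.
Qed.

Let mcons_sigma_finite : sigma_finite setT mcons.
Proof.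
have /sigma_finiteP[F [UF ndF Foo]] := sigma_finiteT mu.
have /sigma_finiteP[G [UG ndG Goo]] := sigma_finiteT m.
exists (fun k => tuncons @^-1` (F k `*` G k)).
  rewrite -preimage_bigcup (_ : \bigcup_k _ = setT) ?preimage_setT//.
  apply/seteqP; split => // -[x y] _.
  have [i _ Fx] : (\bigcup_k F k) x by rewrite -UF.
  have [j _ Gy] : (\bigcup_k G k) y by rewrite -UG.
  exists (maxn i j) => //; split => /=.
    by move: x Fx; exact/subsetPset/ndF/leq_maxl.
  by move: y Gy; exact/subsetPset/ndG/leq_maxr.
move=> k; have [mFk Fkoo] := Foo k; have [mGk Gkoo] := Goo k; split.
  rewrite -[X in measurable X]setTI; apply: measurable_tuncons => //.
  exact: measurableX.
rewrite /mcons /pushforward -comp_preimage.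
rewrite (_ : tuncons \o _ = id); last by apply/funext => x /=; rewrite tconsK.
by rewrite preimage_id product_measure1E// lte_mul_pinfty// ge0_fin_numE.
Qed.

HB.instance Definition _ := Measure_isSigmaFinite.Build _ _ _ mcons
  mcons_sigma_finite.

End step.

Fixpoint mpower n : {sigma_finite_measure set (n.-tuple T) -> \bar R} :=
  match n with
  | 0 => \d_([tuple] : 0.-tuple T)
  | n'.+1 => mcons (mpower n')
  end.

Lemma mpower_box n (A : 'I_n -> set T) : (forall i, measurable (A i)) ->
  mpower n [set t | forall i, A i (tnth t i)] = (\prod_(i < n) mu (A i))%E.
Proof.
elim: n A => [|n IHn] A mA.
  rewrite big_ord0 /= diracE mem_set//; by case.
rewrite big_ord_recl /= /mcons /pushforward -IHn//.
rewrite -product_measure1E//; last first.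
  rewrite (_ : [set t | _] = \bigcap_(i in [set: 'I_n])
      ((@tnth n T ^~ i) @^-1` A (lift ord0 i))); last first.
    by apply/seteqP; split => t /=; [move=> h i _; exact: h|move=> h i; exact: h].
  apply: fin_bigcap_measurable => // i _.
  by rewrite -[X in measurable X]setTI; exact: measurable_tnth.
congr (_ _); apply/seteqP; split => -[x t] /=.
  move=> h; split; first by have := h ord0; rewrite tnth0.
  by move=> i; have := h (lift ord0 i); rewrite tnthS.
move=> [h0 h] i; case: (unliftP ord0 i) => [j|] ->; last by rewrite tnth0.
by rewrite tnthS.
Qed.

End product_power.

Section density.
Context d (T : measurableType d) (R : realType).
Variables (mu : {measure set T -> \bar R}) (f : T -> R).

Definition mdensity (mf : measurable_fun [set: T] f) (f0 : forall x, 0 <= f x) :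
  set T -> \bar R := fun A => (\int[mu]_(x in A) (f x)%:E)%E.

Variables (mf : measurable_fun [set: T] f) (f0 : forall x, 0 <= f x).

Let mdensity0 : mdensity mf f0 set0 = 0%E.
Proof. exact: integral_set0. Qed.

Let mdensity_ge0 A : (0 <= mdensity mf f0 A)%E.
Proof. by apply: integral_ge0 => x _; rewrite lee_fin. Qed.

Let mdensity_sigma_additive : semi_sigma_additive (mdensity mf f0).
Proof.
move=> F mF tF mUF; rewrite /mdensity ge0_integral_bigcup//=.
- by apply: is_cvg_ereal_nneg_natsum => k _; exact: mdensity_ge0.
- exact/measurable_EFinP/measurable_funTS.
- by move=> x _; rewrite lee_fin.
Qed.

HB.instance Definition _ := isMeasure.Build _ _ _ (mdensity mf f0)
  mdensity0 mdensity_ge0 mdensity_sigma_additive.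

End density.

Section distances.
Context d (T : measurableType d) (R : realType) (P Q : probability T R).
Local Open Scope charge_scope.

Definition psum : set T -> \bar R := measure_add P Q.

HB.instance Definition _ := Measure.on psum.

Let psum_finite : fin_num_fun psum.
Proof.
move=> A mA; rewrite /psum measure_addE.
by rewrite fin_numD !fin_num_measure.
Qed.

HB.instance Definition _ := Measure_isFinite.Build _ _ _ psum psum_finite.

(* P + Q dominates both P and Q; hellinger2E shows that any other dominating  *)
(* measure yields the same value.                                             *)
Definition hellinger2 : \bar R :=
  let f := fine \o 'd (charge_of_finite_measure P) '/d psum in
  let g := fine \o 'd (charge_of_finite_measure Q) '/d psum in
  (\int[psum]_x ((Num.sqrt (f x) - Num.sqrt (g x)) ^+ 2)%:E)%E.

Definition tv_distance : \bar R :=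
  ereal_sup [set `|P A - Q A|%E | A in (measurable : set (set T))].

End distances.

Section hellinger2E.
Context d (T : measurableType d) (R : realType) (P Q : probability T R).
Variables (mu : {sigma_finite_measure set T -> \bar R}) (f g : T -> R).
Hypotheses (mf : measurable_fun [set: T] f) (f0 : forall x, 0 <= f x).
Hypotheses (mg : measurable_fun [set: T] g) (g0 : forall x, 0 <= g x).
Hypothesis PE : forall A, measurable A -> P A = (\int[mu]_(x in A) (f x)%:E)%E.
Hypothesis QE : forall A, measurable A -> Q A = (\int[mu]_(x in A) (g x)%:E)%E.
Local Open Scope charge_scope.

Let psum_mu : psum P Q `<< mu.
Proof.
apply/null_content_dominatesP => A mA muA0.
have -> : psum P Q A = (P A + Q A)%E by exact: measure_addE.
rewrite PE// QE// !null_set_integral ?adde0//;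
  exact/measurable_EFinP/measurable_funTS.
Qed.

Let density_chain (N : probability T R) (h : T -> R) :
  measurable_fun [set: T] h -> (forall x, 0 <= h x) ->
  (forall A, measurable A -> N A = (\int[mu]_(x in A) (h x)%:E)%E) ->
  charge_of_finite_measure N `<< psum P Q ->
  ae_eq mu setT (EFin \o h) ('d (charge_of_finite_measure N) '/d (psum P Q) \*
    Radon_Nikodym_SigmaFinite.f (psum P Q) mu)%E.
Proof.
move=> mh h0 hE Npsum.
have Nmu := null_dominates_trans Npsum psum_mu.
have h_ae : ae_eq mu setT ('d (charge_of_finite_measure N) '/d mu) (EFin \o h).
  apply: integral_ae_eq => //.
  - exact: Radon_Nikodym_integrable.
  - exact/measurable_EFinP.
  - by move=> A _ mA; rewrite -Radon_Nikodym_integral// -hE.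
apply: (ae_eq_trans (ae_eq_sym h_ae)).
apply: (ae_eq_trans (Radon_Nikodym_chain_rule Npsum psum_mu)).
have := ae_eq_Radon_Nikodym_SigmaFinite psum_mu measurableT.
by apply: filterS => x /(_ Logic.I) Dx _ /=; rewrite Dx.
Qed.

Lemma hellinger2E : hellinger2 P Q =
  (\int[mu]_x ((Num.sqrt (f x) - Num.sqrt (g x)) ^+ 2)%:E)%E.
Proof.
have psumE0 A : psum P Q A = 0%E -> P A = 0%E /\ Q A = 0%E.
  rewrite /psum measure_addE => /eqP; rewrite padde_eq0; first last.
  - exact: measure_ge0.
  - exact: measure_ge0.
  by move=> /andP[/eqP -> /eqP ->].
have Ppsum : charge_of_finite_measure P `<< psum P Q.
  apply/null_content_dominatesP => A mA.
  by move=> /psumE0[].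
have Qpsum : charge_of_finite_measure Q `<< psum P Q.
  apply/null_content_dominatesP => A mA.
  by move=> /psumE0[].
have fchain := density_chain mf f0 PE Ppsum.
have gchain := density_chain mg g0 QE Qpsum.
have ma : measurable_fun setT (fine \o 'd (charge_of_finite_measure P) '/d (psum P Q)).
  exact: measurableT_comp.
have mb : measurable_fun setT (fine \o 'd (charge_of_finite_measure Q) '/d (psum P Q)).
  exact: measurableT_comp.
have msqrt : measurable_fun [set: R] (@Num.sqrt R).
  by apply: continuous_measurable_fun => x; exact: sqrt_continuous.
have msq (u v : T -> R) : measurable_fun setT u -> measurable_fun setT v ->
    measurable_fun setT (fun x => ((Num.sqrt (u x) - Num.sqrt (v x)) ^+ 2)%:E).
  move=> mu' mv; apply/measurable_EFinP; apply: measurable_funX.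
  apply: measurable_funB; first exact: (measurableT_comp msqrt mu').
  exact: (measurableT_comp msqrt mv).
rewrite /hellinger2 /= -(Radon_Nikodym_SigmaFinite.change_of_variables psum_mu)//;
  [|by move=> x; rewrite lee_fin sqr_ge0|exact: msq].
apply: ge0_ae_eq_integral => //.
- apply: emeasurable_funM; first exact: msq.
  exact: measurable_int (Radon_Nikodym_SigmaFinite.f_integrable psum_mu).
- exact: msq.
- move=> x _; rewrite mule_ge0 ?lee_fin ?sqr_ge0//.
  exact: Radon_Nikodym_SigmaFinite.f_ge0.
- by move=> x _; rewrite lee_fin sqr_ge0.
have D0 := Radon_Nikodym_SigmaFinite.f_ge0 psum_mu.
have Dfin := Radon_Nikodym_SigmaFinite.f_fin_num psum_mu.
have afin x := Radon_Nikodym_fin_num x Ppsum.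
have bfin x := Radon_Nikodym_fin_num x Qpsum.
apply: filterS2 fchain gchain => x /(_ Logic.I) /= fx /(_ Logic.I) /= gx _.
move: fx gx; rewrite -(fineK (afin x)) -(fineK (bfin x)) -(fineK (Dfin x)) /=.
have : 0 <= fine (Radon_Nikodym_SigmaFinite.f (psum P Q) mu x) by rewrite fine_ge0.
set D := fine _; set a := fine _; set b := fine _ => {}D0 [->] [->].
rewrite -EFinM; congr EFin.
rewrite ![_ * D]mulrC !sqrtrM// -mulrBr exprMn sqr_sqrtr// mulrC.
Qed.

End hellinger2E.

(* lebesgue_measure lives on measurableTypeR R, which has the same measurable  *)
(* sets as R but another display; this is the same measure on R itself.       *)
Section lebesgue_real.
Variable R : realType.

Definition lebesgue_real : set R -> \bar R :=
  pushforward lebesgue_measure (fun x : measurableTypeR R => x : R).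

Lemma lebesgue_realE A : lebesgue_real A = lebesgue_measure A.
Proof. by []. Qed.

Let lebesgue_real0 : lebesgue_real set0 = 0%E.
Proof. exact: (measure0 (@lebesgue_measure R)). Qed.

Let lebesgue_real_ge0 A : (0 <= lebesgue_real A)%E.
Proof. exact: (measure_ge0 (@lebesgue_measure R)). Qed.

Let lebesgue_real_sigma_additive : semi_sigma_additive lebesgue_real.
Proof. exact: (@measure_semi_sigma_additive _ _ _ (@lebesgue_measure R)). Qed.

HB.instance Definition _ := isMeasure.Build _ _ _ lebesgue_real
  lebesgue_real0 lebesgue_real_ge0 lebesgue_real_sigma_additive.

Let lebesgue_real_sigma_finite : sigma_finite setT lebesgue_real.
Proof. exact: (@sigma_finiteT _ _ _ (@lebesgue_measure R)). Qed.

HB.instance Definition _ := Measure_isSigmaFinite.Build _ _ _ lebesgue_real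
  lebesgue_real_sigma_finite.

End lebesgue_real.

(* R^d is represented by d.-tuple R, which carries the product (Borel)        *)
(* sigma-algebra.                                                             *)
Section euclidean.
Context (R : realType) (d : nat).
Implicit Types x y : d.-tuple R.

Definition dot x y : R := \sum_(i < d) tnth x i * tnth y i.
Lemma dotC x y : dot x y = dot y x.
Proof. by apply: eq_bigr => i _; rewrite mulrC. Qed.

Definition norm2 x : R := Num.sqrt (\sum_(i < d) tnth x i ^+ 2).
Definition norm1 x : R := \sum_(i < d) `|tnth x i|.
Definition norm0 x : nat := #|[set i : 'I_d | tnth x i != 0]|.

Definition lebesgue_tuple : {sigma_finite_measure set (d.-tuple R) -> \bar R} :=
  mpower (@lebesgue_real R) d.

Lemma measurable_dot x : measurable_fun [set: d.-tuple R] (dot x).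
Proof.
apply: measurable_sum => i; apply: measurable_funM => //.
exact: measurable_tnth.
Qed.

Lemma measurable_norm1 : measurable_fun [set: d.-tuple R] norm1.
Proof.
apply: measurable_sum => i; apply: measurableT_comp => //.
exact: measurable_tnth.
Qed.

End euclidean.

(* A label y in {-1, 1} is encoded by a boolean, true standing for 1.         *)
Definition label (R : realType) (y : bool) : R := if y then 1 else -1.
Arguments label : clear implicits.

Section logistic.
Context (R : realType) (d : nat).
Implicit Types (theta x : d.-tuple R) (y : bool).

Definition logistic theta y x : R :=
  expR (label R y * dot x theta) / (1 + expR (label R y * dot x theta)).

Lemma logistic_ge0 theta y x : 0 <= logistic theta y x.
Proof. by rewrite divr_ge0// ?expR_ge0// addr_ge0// expR_ge0. Qed.

Lemma logistic_sum theta x : \sum_(y : bool) logistic theta y x = 1.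
Proof.
rewrite big_bool /logistic /= mul1r mulN1r expRN.
have := expR_gt0 (dot x theta); set u := expR _ => u0.
have : 1 + u != 0 by rewrite lt0r_neq0// addr_gt0.
have : u != 0 by rewrite lt0r_neq0.
move=> un0 u1n0; have -> : 1 + u^-1 = (1 + u) / u by field.
by field; rewrite un0 u1n0.
Qed.

Lemma logisticE theta y x :
  logistic theta y x = (1 + expR (- (label R y * dot x theta)))^-1.
Proof.
rewrite /logistic expRN; set u := expR _.
have u0 : 0 < u by exact: expR_gt0.
have un0 : u != 0 by rewrite lt0r_neq0.
have u1n0 : 1 + u != 0 by rewrite lt0r_neq0// addr_gt0.
have -> : 1 + u^-1 = (1 + u) / u by field.
by rewrite invf_div.
Qed.

Let measurable_logistic_label y (h : d.-tuple R -> R) :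
  measurable_fun [set: d.-tuple R] h ->
  measurable_fun [set: d.-tuple R]
    (fun t => (1 + expR (- (label R y * h t)))^-1).
Proof.
move=> mh.
have -> : (fun t => (1 + expR (- (label R y * h t)))^-1) =
    (@powR R ^~ (-1)) \o (fun t => 1 + expR (- (label R y * h t))).
  by apply/funext => t /=; rewrite powR_inv1// addr_ge0// expR_ge0.
apply: measurableT_comp => //; apply: measurable_funD => //.
apply: measurableT_comp => //; apply: measurableT_comp => //.
exact: measurable_funM.
Qed.

Lemma measurable_logisticl y x :
  measurable_fun [set: d.-tuple R] (fun theta => logistic theta y x).
Proof.
under eq_fun do rewrite logisticE.
apply: measurable_logistic_label; exact: measurable_dot.
Qed.

Lemma measurable_logisticr theta y :
  measurable_fun [set: d.-tuple R] (logistic theta y).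
Proof.
have -> : logistic theta y =
    fun x => (1 + expR (- (label R y * dot theta x)))^-1.
  by apply/funext => x; rewrite logisticE dotC.
apply: measurable_logistic_label; exact: measurable_dot.
Qed.

End logistic.

(* Joint law of (Y, X): X has law PX, and Y given X = x has the probability   *)
(* mass function y |-> logistic theta y x.                                    *)
Section model.
Context (R : realType) (d : nat) (PX : probability (d.-tuple R) R).

Section joint_law.
Variable theta : d.-tuple R.

Definition joint_law (A : set (bool * d.-tuple R)) : \bar R :=
  (\int[PX]_x (\sum_(y : bool) logistic theta y x * \1_A (y, x))%:E)%E.

Let joint_integrand_ge0 A x :
  0 <= \sum_(y : bool) logistic theta y x * \1_A (y, x).
Proof. by apply: sumr_ge0 => y _; rewrite mulr_ge0// logistic_ge0. Qed.

Let joint_integrand_measurable A : measurable A ->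
  measurable_fun [set: d.-tuple R]
    (fun x => \sum_(y : bool) logistic theta y x * \1_A (y, x)).
Proof.
move=> mA; apply: measurable_sum => y; apply: measurable_funM.
  exact: measurable_logisticr.
have m1 : measurable_fun [set: bool * d.-tuple R] (\1_A : _ -> R).
  exact: measurable_indic.
exact: (measurableT_comp m1 (pair1_measurable y)).
Qed.

Let joint_law0 : joint_law set0 = 0%E.
Proof.
rewrite /joint_law (eq_integral (cst 0%E)) ?integral_cst ?mul0e// => x _.
by rewrite big1// => y _; rewrite indic0 mulr0.
Qed.

Let joint_law_ge0 A : (0 <= joint_law A)%E.
Proof. by apply: integral_ge0 => x _; rewrite lee_fin. Qed.

Let joint_law_sigma_additive : semi_sigma_additive joint_law.
Proof.
move=> F mF tF mUF.
have -> : joint_law (\bigcup_n F n) = (\sum_(n <oo) joint_law (F n))%E.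
  rewrite /joint_law -integral_nneseries//=.
  - apply: eq_integral => x _.
    rewrite -sumEFin; under [RHS]eq_eseriesr do rewrite -sumEFin.
    rewrite nneseries_sum; last first.
      by move=> y n _; rewrite lee_fin mulr_ge0// logistic_ge0.
    apply: eq_bigr => y _; rewrite EFinM indic_bigcup//.
    by rewrite -nneseriesZl// => n _; rewrite lee_fin.
  - move=> n; apply/measurable_EFinP; exact: joint_integrand_measurable.
  - by move=> n x _; rewrite lee_fin.
by apply: is_cvg_ereal_nneg_natsum => k _; exact: joint_law_ge0.
Qed.

HB.instance Definition _ := isMeasure.Build _ _ _ joint_law
  joint_law0 joint_law_ge0 joint_law_sigma_additive.

Let joint_law_setT : joint_law [set: _] = 1%E.
Proof.
rewrite /joint_law (eq_integral (cst 1%E)); last first.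
  move=> x _; under eq_bigr do rewrite indicT mulr1.
  by rewrite logistic_sum.
by rewrite integral_cst// mul1e; exact: probability_setT.
Qed.

HB.instance Definition _ := Measure_isProbability.Build _ _ _ joint_law
  joint_law_setT.

End joint_law.
End model.

Section prior.
Context (R : realType) (d : nat) (C tau : R).

Definition l1_ball : set (d.-tuple R) := [set theta | norm1 theta <= C].

Definition prior_weight (theta : d.-tuple R) : R :=
  \1_l1_ball theta * \prod_(i < d) (tau ^+ 2 + tnth theta i ^+ 2) ^- 2.

Lemma prior_weight_ge0 theta : 0 <= prior_weight theta.
Proof.
rewrite mulr_ge0// prodr_ge0// => i _.
by rewrite invr_ge0 exprn_ge0// addr_ge0// sqr_ge0.
Qed.

Lemma measurable_l1_ball : measurable l1_ball.
Proof.
rewrite (_ : l1_ball = [set: _] `&` @norm1 R d @^-1` `]-oo, C]).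
  exact: measurable_norm1.
by rewrite setTI; apply/seteqP; split => x /=; rewrite in_itv.
Qed.

Lemma measurable_prior_weight :
  measurable_fun [set: d.-tuple R] prior_weight.
Proof.
apply: measurable_funM; first exact: measurable_indic measurable_l1_ball.
apply: measurable_prod => i _.
rewrite (_ : (fun _ => _) = (@powR R ^~ (-1)) \o
    (fun t : d.-tuple R => (tau ^+ 2 + tnth t i ^+ 2) ^+ 2)); last first.
  apply/funext => t /=; rewrite powR_inv1// exprn_ge0//.
  by rewrite addr_ge0// sqr_ge0.
apply: measurableT_comp => //; apply: measurable_funX.
apply: measurable_funD => //; apply: measurable_funX.
exact: measurable_tnth.
Qed.

(* The last argument of mnormalize is used only if the total mass is 0 or     *)
(* infinite, which does not happen when 0 < C and 0 < tau.                    *)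
Definition prior : probability (d.-tuple R) R :=
  mnormalize
    (mdensity (@lebesgue_tuple R d) measurable_prior_weight prior_weight_ge0)
    \d_([tuple (0 : R) | _ < d]).

End prior.

Section posterior.
Context (R : realType) (d n : nat).
Variables (pi : probability (d.-tuple R) R) (alpha : R).
Variable z : n.-tuple (bool * d.-tuple R).

Definition likelihood (theta : d.-tuple R) : R :=
  \prod_(i < n) logistic theta (tnth z i).1 (tnth z i).2.

Definition likelihood_power (theta : d.-tuple R) : R :=
  likelihood theta `^ alpha.

Lemma likelihood_power_ge0 theta : 0 <= likelihood_power theta.
Proof. exact: powR_ge0. Qed.

Lemma measurable_likelihood_power :
  measurable_fun [set: d.-tuple R] likelihood_power.
Proof.
apply: (measurableT_comp (measurable_powR alpha)).
by apply: measurable_prod => i _; exact: measurable_logisticl.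
Qed.

(* The total mass lies in ]0, 1] when 0 < alpha, so the fallback of           *)
(* mnormalize is not used.                                                    *)
Definition fractional_posterior : probability (d.-tuple R) R :=
  mnormalize
    (mdensity pi measurable_likelihood_power likelihood_power_ge0) pi.

End posterior.

(* Main.v *)
(* Write rho_i for the likelihood ratio p_theta / p_theta0 at Z_i, h(theta) for *)
(* H^2(P_theta, P_theta0), c = min(alpha, 1 - alpha) and A = n eps.             *)
(*                                                                              *)
(* Upper bound. From rho^alpha + c (sqrt rho - 1)^2 <= alpha rho + 1 - alpha one *)
(* gets E[rho^alpha f(X)] <= E f(X) - c h(theta) for every f >= 1, so the prior *)
(* average U of exp(n c h) prod_i rho_i^alpha f(X_i) has expectation at most    *)
(* exp(n (E f - 1)), and Markov's inequality controls U with probability        *)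
(* 1 - 2/A. By Jensen, n c times the posterior mean of h is at most             *)
(* ln U - sum_i ln f(X_i) - ln (prior average of prod_i rho_i^alpha).           *)
(*                                                                              *)
(* Lower bound on the prior average, for every sample. Since                    *)
(* rho_i >= exp (- |X_i . u|) at theta = theta0 + u, translating the Student-type *)
(* prior to theta0 costs the factor (C1 / (s tau))^(4 s) and leaves the integral *)
(* of prod_i exp (- alpha |X_i . u|) against the centred density on a small l1  *)
(* ball. That density is a mixture over x of autocorrelations of Gaussians, and *)
(* exp (- alpha |v - v'|) dominates a Gaussian in v - v', which is again an     *)
(* autocorrelation; Cauchy-Schwarz turns the double integral into the square of *)
(* a single one, to which Jensen's inequality applies. The loss is a factor     *)
(* f(X_i) per observation, with f(x) = 1 + 4 alpha (|x| / n + 1 / (32 n)); this *)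
(* is the f taken in U, so the samples X_i cancel and only the first moment of  *)
(* |X| enters, through the expectation of U.                                    *)

From HB Require Import structures.
Require Import Defs.
From mathcomp Require Import all_boot all_order all_algebra.
From mathcomp Require Import all_classical all_reals all_analysis.
From mathcomp Require Import measurable_realfun ring lra.

Set Implicit Arguments.
Unset Strict Implicit.
Unset Printing Implicit Defensive.

Import Order.TTheory GRing.Theory Num.Theory.
Import numFieldNormedType.Exports.

Local Open Scope classical_set_scope.
Local Open Scope ring_scope.
Local Open Scope ereal_scope.

(** * Integration *)

(** Both claims are read off one event of probability at least 1 - 2/A, where A = n eps. On it the
    posterior mean of h(theta) = H^2(P_theta, P_theta0) is small, and the squared total variation
    distance is at most h ([tv_distance_sqr_le]).

    The posterior has density proportional to the product of the rho_i^alpha with respect to the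
    prior. By Jensen's inequality ([fractional_posterior_expR_le]), n c times the posterior mean of
    h is at most the logarithm of a quotient. The numerator is the prior average of exp(n c h)
    prod_i rho_i^alpha; its expectation is at most 1, by the pointwise inequality [powR_sqrt_le].
    The denominator is the evidence, which must be bounded below for the observed sample.

    A bound on the evidence must depend on the covariates, yet only the mean of |X| may appear in
    the result. [prior_integral_ge] therefore has product form: a constant times prod_i 1 / f(X_i),
    for every sample. The factors f(X_i) are moved into the numerator, where independence integrates
    them ([integral_tilted_evidence_le]), and Markov's inequality is used only once
    ([tilted_evidence_markov]).

    The product form rests on positive definiteness of Gaussian kernels. The Student density is a
    mixture of Gaussian autocorrelations ([studentd_smixd]), so the evidence becomes a double
    integral against a product of Gaussian kernels. [gauss_kernel_prod_ge] bounds this below by a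
    square, and [slab_student_ge] evaluates the result.

    The final count, in [posterior_hellinger2_event], is (2 alpha A + 1/8) + (A - 1/8) + A = 2
    (alpha + 1) A: the tilt f, the Markov threshold together with the numerical constants, and the
    translation of the prior to [theta0]. *)

Section integral_facts.
Context d (T : measurableType d) (R : realType).
Implicit Types (mu : {measure set T -> \bar R}) (f g : T -> \bar R).

Import HBNNSimple.

(** The integral of a nonnegative function is a supremum over simple functions below it, so
    monotonicity needs no measurability. This covers the total variation integrand, whose
    measurability in the parameter is not established. *)
Lemma ge0_le_integral_nomeas mu f g : (forall x, 0 <= f x) ->
  (forall x, f x <= g x) -> \int[mu]_x f x <= \int[mu]_x g x.
Proof.
move=> f0 fg; have g0 x : 0 <= g x by exact: le_trans (fg x).
rewrite !ge0_integralTE//; apply: le_ereal_sup => _ [h hf <-].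
by exists h => // x; exact: le_trans (hf x) (fg x).
Qed.

(** [nu] is a mixture of point masses at [phi i x] with weights [w i x]; the formula passes from
    indicators to simple functions to monotone limits. A singleton [I] gives measures with a
    density, and [I] = [bool] gives the joint law of label and covariate. *)
Lemma ge0_integral_mixture d' (X : measurableType d') (I : finType)
    (mu : {measure set X -> \bar R}) (nu : {measure set T -> \bar R})
    (w : I -> X -> R) (phi : I -> X -> T) (g : T -> \bar R) :
  (forall i, measurable_fun setT (w i)) ->
  (forall i x, (0 <= w i x)%R) ->
  (forall i, measurable_fun setT (phi i)) ->
  (forall A, measurable A ->
    nu A = \int[mu]_x (\sum_i w i x * \1_A (phi i x))%R%:E) ->
  measurable_fun setT g -> (forall y, 0 <= g y) ->
  \int[nu]_y g y = \int[mu]_x \sum_i (w i x)%:E * g (phi i x).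
Proof.
move=> mw w0 mphi nuE mg g0; pose g_ := nnsfun_approx measurableT mg.
have mgphi i n : measurable_fun setT (fun x => g_ n (phi i x)).
  exact: measurableT_comp.
transitivity (limn (fun n => \int[nu]_y (g_ n y)%:E)).
  rewrite -monotone_convergence//.
  - apply: eq_integral => y _; apply/esym/cvg_lim => //.
    exact: cvg_nnsfun_approx.
  - by move=> n; exact/measurable_EFinP.
  - by move=> n y _; rewrite lee_fin.
  - by move=> y _ m n mn; rewrite lee_fin; exact/lefP/nd_nnsfun_approx.
rewrite [X in limn X](_ : _ = (fun n =>
    \int[mu]_x (\sum_i w i x * g_ n (phi i x))%R%:E)).
  rewrite -monotone_convergence//; last 3 first.
  - move=> n; apply/measurable_EFinP/measurable_sum => i.
    exact: measurable_funM.
  - by move=> n x _; rewrite lee_fin sumr_ge0// => i _; rewrite mulr_ge0.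
  - move=> x _ m n mn; rewrite lee_fin ler_sum// => i _.
    by rewrite ler_wpM2l//; exact/lefP/nd_nnsfun_approx.
  apply: eq_integral => x _; apply/cvg_lim => //.
  rewrite [X in X @ _ --> _](_ : _ = fun n => \sum_i (w i x)%:E * (g_ n (phi i x))%:E).
    apply: cvg_nnesum => i _.
      by apply: nearW => n; rewrite mule_ge0// lee_fin.
    apply: cvgeZl => //; exact: cvg_nnsfun_approx.
  by apply/funext => n; rewrite -sumEFin.
apply/funext => n.
rewrite integralT_nnsfun sintegralE.
transitivity (\sum_(r \in range (g_ n))
    \int[mu]_x (r * \sum_i w i x * \1_(g_ n @^-1` [set r]) (phi i x))%R%:E).
  apply: eq_fsbigr => r; rewrite inE => -[y _ ry].
  rewrite nuE//; under [RHS]eq_integral do rewrite EFinM.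
  rewrite ge0_integralZl//.
  - apply/measurable_EFinP/measurable_sum => i; apply: measurable_funM => //.
    by apply: measurableT_comp => //; exact: measurable_indic.
  - by move=> x _; rewrite lee_fin sumr_ge0// => i _; rewrite mulr_ge0.
  - by rewrite lee_fin -ry.
rewrite -ge0_integral_fsum//.
- apply: eq_integral => x _; rewrite fsumEFin//; congr EFin.
  under eq_fsbigr do rewrite mulr_sumr.
  rewrite fsbig_finite//= exchange_big/=; apply: eq_bigr => i _.
  rewrite [in RHS]fimfunE mulrC fsbig_finite//= mulr_suml; apply: eq_bigr => r _.
  by rewrite mulrCA mulrC.
- move=> r; apply/measurable_EFinP/measurable_funM => //; apply: measurable_sum => i.
  apply: measurable_funM => //.
  by apply: measurableT_comp => //; exact: measurable_indic.
- move=> r x _; have [r0|r0] := leP 0%R r.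
    by rewrite lee_fin mulr_ge0// sumr_ge0// => i _; rewrite mulr_ge0.
  by rewrite preimage_nnfun0// big1 ?mulr0// => i _; rewrite indic0 mulr0.
Qed.

Lemma ge0_integral_mdensity mu (f : T -> R) (mf : measurable_fun setT f)
    (f0 : forall x, (0 <= f x)%R) g :
  measurable_fun setT g -> (forall x, 0 <= g x) ->
  \int[mdensity mu mf f0]_x g x = \int[mu]_x ((f x)%:E * g x).
Proof.
move=> mg g0.
rewrite [LHS](@ge0_integral_mixture _ _ 'I_1 mu _ (fun=> f) (fun=> id))//.
  by apply: eq_integral => x _; rewrite big_ord1.
move=> A mA; rewrite /mdensity /= [LHS]integral_mkcond; apply: eq_integral => x _.
by rewrite big_ord1 patchE indicE; case: ifP; rewrite (mulr1, mulr0).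
Qed.

Lemma ge0_integral_mnormalize mu (P : probability T R) g (e : R) :
  (0 < e)%R -> mu setT = e%:E ->
  measurable_fun setT g -> (forall x, 0 <= g x) ->
  \int[mnormalize mu P]_x g x = e^-1%:E * \int[mu]_x g x.
Proof.
move=> e0 muE mg g0; have e0' : (0 <= e^-1)%R by rewrite invr_ge0 ltW.
rewrite -[e^-1%R]/((NngNum e0')%:num)%R -ge0_integral_mscale//.
apply: eq_measure_integral => A mA _.
by rewrite /= /mnormalize muE /= eqe gt_eqF//= /mscale/= muleC.
Qed.

Lemma ge0_integralZR mu (k : R) (f : T -> R) : (0 <= k)%R ->
  measurable_fun setT f -> (forall x, (0 <= f x)%R) ->
  \int[mu]_x (k * f x)%:E = k%:E * \int[mu]_x (f x)%:E.
Proof.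
move=> k0 mf f0; rewrite -ge0_integralZl//; first exact/measurable_EFinP.
by move=> x _; rewrite lee_fin.
Qed.

(** Integrate 2 t a b <= a^2 + t^2 b^2: t = 1 shows that the integral of a b is finite, and t equal
    to that integral gives the claim. [a] is extended real because in the applications it is itself
    an integral. *)
Lemma cauchy_schwarz_unit mu (a : T -> \bar R) (b : T -> R) :
  measurable_fun setT a -> measurable_fun setT b ->
  (forall x, 0 <= a x) -> (forall x, (0 <= b x)%R) ->
  \int[mu]_x (b x ^+ 2)%:E <= 1 ->
  (\int[mu]_x (a x * (b x)%:E)) ^+ 2 <= \int[mu]_x (a x ^+ 2).
Proof.
move=> ma mb a0 b0 b1.
have I0 : 0 <= \int[mu]_x (a x * (b x)%:E).
  by apply: integral_ge0 => x _; rewrite mule_ge0// lee_fin.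
have a20 x : 0 <= a x ^+ 2 by exact: expe_ge0.
have ma2 : measurable_fun setT (fun x => a x ^+ 2).
  by rewrite (_ : (fun _ => _) = a \* a)%E; [exact: emeasurable_funM|apply/funext => x; rewrite expe2].
have J0 : 0 <= \int[mu]_x (a x ^+ 2) by exact: integral_ge0.
have [Joo|] := eqVneq (\int[mu]_x (a x ^+ 2)) +oo; first by rewrite Joo leey.
rewrite -ltey -ge0_fin_numE// => Jfin.
have key (t : R) : (0 <= t)%R -> (2 * t)%:E * \int[mu]_x (a x * (b x)%:E) <=
    \int[mu]_x (a x ^+ 2) + (t ^+ 2)%:E.
  move=> t0; rewrite -ge0_integralZl//; last 3 first.
  - by apply: emeasurable_funM => //; exact/measurable_EFinP.
  - by move=> x _; rewrite mule_ge0// lee_fin.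
  - by rewrite lee_fin mulr_ge0.
  apply: (@le_trans _ _ (\int[mu]_x (a x ^+ 2 + (t ^+ 2 * b x ^+ 2)%:E))).
    apply: ge0_le_integral_nomeas => x.
      by rewrite mule_ge0 ?lee_fin ?mulr_ge0// mule_ge0// lee_fin.
    case: (a x) (a0 x) => // [r _|_]; last first.
      by rewrite expe2 mulyy addye// leey.
    rewrite -?EFin_expe -?EFinM -?EFinD lee_fin.
    rewrite -subr_ge0; apply: le_trans (sqr_ge0 (r - t * b x)%R) _.
    by rewrite le_eqVlt; apply/orP; left; apply/eqP; ring.
  rewrite ge0_integralD//; last 2 first.
  - by move=> x _; rewrite lee_fin mulr_ge0// sqr_ge0.
  - by apply/measurable_EFinP/measurable_funM => //; exact: measurable_funX.
  rewrite leeD2l//; under eq_integral do rewrite EFinM.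
  rewrite ge0_integralZl//; last 3 first.
  - exact/measurable_EFinP/measurable_funX.
  - by move=> x _; rewrite lee_fin sqr_ge0.
  - by rewrite lee_fin sqr_ge0.
  by rewrite -[leRHS]mule1 lee_pmul ?lee_fin ?sqr_ge0// integral_ge0// => x _; rewrite lee_fin sqr_ge0.
have Ifin : \int[mu]_x (a x * (b x)%:E) \is a fin_num.
  rewrite ge0_fin_numE//.
  have /(le_lt_trans) := key 1%R ler01.
  have : \int[mu]_x (a x ^+ 2) + (1 ^+ 2)%:E < +oo.
    by apply: lte_add_pinfty; [rewrite -ge0_fin_numE|rewrite ltry].
  move=> h /(_ _ h); case: (\int[mu]_x (a x * (b x)%:E)) I0 => //.
    by move=> r _ _; rewrite ltry.
  by rewrite gt0_muley ?lte_fin ?mulr1.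
move: key I0; rewrite -(fineK Ifin) -(fineK Jfin); set I := fine _; set J := fine _.
move=> key; rewrite lee_fin => I0; have := key _ I0.
rewrite -EFinM -EFinD -EFin_expe !lee_fin => h; lra.
Qed.

End integral_facts.

(** * Integration over finite product measures *)

Section mpower_facts.
Context d (T : measurableType d) (R : realType).
Variable mu : {sigma_finite_measure set T -> \bar R}.

(* Stated for all sets, so that events need not be proved measurable. *)
Lemma le_mpower n (A B : set (n.-tuple T)) :
  A `<=` B -> mpower mu n A <= mpower mu n B.
Proof.
elim: n A B => [|n IHn] A B AB /=.
  rewrite !diracE lee_fin ler_nat; case: (boolP (_ \in A)) => // /set_mem /AB AB'.
  by rewrite mem_set.
rewrite /mcons /pushforward /product_measure1.
apply: ge0_le_integral_nomeas => x //=; apply: IHn => t.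
by rewrite /xsection /= !inE; exact: AB.
Qed.

Lemma ge0_integral_mpowerS n (f : n.+1.-tuple T -> \bar R) :
  measurable_fun setT f -> (forall t, 0 <= f t) ->
  \int[mpower mu n.+1]_t f t =
  \int[mu]_x \int[mpower mu n]_t f (tcons (x, t)).
Proof.
move=> mf f0.
have mtc : measurable_fun setT (@tcons _ T n) := @measurable_tcons _ T n.
rewrite (_ : \int[mpower mu n.+1]_t f t =
    \int[pushforward (mu \x mpower mu n) (@tcons _ T n)]_t f t)//.
rewrite ge0_integral_pushforward// preimage_setT.
rewrite fubini_tonelli1//; first exact: measurableT_comp mf mtc.
by move=> z; exact: f0.
Qed.

Lemma measurable_prod_tnth n (phi : 'I_n -> T -> R) :
  (forall i, measurable_fun setT (phi i)) ->
  measurable_fun setT (fun t : n.-tuple T => \prod_(i < n) phi i (tnth t i))%R.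
Proof.
move=> mphi; apply: measurable_prod => i _.
by apply: measurableT_comp => //; exact: measurable_tnth.
Qed.

Lemma ge0_integral_mpower_prod n (phi : 'I_n -> T -> R) :
  (forall i, measurable_fun setT (phi i)) -> (forall i x, (0 <= phi i x)%R) ->
  \int[mpower mu n]_t (\prod_(i < n) phi i (tnth t i))%:E =
  \prod_(i < n) \int[mu]_x (phi i x)%:E.
Proof.
elim: n phi => [|n IHn] phi mphi phi0.
  rewrite [LHS]integral_dirac//= ?big_ord0 ?diracT ?mul1e//.
  by rewrite (_ : (fun=> _) = cst 1)//; apply/funext => t; rewrite big_ord0.
rewrite ge0_integral_mpowerS; last 2 first.
- by apply/measurable_EFinP; apply: measurable_prod_tnth.
- by move=> t; rewrite lee_fin prodr_ge0.
rewrite big_ord_recl -IHn; last 2 first.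
- by move=> i; exact: mphi.
- by move=> i x; exact: phi0.
rewrite -ge0_integralZr//; last 3 first.
- exact/measurable_EFinP.
- by move=> x _; rewrite lee_fin.
- by apply: integral_ge0 => t _; rewrite lee_fin prodr_ge0.
apply: eq_integral => x _; rewrite -ge0_integralZl//; last 3 first.
- by apply/measurable_EFinP; apply: (@measurable_prod_tnth n (fun i => phi (lift ord0 i))) => i; exact: mphi.
- by move=> t _; rewrite lee_fin prodr_ge0.
- by rewrite lee_fin.
apply: eq_integral => t _; rewrite -EFinM; congr EFin.
rewrite big_ord_recl; congr (phi _ _ * _)%R => //.
by apply: eq_bigr => i _; rewrite tnthS.
Qed.

End mpower_facts.

(** * Lebesgue measure on the line: affine substitution, Gaussian integrals, translation *)

Section lebesgue_real_facts.
Variable R : realType.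
Local Notation leb := (@lebesgue_real R).

Lemma ge0_integral_lebesgue_real (f : R -> \bar R) :
  measurable_fun setT f -> (forall x, 0 <= f x) ->
  \int[leb]_x f x = \int[lebesgue_measure]_(x in [set: measurableTypeR R]) f x.
Proof.
move=> mf f0.
rewrite (_ : \int[leb]_x f x = \int[pushforward lebesgue_measure
    (fun x : measurableTypeR R => x : R)]_x f x)//.
by rewrite ge0_integral_pushforward.
Qed.

Lemma ge0_integral_affine (a b : R) (f : R -> R) :
  (0 < a)%R -> continuous f -> (forall x, (0 <= f x)%R) ->
  \int[leb]_x (f x)%:E = \int[leb]_x (a * f (a * x + b))%:E.
Proof.
move=> a0 cf f0.
have dF (x : R) : is_derive x 1%R (fun x => a * x + b)%R a.
  by apply: is_derive_eq; rewrite /GRing.scale/= ?mulr1 ?mulr0 ?addr0 ?add0r.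
have F'E : derive1 (fun x : R => a * x + b)%R = cst a.
  by apply/funext => x; rewrite derive1E derive_val.
have mf : measurable_fun setT f by exact: continuous_measurable_fun.
have mF : measurable_fun setT (fun x => a * x + b)%R.
  by apply: measurable_funD => //; exact: measurable_funM.
rewrite [LHS]ge0_integral_lebesgue_real//; last exact/measurable_EFinP.
rewrite [RHS]ge0_integral_lebesgue_real//; last 2 first.
- by apply/measurable_EFinP/measurable_funM => //; exact: measurableT_comp mf mF.
- by move=> x; rewrite lee_fin mulr_ge0// ltW.
rewrite (@increasing_ge0_integration_by_substitutionT _ (fun x => a * x + b)%R)//.
- by apply: eq_integral => x _; rewrite /= F'E mulrC.
- by move=> x y xy; rewrite ltrD2r ltr_pM2l.
- by rewrite F'E => x; exact: cvg_cst.
- by rewrite F'E; exact: is_cvg_cst.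
- by rewrite F'E; exact: is_cvg_cst.
- apply/cvgrNyPle => M; exists (a^-1 * (M - b))%R; split => [|x /ltW]; first exact: num_real.
  by rewrite ler_pdivlMl// lerBrDr.
- apply/cvgryPge => M; exists (a^-1 * (M - b))%R; split => [|x /ltW]; first exact: num_real.
  by rewrite ler_pdivrMl// lerBlDr.
Qed.

Lemma integral_gauss_affine (p c : R) : (0 < p)%R ->
  \int[leb]_y (expR (- (p * (y - c) ^+ 2)))%:E = (Num.sqrt (pi / p))%:E.
Proof.
move=> p0; have sp0 : (0 < Num.sqrt p)%R by rewrite sqrtr_gt0.
have mh : measurable_fun setT (fun y : R => expR (- (p * (y - c) ^+ 2))).
  apply: measurableT_comp => //; apply: measurableT_comp => //.
  by apply: measurable_funM => //; apply: measurable_funX; exact: measurable_funB.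
rewrite sqrtrM ?pi_ge0// sqrtrV ?(ltW p0)// EFinM.
transitivity (\int[leb]_y ((Num.sqrt p)^-1%:E * (Num.sqrt p * gauss_fun (Num.sqrt p * y + - (Num.sqrt p * c)))%:E)).
  apply: eq_integral => y _; rewrite -EFinM mulKf ?gt_eqF// /gauss_fun.
  by rewrite -mulrBr exprMn sqr_sqrtr// ltW.
rewrite ge0_integralZl//; last 2 first.
- apply/measurable_EFinP/measurable_funM => //.
  apply: (measurableT_comp (@measurable_gauss_fun R)).
  by apply: measurable_funD => //; exact: measurable_funM.
- by move=> x _; rewrite lee_fin mulr_ge0 ?sqrtr_ge0// gauss_fun_ge0.
rewrite -ge0_integral_affine//; last 2 first.
- exact: continuous_gauss_fun.
- exact: gauss_fun_ge0.
rewrite ge0_integral_lebesgue_real; last 2 first.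
- by apply/measurable_EFinP; exact: measurable_gauss_fun.
- by move=> x; rewrite lee_fin gauss_fun_ge0.
by rewrite integralT_gauss muleC.
Qed.

(** [f] is only measurable here, so the substitution rule for continuous functions does not apply;
    instead the translated measure agrees with Lebesgue measure on half-open intervals, which
    determine it. *)
Lemma ge0_integral_shift (a : R) (f : R -> \bar R) :
  measurable_fun setT f -> (forall x, 0 <= f x) ->
  \int[leb]_x f (a + x)%R = \int[leb]_x f x.
Proof.
move=> mf f0.
have ma : measurable_fun setT (fun x : measurableTypeR R => (a + x)%R : measurableTypeR R).
  exact: measurable_funD.
have ma' : measurable_fun setT (fun x : R => (a + x)%R) by exact: measurable_funD.
rewrite ge0_integral_lebesgue_real//; last exact: measurableT_comp mf ma'.
rewrite [RHS]ge0_integral_lebesgue_real//.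
transitivity (\int[pushforward lebesgue_measure
    (fun x : measurableTypeR R => (a + x)%R : measurableTypeR R)]_x f x).
  by rewrite ge0_integral_pushforward.
apply: eq_measure_integral => A mA _; apply/esym.
apply: (@lebesgue_measure_unique R (pushforward lebesgue_measure
    (fun x : measurableTypeR R => (a + x)%R : measurableTypeR R))) => // _ [[u v] _ <-].
rewrite /= /pushforward (_ : _ @^-1` _ = `](u - a)%R, (v - a)%R]%classic).
  by rewrite !lebesgue_measure_itv/= !lte_fin ltrD2r -!EFinB opprB addrA subrK.
by apply/seteqP; split => x /=; rewrite !in_itv/= ltrBlDl lerBrDl.
Qed.

End lebesgue_real_facts.

(** * Translation invariance of Lebesgue measure on tuples *)

Section lebesgue_tuple_shift.
Variable R : realType.

Definition tadd n (a x : n.-tuple R) : n.-tuple R :=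
  [tuple (tnth a i + tnth x i)%R | i < n].

Lemma measurable_tadd n (a : n.-tuple R) : measurable_fun setT (tadd a).
Proof.
apply/measurable_fun_tnthP => i; rewrite (_ : _ \o _ = fun x => tnth a i + tnth x i)%R.
  by apply: measurable_funD => //; exact: measurable_tnth.
by apply/funext => x; rewrite /= tnth_mktuple.
Qed.

Lemma ge0_integral_tadd n (a : n.-tuple R) (f : n.-tuple R -> \bar R) :
  measurable_fun setT f -> (forall x, 0 <= f x) ->
  \int[lebesgue_tuple R n]_x f (tadd a x) = \int[lebesgue_tuple R n]_x f x.
Proof.
rewrite /lebesgue_tuple; elim: n a f => [|n IHn] a f mf f0.
  by apply: eq_integral => x _; congr f; apply/eq_from_tnth => -[].
have mfa : measurable_fun setT (fun x => f (tadd a x)).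
  exact: measurableT_comp mf (measurable_tadd a).
rewrite !ge0_integral_mpowerS//.
have mft := measurableT_comp mf (@measurable_tcons _ _ n).
transitivity (\int[@lebesgue_real R]_x
    (fun y => \int[mpower (@lebesgue_real R) n]_t f (tcons (y, t))) (thead a + x)%R).
  apply: eq_integral => x _.
  rewrite -(IHn [tuple of behead a] (fun t => f (tcons (thead a + x, t)%R)))//; last first.
    exact: (measurableT_comp mft (pair1_measurable (thead a + x)%R)).
  apply: eq_integral => t _; congr f; apply/eq_from_tnth => i.
  case: (unliftP ord0 i) => [j|] ->.
    rewrite tnth_mktuple [RHS]tnthS [RHS]tnth_mktuple tnth_behead tnthS.
    by congr (tnth a _ + _)%R; apply/val_inj; rewrite /= inordK// ltnS.
  by rewrite tnth_mktuple !tnth0.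
apply: (@ge0_integral_shift R (thead a) (fun y => \int[mpower (@lebesgue_real R) n]_t f (tcons (y, t)))).
  exact: (measurable_fun_fubini_tonelli_F (fun z => f (tcons z))).
by move=> x; exact: integral_ge0.
Qed.

End lebesgue_tuple_shift.

(** * Gaussian kernels and Cauchy-Schwarz *)

Section gaussian_kernel.
Variable R : realType.
Local Notation leb := (@lebesgue_real R).
Implicit Types a p q v c : R.
Local Open Scope ring_scope.

(** The prefactor is a fourth root, so that a product of two kernels with the same [a] carries the
    square root of [a], the form of a Gaussian normalising constant. *)
Definition gker a p v c : R := Num.sqrt (Num.sqrt a) * expR (- (p * (c - v) ^+ 2)).

Lemma gker_ge0 a p v c : 0 <= gker a p v c.
Proof. by rewrite mulr_ge0 ?sqrtr_ge0 ?expR_ge0. Qed.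

Lemma measurable_gker d (Y : measurableType d) a p (v c : Y -> R) :
  measurable_fun setT v -> measurable_fun setT c ->
  measurable_fun setT (fun y => gker a p (v y) (c y)).
Proof.
move=> mv mc; apply: measurable_funM => //.
apply: measurableT_comp => //; apply: measurableT_comp => //.
by apply: measurable_funM => //; apply: measurable_funX; exact: measurable_funB.
Qed.

Lemma integral_gker_mul a a' p p' v v' : 0 <= a -> 0 < p -> 0 < p' ->
  (\int[leb]_c (gker a p v c * gker a' p' v' c)%:E)%E =
  (Num.sqrt (Num.sqrt (a * a')) * Num.sqrt (pi / (p + p')) *
    expR (- (p * p' / (p + p') * (v - v') ^+ 2)))%:E.
Proof.
move=> a0 p0 p'0; have pp'0 : 0 < p + p' by rewrite addr_gt0.
(* The precision-weighted mean of the two centres: completing the square there splits off a Gaussian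
   in v - v'. *)
pose m := (p * v + p' * v') / (p + p').
transitivity (\int[leb]_c ((Num.sqrt (Num.sqrt (a * a')) *
    expR (- (p * p' / (p + p') * (v - v') ^+ 2)))%:E *
    (expR (- ((p + p') * (c - m) ^+ 2)))%:E))%E.
  apply: eq_integral => c _; rewrite -EFinM; congr EFin.
  rewrite /gker mulrACA -[RHS]mulrA !sqrtrM ?sqrtr_ge0//; congr (_ * _).
  rewrite -!expRD; congr expR; rewrite /m; field.
  by rewrite gt_eqF.
under eq_integral do rewrite -EFinM.
rewrite ge0_integralZR; last 3 first.
- by rewrite mulr_ge0 ?sqrtr_ge0 ?expR_ge0.
- apply: measurableT_comp => //; apply: measurableT_comp => //.
  by apply: measurable_funM => //; apply: measurable_funX; exact: measurable_funB.
- by move=> c; exact: expR_ge0.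
by rewrite integral_gauss_affine// -EFinM mulrAC.
Qed.

Lemma integral_gker_sqr p v v' : 0 < p ->
  (\int[leb]_c (gker (4 * p / pi) (2 * p) v c * gker (4 * p / pi) (2 * p) v' c)%:E)%E =
  (expR (- (p * (v - v') ^+ 2)))%:E.
Proof.
move=> p0; have [P PE P0] : exists2 P : R, pi = P & 0 < P by exists pi; rewrite ?pi_gt0.
have a0 : 0 < 4 * p / P by rewrite divr_gt0// mulr_gt0.
have p4 : 0 < 2 * p + 2 * p by rewrite addr_gt0// mulr_gt0.
rewrite PE integral_gker_mul ?mulr_gt0// ?(ltW a0)//; congr EFin.
rewrite PE -expr2 sqrtr_sqr gtr0_norm// -sqrtrM ?(ltW a0)//.
rewrite (_ : 4 * p / P * _ = 1) ?sqrtr1 ?mul1r; last first.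
  by field; rewrite !gt_eqF.
by rewrite (_ : 2 * p * (2 * p) / (2 * p + 2 * p) = p)//; field; rewrite gt_eqF.
Qed.

(** Inner product of the kernel centred at [v] with a unit Gaussian centred at 0, [q ^+ 2] being the
    ratio of the two precisions ([integral_gker_gfeature]). *)
Definition gfeature p q v : R :=
  Num.sqrt (2 * q / (1 + q ^+ 2)) * expR (- (2 * p * q ^+ 2 / (1 + q ^+ 2) * v ^+ 2)).

Lemma gfeature_ge0 p q v : 0 <= gfeature p q v.
Proof. by rewrite mulr_ge0 ?sqrtr_ge0 ?expR_ge0. Qed.

Lemma measurable_gfeature d (Y : measurableType d) p q (v : Y -> R) :
  measurable_fun setT v -> measurable_fun setT (fun y => gfeature p q (v y)).
Proof.
move=> mv; apply: measurable_funM => //.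
apply: measurableT_comp => //; apply: measurableT_comp => //.
by apply: measurable_funM => //; exact: measurable_funX.
Qed.

Lemma integral_gker_gfeature p q v : 0 < p -> 0 < q ->
  (\int[leb]_c (gker (4 * p / pi) (2 * p) v c *
    gker (4 * (p * q ^+ 2) / pi) (2 * (p * q ^+ 2)) 0 c)%:E)%E =
  (gfeature p q v)%:E.
Proof.
move=> p0 q0; have [P PE P0] : exists2 P : R, pi = P & 0 < P by exists pi; rewrite ?pi_gt0.
have q20 : 0 < q ^+ 2 by rewrite exprn_gt0.
have a0 : 0 < 4 * p / P by rewrite divr_gt0// mulr_gt0.
have b0 : 0 < 4 * p * q / P by rewrite divr_gt0// !mulr_gt0.
have r0 : 0 < 1 + q ^+ 2 by rewrite addr_gt0.
have s0 : 0 < 2 * p + 2 * (p * q ^+ 2) by rewrite addr_gt0// !mulr_gt0.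
rewrite PE integral_gker_mul ?mulr_gt0// ?(ltW a0)//; congr EFin.
rewrite PE (_ : 4 * p / P * _ = (4 * p * q / P) ^+ 2); last first.
  by field; rewrite gt_eqF.
rewrite sqrtr_sqr gtr0_norm// -sqrtrM ?(ltW b0)// subr0.
rewrite /gfeature (_ : 4 * p * q / P * _ = 2 * q / (1 + q ^+ 2)); last first.
  by field; rewrite !gt_eqF.
rewrite (_ : _ / (2 * p + 2 * (p * q ^+ 2)) = 2 * p * q ^+ 2 / (1 + q ^+ 2))//.
by field; rewrite !gt_eqF.
Qed.

End gaussian_kernel.

Section gaussian_kernel_product.
Context d (Y : measurableType d) (R : realType).
Variable nu : {sigma_finite_measure set Y -> \bar R}.
Local Notation leb := (@lebesgue_real R).

(* Each factor [expR (- p (v - v')^2)] is an integral over [c] of a product    *)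
(* [k v c * k v' c]; integrating against the unit vector [w c] and applying    *)
(* Cauchy-Schwarz in [c] removes it, after which [k (v y) c] joins [Phi].      *)
Lemma gauss_kernel_prod_ge (I : eqType) (s : seq I) (v : I -> Y -> R)
    (p q : I -> R) (Phi : Y -> R) :
  (forall i, measurable_fun setT (v i)) ->
  (forall i, 0 < p i)%R -> (forall i, 0 < q i)%R ->
  measurable_fun setT Phi -> (forall y, 0 <= Phi y)%R ->
  (\int[nu]_y (Phi y * \prod_(i <- s) gfeature (p i) (q i) (v i y))%:E) ^+ 2 <=
  \int[nu]_y \int[nu]_y' (Phi y * Phi y' *
     \prod_(i <- s) expR (- (p i * (v i y - v i y') ^+ 2)))%:E.
Proof.
move=> mv p0 q0; elim: s Phi => [|i s IHs] Phi mPhi Phi0.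
  have I0 : 0 <= \int[nu]_y (Phi y)%:E by apply: integral_ge0 => y _; rewrite lee_fin.
  under eq_integral do rewrite big_nil mulr1.
  under [leRHS]eq_integral => y _.
    under eq_integral do rewrite big_nil mulr1 EFinM.
    rewrite ge0_integralZl//; [|exact/measurable_EFinP|by move=> ? _; rewrite lee_fin|by rewrite lee_fin].
    over.
  rewrite ge0_integralZr// ?expe2//; [exact/measurable_EFinP|by move=> y _; rewrite lee_fin].
pose k y c := gker (4 * p i / pi) (2 * p i) (v i y) c.
pose w (c : R) := gker (4 * (p i * q i ^+ 2) / pi) (2 * (p i * q i ^+ 2)) 0 c.
pose P y := (\prod_(j <- s) gfeature (p j) (q j) (v j y))%R.
pose K (y y' : Y) := (\prod_(j <- s) expR (- (p j * (v j y - v j y') ^+ 2)))%R.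
have k0 y c : (0 <= k y c)%R by exact: gker_ge0.
have w0 c : (0 <= w c)%R by exact: gker_ge0.
have P0 y : (0 <= P y)%R by apply: prodr_ge0 => j _; exact: gfeature_ge0.
have K0 y y' : (0 <= K y y')%R by apply: prodr_ge0 => j _; exact: expR_ge0.
have mP : measurable_fun setT P by apply: measurable_prod => j _; exact: measurable_gfeature.
have mw : measurable_fun setT w by exact: measurable_gker.
have w1 : \int[leb]_c (w c ^+ 2)%:E <= 1.
  rewrite (_ : \int[leb]_c (w c ^+ 2)%:E = 1)//.
  under eq_integral do rewrite expr2.
  by rewrite integral_gker_sqr ?mulr_gt0 ?exprn_gt0// subrr expr0n/= mulr0 oppr0 expR0.
pose F (z : R * Y * Y) :=
  (Phi z.1.2 * k z.1.2 z.1.1 * (Phi z.2 * k z.2 z.1.1) * K z.1.2 z.2)%:E.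
have mF : measurable_fun setT F.
  have m1 : measurable_fun [set: R * Y * Y] (fun z => z.1.1).
    exact: measurableT_comp measurable_fst measurable_fst.
  have m2 : measurable_fun [set: R * Y * Y] (fun z => z.1.2).
    exact: measurableT_comp measurable_snd measurable_fst.
  have m3 : measurable_fun [set: R * Y * Y] (fun z => z.2) by exact: measurable_snd.
  apply/measurable_EFinP; apply: measurable_funM;
    first (apply: measurable_funM; apply: measurable_funM).
  - exact: measurableT_comp mPhi m2.
  - by apply: measurable_gker => //; exact: measurableT_comp (mv i) m2.
  - exact: measurableT_comp mPhi m3.
  - by apply: measurable_gker => //; exact: measurableT_comp (mv i) m3.
  apply: measurable_prod => j _; apply: measurableT_comp => //; apply: measurableT_comp => //.
  apply: measurable_funM => //; apply: measurable_funX; apply: measurable_funB.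
    exact: measurableT_comp (mv j) m2.
  exact: measurableT_comp (mv j) m3.
have F0 z : 0 <= F z by rewrite lee_fin !mulr_ge0.
have mG : measurable_fun [set: R * Y] (fun z => (Phi z.2 * k z.2 z.1 * P z.2)%:E).
  have m1 : measurable_fun [set: R * Y] (fun z => z.1) by exact: measurable_fst.
  have m2 : measurable_fun [set: R * Y] (fun z => z.2) by exact: measurable_snd.
  apply/measurable_EFinP; apply: measurable_funM; first apply: measurable_funM.
  - exact: measurableT_comp mPhi m2.
  - by apply: measurable_gker => //; exact: measurableT_comp (mv i) m2.
  - exact: measurableT_comp mP m2.
have -> : \int[nu]_y \int[nu]_y' (Phi y * Phi y' *
     \prod_(i <- i :: s) expR (- (p i * (v i y - v i y') ^+ 2)))%:E =
   \int[leb]_c \int[nu]_y \int[nu]_y' F ((c, y), y').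
  rewrite (fubini_tonelli (fun z => \int[nu]_y' F (z, y'))); last 2 first.
  - exact: measurable_fun_fubini_tonelli_F.
  - by move=> z; exact: integral_ge0.
  apply: eq_integral => y _; rewrite (fubini_tonelli (fun z => F ((z.1, y), z.2)))//; last first.
    apply: measurableT_comp mF _; apply: measurable_fun_pair => //.
    by apply: measurable_fun_pair => //; exact: measurable_fst.
  apply: eq_integral => y' _; rewrite big_cons [X in (_ * X)%:E]mulrC mulrA EFinM.
  rewrite -integral_gker_sqr// -ge0_integralZR; last 3 first.
  - by apply: mulr_ge0; [exact: mulr_ge0|exact: K0].
  - by apply: measurable_funM; apply: measurable_gker.
  - by move=> c; apply: mulr_ge0; exact: gker_ge0.
  by apply: eq_integral => c _; rewrite /F /=; congr EFin; rewrite -/(K y y') -/(k y c) -/(k y' c); move: (K _ _) (k _ _) (k _ _) => K1 k1 k2; ring.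
apply: (@le_trans _ _ (\int[leb]_c (\int[nu]_y (Phi y * k y c * P y)%:E) ^+ 2)).
  apply: le_trans; last apply: (cauchy_schwarz_unit _ mw _ w0 w1); last 2 first.
  - apply: (measurable_fun_fubini_tonelli_F (fun z => (Phi z.2 * k z.2 z.1 * P z.2)%:E)) => // z.
    by rewrite lee_fin !mulr_ge0.
  - by move=> c; apply: integral_ge0 => y _; rewrite lee_fin !mulr_ge0.
  rewrite le_eqVlt; apply/orP; left; apply/eqP; congr (_ ^+ 2).
  transitivity (\int[leb]_c \int[nu]_y ((Phi y * k y c * P y)%:E * (w c)%:E)).
    rewrite (fubini_tonelli (fun z => (Phi z.2 * k z.2 z.1 * P z.2)%:E * (w z.1)%:E)); last 2 first.
    - apply: emeasurable_funM => //; apply/measurable_EFinP.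
      exact: measurableT_comp mw measurable_fst.
    - by move=> z; rewrite mule_ge0// lee_fin ?mulr_ge0.
    apply: eq_integral => y _; rewrite big_cons mulrCA mulrC EFinM.
    rewrite -integral_gker_gfeature// -ge0_integralZR; last 3 first.
    - by apply: mulr_ge0; [exact: Phi0|exact: P0].
    - by apply: measurable_funM; apply: measurable_gker.
    - by move=> c; apply: mulr_ge0; exact: gker_ge0.
    by apply: eq_integral => c _; rewrite -EFinM; congr EFin; rewrite -/(P y) -/(k y c) -/(w c); ring.
  apply: eq_integral => c _; rewrite ge0_integralZr//.
  - by apply/measurable_EFinP; apply: measurable_funM => //; apply: measurable_funM => //; exact: measurable_gker.
  - by move=> y _; rewrite lee_fin !mulr_ge0.
  - by rewrite lee_fin.
apply: ge0_le_integral_nomeas => c; first by apply: expe_ge0; apply: integral_ge0 => y _; rewrite lee_fin !mulr_ge0.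
apply: (IHs (fun y => Phi y * k y c)%R) => [|y]; last by apply: mulr_ge0; [exact: Phi0|exact: gker_ge0].
by apply: measurable_funM => //; exact: measurable_gker.
Qed.

End gaussian_kernel_product.

(** * Student densities as Gaussian mixtures *)

Section student.
Variables (R : realType).
Local Notation leb := (@lebesgue_real R).
Local Open Scope ring_scope.

Let den_gt0 (u : R) : 0 < 1 + u ^+ 2.
Proof. by rewrite ltr_pwDl// sqr_ge0. Qed.

Lemma continuous_student tau : 0 < tau ->
  continuous (fun u : R => (tau ^+ 2 + u ^+ 2) ^- 2).
Proof.
move=> tau0 u; apply: (@cvgV _ _ _ _ (fun u : R => (tau ^+ 2 + u ^+ 2) ^+ 2)).
  by rewrite gt_eqF// exprn_gt0// ltr_pwDl ?exprn_gt0// sqr_ge0.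
have cd : (fun u : R => tau ^+ 2 + u ^+ 2) x @[x --> u] --> tau ^+ 2 + u ^+ 2.
  by apply: cvgD; [exact: cvg_cst|exact: exprn_continuous].
under eq_fun do rewrite expr2.
rewrite expr2; exact: cvgM.
Qed.

Let F (u : R) : R := 2^-1 * (u / (1 + u ^+ 2) + atan u).
Let G (u : R) : R := atan u - F u.

Let is_derive_F (u : R) : is_derive u 1 F ((1 + u ^+ 2) ^- 2).
Proof.
have un0 : 1 + u ^+ 2 != 0 by rewrite gt_eqF.
have d1 : is_derive u 1 (fun u : R => 1 + u ^+ 2) (2 * u).
  by apply: is_derive_eq; rewrite /GRing.scale/=; ring.
have d2 := @is_deriveV R (fun u : R => 1 + u ^+ 2) u _ 1 un0 d1.
have d3 : is_derive u 1 (fun u : R => u / (1 + u ^+ 2) + atan u)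
    (u * (- (1 + u ^+ 2) ^- 2 * (2 * u)) + (1 + u ^+ 2)^-1 * 1 + (1 + u ^+ 2)^-1).
  apply: is_deriveD; exact: (is_deriveM (is_derive_id _ _) d2).
apply: (is_derive_eq (is_deriveZ 2^-1 d3)); rewrite /GRing.scale/=.
by field.
Qed.

Let is_derive_G (u : R) : is_derive u 1 G (u ^+ 2 / (1 + u ^+ 2) ^+ 2).
Proof.
have un0 : 1 + u ^+ 2 != 0 by rewrite gt_eqF.
apply: (is_derive_eq (is_deriveB (is_derive1_atan u) (is_derive_F u))).
by field.
Qed.

Let cvgy_F : F x @[x --> +oo] --> (pi / 4 : R).
Proof.
have -> : (pi / 4 : R) = 2^-1 * (0 + pi / 2) by rewrite add0r mulrCA -invfM -natrM.
suff h : (fun x : R => x / (1 + x ^+ 2)) x @[x --> +oo] --> (0 : R).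
  exact: (cvgM (cvg_cst _) (cvgD h (@cvgy_atan R))).
apply: (@squeeze_cvgr _ _ _ _ (cst 0) (fun x => x^-1)).
- near=> x; have x0 : 0 < x by near: x; exact: nbhs_pinfty_gt.
  apply/andP; split; first by rewrite divr_ge0// ltW.
  rewrite ler_pdivrMr// mulrDr mulr1 expr2 mulrA mulVf ?gt_eqF// mul1r.
  by rewrite lerDr invr_ge0 ltW.
- exact: cvg_cst.
- apply/gtr0_cvgV0; [|exact: cvg_id].
  by near=> x; near: x; exact: nbhs_pinfty_gt.
Unshelve. all: by end_near. Qed.

(** An even function has twice its integral over the half-line. The derivative of [K] has to match
    [f] only for positive x, so that x^3 can stand in for |x|^3. *)
Let integral_FTC_half (f k K : R -> R) (l : R) : (forall x, 0 <= f x) -> continuous f ->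
  K 0 = 0 -> (forall x : R, is_derive x 1 K (k x)) ->
  (forall x, 0 < x -> k x = f x) -> K x @[x --> +oo] --> l ->
  f =1 f \o -%R -> (\int[leb]_u (f u)%:E)%E = (l + l)%:E.
Proof.
move=> f0 cf K0 dK kf Kl fN.
rewrite ge0_integral_lebesgue_real; last 2 first.
- by apply/measurable_EFinP; exact: continuous_measurable_fun.
- by move=> x; rewrite lee_fin.
rewrite ge0_symfun_integralT// -set_itvcy (@ge0_continuous_FTC2y _ f K 0 l)//.
- by rewrite K0 sube0 -EFinM; congr EFin; ring.
- exact: continuous_subspaceT.
- apply: cvg_at_right_filter; apply: differentiable_continuous.
  by apply/derivable1_diffP; exact: ex_derive.
- by move=> x; rewrite in_itv/= andbT => x0; rewrite derive1E -kf//; exact: derive_val.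
Qed.

Lemma integral_student (tau : R) : 0 < tau ->
  (\int[leb]_u ((tau ^+ 2 + u ^+ 2) ^- 2)%:E)%E = (tau ^- 3 * (pi / 2))%:E.
Proof.
move=> tau0; have tn0 : tau != 0 by rewrite gt_eqF.
have h1 : (\int[leb]_u ((1 ^+ 2 + u ^+ 2) ^- 2)%:E)%E = (pi / 4 + pi / 4)%:E.
  apply: (@integral_FTC_half _ (fun u => (1 + u ^+ 2) ^- 2) F (pi / 4)).
  - by move=> x; rewrite invr_ge0 sqr_ge0.
  - exact: continuous_student.
  - by rewrite /F mul0r atan0 addr0 mulr0.
  - exact: is_derive_F.
  - by move=> u _; rewrite expr1n.
  - exact: cvgy_F.
  - by move=> u; rewrite /comp sqrrN.
rewrite (@ge0_integral_affine R tau 0)//; last 2 first.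
- exact: continuous_student.
- by move=> u; rewrite invr_ge0 sqr_ge0.
transitivity (\int[leb]_u (tau ^- 3 * (1 ^+ 2 + u ^+ 2) ^- 2)%:E)%E.
  apply: eq_integral => u _; congr EFin; rewrite addr0 exprMn expr1n.
  by field; rewrite tn0 !gt_eqF//= ltr_pwDl ?exprn_gt0 ?sqr_ge0.
rewrite ge0_integralZR ?h1 ?invr_ge0 ?exprn_ge0 ?(ltW tau0)//.
- by rewrite -EFinM; congr (_ * _)%:E; lra.
- by apply: continuous_measurable_fun; exact: continuous_student.
- by move=> u; rewrite invr_ge0 sqr_ge0.
Qed.

Lemma integral_sqr_student (tau : R) : 0 < tau ->
  (\int[leb]_u (u ^+ 2 * (tau ^+ 2 + u ^+ 2) ^- 2)%:E)%E = (tau^-1 * (pi / 2))%:E.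
Proof.
move=> tau0; have tn0 : tau != 0 by rewrite gt_eqF.
have cs (t : R) : 0 < t -> continuous (fun u : R => u ^+ 2 * (t ^+ 2 + u ^+ 2) ^- 2).
  move=> t0 u; apply: cvgM; first exact: exprn_continuous.
  exact: continuous_student.
have h1 : (\int[leb]_u (u ^+ 2 * (1 ^+ 2 + u ^+ 2) ^- 2)%:E)%E = ((pi / 2 - pi / 4) + (pi / 2 - pi / 4))%:E.
  have cG : G x @[x --> +oo] --> (pi / 2 - pi / 4 : R) by exact: (cvgB (@cvgy_atan R) cvgy_F).
  apply: (@integral_FTC_half _ (fun u => u ^+ 2 * (1 + u ^+ 2) ^- 2) G (pi / 2 - pi / 4)).
  - by move=> x; rewrite mulr_ge0 ?invr_ge0 ?sqr_ge0.
  - exact: cs.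
  - by rewrite /G /F mul0r atan0 addr0 mulr0 subr0.
  - exact: is_derive_G.
  - by move=> u _; rewrite expr1n.
  - exact: cG.
  - by move=> u; rewrite /comp sqrrN.
rewrite (@ge0_integral_affine R tau 0)//; last 2 first.
- exact: cs.
- by move=> u; rewrite mulr_ge0 ?invr_ge0 ?sqr_ge0.
transitivity (\int[leb]_u (tau^-1 * (u ^+ 2 * (1 ^+ 2 + u ^+ 2) ^- 2))%:E)%E.
  apply: eq_integral => u _; congr EFin; rewrite addr0 exprMn expr1n.
  by field; rewrite tn0 !gt_eqF//= ltr_pwDl ?exprn_gt0 ?sqr_ge0.
rewrite ge0_integralZR ?h1 ?invr_ge0 ?(ltW tau0)//.
- by rewrite -EFinM; congr (_ * _)%:E; lra.
- by apply: continuous_measurable_fun; exact: cs.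
- by move=> u; rewrite mulr_ge0 ?invr_ge0 ?sqr_ge0.
Qed.

Let H (q x : R) : R := q ^- 2 / 2 - (2 * q)^-1 * ((x ^+ 2 + q^-1) * expR (- (q * x ^+ 2))).

Let is_derive_H (q x : R) : 0 < q ->
  is_derive x 1 (H q) (x ^+ 3 * expR (- (q * x ^+ 2))).
Proof.
move=> q0; have d1 : is_derive x 1 (fun x : R => - (q * x ^+ 2)) (- (q * (2 * x))).
  by apply: is_derive_eq; rewrite /GRing.scale/=; ring.
have d2 : is_derive x 1 (fun x : R => expR (- (q * x ^+ 2)))
    (expR (- (q * x ^+ 2)) * - (q * (2 * x))).
  exact: (@is_derive1_comp _ expR (fun x : R => - (q * x ^+ 2)) x _ _ (is_derive_expR _) d1).
have d3 : is_derive x 1 (fun x : R => x ^+ 2 + q^-1) (2 * x).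
  by apply: is_derive_eq; rewrite /GRing.scale/=; ring.
have d4 := is_deriveM d3 d2.
have d5 := is_deriveB (is_derive_cst (q ^- 2 / 2) x 1) (is_deriveZ (2 * q)^-1 d4).
apply: (is_derive_eq d5); rewrite /GRing.scale/=.
by field; rewrite gt_eqF.
Qed.

Let cvgy_H (q : R) : 0 < q -> H q x @[x --> +oo] --> (q ^- 2 / 2 : R).
Proof.
move=> q0.
suff h : (fun x : R => (x ^+ 2 + q^-1) * expR (- (q * x ^+ 2))) x @[x --> +oo] --> (0 : R).
  have := cvgB (cvg_cst (q ^- 2 / 2)) (cvgM (cvg_cst (2 * q)^-1) h).
  by rewrite mulr0 subr0; apply.
apply: (@squeeze_cvgr _ _ _ _ (cst 0) (fun x => (q^-1 * (4 * q^-1)) * x^-1)).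
- near=> x; have x1 : 1 <= x by near: x; exact: nbhs_pinfty_ge.
  have x0 : 0 < x by exact: lt_le_trans x1.
  apply/andP; split.
    by rewrite mulr_ge0 ?expR_ge0// addr_ge0 ?sqr_ge0// invr_ge0 ltW.
  set t := q * x ^+ 2; have t0 : 0 < t by rewrite mulr_gt0// exprn_gt0.
  (* Squared, this gives exp t >= (1 + t/2)^2. Since q x <= t for x >= 1, the bound reduces to t (t
     + 1) <= 4 (1 + t/2)^2, which is the source of the constant 4. *)
  have e1 : (1 + t / 2) <= expR (t / 2) by exact: expR_ge1Dx.
  have e2 : (1 + t / 2) ^+ 2 <= expR t.
    rewrite [X in expR X](_ : t = t / 2 + t / 2) ?expRD ?expr2; last by lra.
    by apply: ler_pM => //; rewrite addr_ge0// divr_ge0// ltW.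
  rewrite expRN ler_pdivrMr ?expR_gt0//.
  apply: le_trans (ler_wpM2l _ e2); last first.
    by rewrite !mulr_ge0// invr_ge0 ltW.
  have -> : x ^+ 2 + q^-1 = q^-1 * (t + 1) by rewrite /t; field; rewrite gt_eqF.
  rewrite (_ : _ * (1 + t / 2) ^+ 2 = q^-1 * ((q * x)^-1 * (4 * (1 + t / 2) ^+ 2))); last first.
    by field; rewrite !gt_eqF.
  rewrite ler_pM2l ?invr_gt0// ler_pdivlMl ?mulr_gt0//.
  have qxt : q * x <= t by rewrite ler_pM2l// expr2 ler_peMl// ltW.
  nra.
- exact: cvg_cst.
- rewrite -(mulr0 (q^-1 * (4 * q^-1))); apply: cvgM; first exact: cvg_cst.
  apply/gtr0_cvgV0; [|exact: cvg_id].
  by near=> x; near: x; exact: nbhs_pinfty_gt.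
Unshelve. all: by end_near. Qed.

(** At q = tau^2 + u^2 this exhibits the Student kernel (tau^2 + u^2)^-2 as a mixture over x of
    Gaussians in u. *)
Lemma integral_cube_gauss (q : R) : 0 < q ->
  (\int[leb]_x (`|x| ^+ 3 * expR (- (q * x ^+ 2)))%:E)%E = (q ^- 2)%:E.
Proof.
move=> q0; transitivity ((q ^- 2 / 2 + q ^- 2 / 2)%:E); last by rewrite -splitr.
apply: (@integral_FTC_half _ (fun x => x ^+ 3 * expR (- (q * x ^+ 2))) (H q) (q ^- 2 / 2)).
- by move=> x; rewrite mulr_ge0 ?expR_ge0// exprn_ge0.
- move=> x; apply: cvgM.
    apply: (@continuous_comp _ _ _ (fun x : R => `|x|) (fun y : R => y ^+ 3)).
      exact: norm_continuous.
    exact: exprn_continuous.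
  apply: (@continuous_comp _ _ _ (fun x : R => - (q * x ^+ 2)) expR).
    apply: cvgN; apply: cvgM; [exact: cvg_cst|exact: exprn_continuous].
  exact: continuous_expR.
- rewrite /H expr0n/= mulr0 oppr0 expR0 add0r mulr1.
  by field; rewrite gt_eqF.
- by move=> x; exact: is_derive_H.
- by move=> x x0; rewrite gtr0_norm.
- exact: cvgy_H.
- by move=> x; rewrite /comp normrN sqrrN.
Qed.

End student.

(* [expR (- x^2 u^2)] is, up to a factor, the autocorrelation of               *)
(* [y |-> expR (- 2 x^2 y^2)]; integrating over the scale [x] represents the   *)
(* Student density as a mixture of autocorrelations.                           *)
Section student_mixture.
Variables (R : realType) (tau : R).
Local Notation leb := (@lebesgue_real R).
Local Open Scope ring_scope.

(** The prefactor is chosen so that the autocorrelation in y is exactly the integrand of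
    [integral_cube_gauss] at q = tau^2 + u^2. *)
Definition smix (x y : R) : R :=
  Num.sqrt (2 / Num.sqrt pi) * x ^+ 2 * expR (- (x ^+ 2 * tau ^+ 2 / 2)) *
  expR (- (2 * x ^+ 2 * y ^+ 2)).

Definition smix_mass (x : R) : R :=
  Num.sqrt (2 / Num.sqrt pi) * Num.sqrt (pi / 2) * `|x| *
  expR (- (x ^+ 2 * tau ^+ 2 / 2)).

Lemma smix_ge0 x y : 0 <= smix x y.
Proof.
by do 2 (apply: mulr_ge0; last exact: expR_ge0); rewrite mulr_ge0 ?sqrtr_ge0 ?sqr_ge0.
Qed.

Lemma smix_mass_ge0 x : 0 <= smix_mass x.
Proof. by rewrite /smix_mass !mulr_ge0 ?expR_ge0 ?sqrtr_ge0. Qed.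

Lemma measurable_smix d (Y : measurableType d) (x y : Y -> R) :
  measurable_fun setT x -> measurable_fun setT y ->
  measurable_fun setT (fun t => smix (x t) (y t)).
Proof.
move=> mx my; have mx2 : measurable_fun setT (fun t => x t ^+ 2) by exact: measurable_funX.
have my2 : measurable_fun setT (fun t => y t ^+ 2) by exact: measurable_funX.
apply: measurable_funM; first apply: measurable_funM; first exact: measurable_funM.
  apply: measurableT_comp => //; apply: measurableT_comp => //.
  by apply: measurable_funM => //; exact: measurable_funM.
apply: measurableT_comp => //; apply: measurableT_comp => //.
by apply: measurable_funM => //; exact: measurable_funM.
Qed.

Lemma measurable_smix_mass d (Y : measurableType d) (x : Y -> R) :
  measurable_fun setT x -> measurable_fun setT (fun t => smix_mass (x t)).
Proof.
move=> mx; have mx2 : measurable_fun setT (fun t => x t ^+ 2) by exact: measurable_funX.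
apply: measurable_funM.
  by apply: measurable_funM => //; exact: measurableT_comp.
apply: measurableT_comp => //; apply: measurableT_comp => //.
by apply: measurable_funM => //; exact: measurable_funM.
Qed.

Let sqrt_pi_gt0 : 0 < Num.sqrt (pi : R).
Proof. by rewrite sqrtr_gt0 pi_gt0. Qed.

Let measurable_gauss p c :
  measurable_fun setT (fun y : R => expR (- (p * (y - c) ^+ 2))).
Proof.
apply: measurableT_comp => //; apply: measurableT_comp => //.
by apply: measurable_funM => //; apply: measurable_funX; exact: measurable_funB.
Qed.

Let measurable_gauss0 p : measurable_fun setT (fun y : R => expR (- (p * y ^+ 2))).
Proof.
apply: measurableT_comp => //; apply: measurableT_comp => //.
by apply: measurable_funM => //; exact: measurable_funX.
Qed.

Let integral_gauss0 p : 0 < p ->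
  (\int[leb]_y (expR (- (p * y ^+ 2)))%:E)%E = (Num.sqrt (pi / p))%:E.
Proof.
move=> p0; rewrite -(@integral_gauss_affine R p 0 p0).
by apply: eq_integral => y _; rewrite subr0.
Qed.

Lemma integral_smix x : (\int[leb]_y (smix x y)%:E)%E = (smix_mass x)%:E.
Proof.
have [->|x0] := eqVneq x 0.
  rewrite /smix_mass normr0 mulr0 mul0r integral0_eq// => y _.
  by rewrite /smix expr0n/= mulr0 !mul0r.
rewrite ge0_integralZR; last 3 first.
- by apply: mulr_ge0; rewrite ?expR_ge0// mulr_ge0 ?sqrtr_ge0 ?sqr_ge0.
- exact: measurable_gauss0.
- by move=> y; exact: expR_ge0.
have x20 : 0 < x ^+ 2 by rewrite exprn_even_gt0.
rewrite integral_gauss0; last by rewrite pmulr_rgt0.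
rewrite -EFinM /smix_mass; congr EFin.
rewrite (_ : pi / (2 * x ^+ 2) = pi / 2 / x ^+ 2); last by rewrite invfM mulrA.
rewrite [Num.sqrt (pi / 2 / _)]sqrtrM ?divr_ge0 ?pi_ge0// sqrtrV ?(ltW x20)// sqrtr_sqr.
rewrite -[X in _ * X * expR _ * _]real_normK ?num_real//.
move: (Num.sqrt (2 / _)) (Num.sqrt (pi / 2)) (expR _) => a b e.
by field; rewrite normr_eq0.
Qed.

(** Complete the square: 2 y^2 + 2 (u + y)^2 = 4 (y + u/2)^2 + u^2. *)
Lemma integral_smix_mul x u :
  (\int[leb]_y (smix x y * smix x (u + y))%:E)%E =
  (`|x| ^+ 3 * expR (- ((tau ^+ 2 + u ^+ 2) * x ^+ 2)))%:E.
Proof.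
have [->|x0] := eqVneq x 0.
  rewrite normr0 expr0n/= mul0r integral0_eq// => y _.
  by rewrite /smix expr0n/= mulr0 !mul0r.
have x20 : 0 < x ^+ 2 by rewrite exprn_even_gt0.
transitivity (\int[leb]_y (2 / Num.sqrt pi * x ^+ 4 *
    expR (- ((tau ^+ 2 + u ^+ 2) * x ^+ 2)) *
    expR (- (4 * x ^+ 2 * (y - - (u / 2)) ^+ 2)))%:E)%E.
  apply: eq_integral => y _; congr EFin; rewrite /smix.
  set c := Num.sqrt (2 / _).
  have -> : 2 / Num.sqrt pi = c ^+ 2 by rewrite sqr_sqrtr ?divr_ge0 ?sqrtr_ge0.
  rewrite -[RHS]mulrA -expRD.
  have -> : - ((tau ^+ 2 + u ^+ 2) * x ^+ 2) - 4 * x ^+ 2 * (y - - (u / 2)) ^+ 2 =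
    - (x ^+ 2 * tau ^+ 2 / 2) - (2 * x ^+ 2 * y ^+ 2) - (x ^+ 2 * tau ^+ 2 / 2)
    - (2 * x ^+ 2 * (u + y) ^+ 2) by field.
  by rewrite !expRD; ring.
rewrite ge0_integralZR; last 3 first.
- apply: mulr_ge0; last exact: expR_ge0.
  apply: mulr_ge0; last by rewrite exprn_even_ge0.
  by apply: divr_ge0 => //; exact: sqrtr_ge0.
- exact: measurable_gauss.
- by move=> y; exact: expR_ge0.
rewrite integral_gauss_affine; last by rewrite pmulr_rgt0.
rewrite -EFinM; congr EFin.
rewrite (_ : 4 * x ^+ 2 = (2 * `|x|) ^+ 2); last by rewrite exprMn real_normK ?num_real//; congr (_ * _); ring.
rewrite sqrtrM ?pi_ge0// sqrtrV ?exprn_ge0 ?mulr_ge0// sqrtr_sqr ger0_norm ?mulr_ge0//.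
rewrite (_ : x ^+ 4 = `|x| ^+ 4); last by rewrite -[4%N]/(2 * 2)%N !exprM real_normK ?num_real.
move: sqrt_pi_gt0; set s := Num.sqrt pi => s0; field.
by rewrite normr_eq0 x0 gt_eqF.
Qed.

Hypothesis tau0 : 0 < tau.

(** Weighting each Gaussian by its own mass, instead of correlating it with itself, keeps the mixing
    law and halves the variance at every scale x. The outcome is again a Student density, contracted
    by sqrt 2. *)
Lemma integral_smix_mass_smix y :
  (\int[leb]_x (smix_mass x * smix x y)%:E)%E =
  (Num.sqrt 2 * (tau ^+ 2 + (Num.sqrt 2 * y) ^+ 2) ^- 2)%:E.
Proof.
rewrite exprMn sqr_sqrtr//.
have q0 : 0 < tau ^+ 2 + 2 * y ^+ 2 by rewrite ltr_pwDl ?exprn_gt0// mulr_ge0// sqr_ge0.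
rewrite EFinM -(integral_cube_gauss q0) -ge0_integralZR; last 3 first.
- exact: sqrtr_ge0.
- apply: measurable_funM; first by apply: measurable_funX; exact: normr_measurable.
  exact: measurable_gauss0.
- by move=> x; rewrite mulr_ge0 ?expR_ge0// exprn_ge0.
apply: eq_integral => x _; congr EFin; rewrite /smix /smix_mass.
have -> : - ((tau ^+ 2 + 2 * y ^+ 2) * x ^+ 2) =
  - (x ^+ 2 * tau ^+ 2 / 2) - (x ^+ 2 * tau ^+ 2 / 2) - (2 * x ^+ 2 * y ^+ 2) by field.
rewrite !expRD.
have x2 : x ^+ 2 = `|x| ^+ 2 by rewrite real_normK ?num_real.
have sc : Num.sqrt 2 = Num.sqrt (2 / Num.sqrt pi) ^+ 2 * Num.sqrt (pi / 2) :> R.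
  rewrite sqr_sqrtr ?divr_ge0 ?sqrtr_ge0// sqrtrM ?pi_ge0// sqrtrV//.
  have s20 : 0 < Num.sqrt (2 : R) by rewrite sqrtr_gt0.
  have s2 : Num.sqrt (2 : R) ^+ 2 = 2 by rewrite sqr_sqrtr.
  move: sqrt_pi_gt0; set s := Num.sqrt pi => s0.
  rewrite -[X in X / s]s2; field.
  by rewrite !gt_eqF.
rewrite sc; set a := Num.sqrt (2 / _); set b := Num.sqrt (pi / 2).
set e1 := expR (- (x ^+ 2 * tau ^+ 2 / 2)); set e2 := expR (- (2 * x ^+ 2 * y ^+ 2)).
by rewrite x2; ring.
Qed.

End student_mixture.

(** * Inequalities for finite sums and for the loss of one observation *)

Section finite_sums.
Variable R : realType.
Local Open Scope ring_scope.

(** Lagrange's identity: twice the difference of the two sides is the sum of the (x_i y_j - x_j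
    y_i)^2. *)
Lemma sum_cauchy_schwarz n (x y : 'I_n -> R) :
  (\sum_i x i * y i) ^+ 2 <= (\sum_i x i ^+ 2) * (\sum_i y i ^+ 2).
Proof.
have : 0 <= \sum_i \sum_j (x i * y j - x j * y i) ^+ 2.
  by apply: sumr_ge0 => i _; apply: sumr_ge0 => j _; exact: sqr_ge0.
have -> : \sum_i \sum_j (x i * y j - x j * y i) ^+ 2 =
    2 * ((\sum_i x i ^+ 2) * (\sum_i y i ^+ 2)) - 2 * (\sum_i x i * y i) ^+ 2.
  transitivity (\sum_i \sum_j (x i ^+ 2 * y j ^+ 2 + x j ^+ 2 * y i ^+ 2 -
      2 * ((x i * y i) * (x j * y j)))).
    by apply: eq_bigr => i _; apply: eq_bigr => j _; ring.
  have -> : (\sum_i x i * y i) ^+ 2 = \sum_i \sum_j (x i * y i) * (x j * y j).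
    by rewrite expr2 mulr_suml; apply: eq_bigr => i _; rewrite mulr_sumr.
  have E : (\sum_i x i ^+ 2) * (\sum_i y i ^+ 2) = \sum_i \sum_j x i ^+ 2 * y j ^+ 2.
    by rewrite mulr_suml; apply: eq_bigr => i _; rewrite mulr_sumr.
  have E' : (\sum_i x i ^+ 2) * (\sum_i y i ^+ 2) = \sum_i \sum_j x j ^+ 2 * y i ^+ 2.
    by rewrite E exchange_big.
  rewrite [2 * (_ * _)](_ : _ = \sum_i \sum_j x i ^+ 2 * y j ^+ 2 +
    \sum_i \sum_j x j ^+ 2 * y i ^+ 2); last by rewrite -E -E'; ring.
  rewrite mulr_sumr -big_split/= -sumrB.
  apply: eq_bigr => i _; rewrite mulr_sumr -big_split/= -sumrB.
  by apply: eq_bigr => j _.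
by rewrite subr_ge0 ler_pM2l.
Qed.

Lemma norm1_sqr_le d (y : d.-tuple R) :
  norm1 y ^+ 2 <= d%:R * \sum_(i < d) tnth y i ^+ 2.
Proof.
have := sum_cauchy_schwarz (fun=> 1) (fun i : 'I_d => `|tnth y i|).
rewrite (eq_bigr (fun i => `|tnth y i|)); last by move=> i _; rewrite mul1r.
rewrite [X in _ <= X * _](_ : _ = d%:R); last first.
  by rewrite (eq_bigr (fun=> 1)) ?sumr_const ?card_ord// => i _; rewrite expr1n.
by rewrite [X in _ <= _ * X](eq_bigr (fun i => tnth y i ^+ 2))// => i _; rewrite real_normK ?num_real.
Qed.

Lemma dot_sqr_le d (x y : d.-tuple R) :
  dot x y ^+ 2 <= norm2 x ^+ 2 * \sum_(i < d) tnth y i ^+ 2.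
Proof.
rewrite /norm2 sqr_sqrtr; last by apply: sumr_ge0 => i _; exact: sqr_ge0.
exact: sum_cauchy_schwarz.
Qed.

(* With the width and weight parameters chosen as [p = lam^2 (1+m) / (2m)] and *)
(* [q = 1 / (1+2m)], where [m = lam b], the loss per point is logarithmic in b. *)
Lemma point_loss_le (m : R) : 0 < m ->
  (1 + 4 * m)^-1 <= (1 + 2 * m) / (1 + 2 * m + 2 * m ^+ 2) *
    expR (- (m / (2 * (1 + m)) + m * (1 + m) / (1 + 2 * m + 2 * m ^+ 2))).
Proof.
move=> m0; set D := 1 + 2 * m + 2 * m ^+ 2.
have D0 : 0 < D by rewrite /D; nra.
have m10 : 0 < 1 + m by lra.
set E := (X in expR (- X)).
(* Positivity of this numerator makes 1 - E/2 positive, hence exp(-E) >= (1 - E/2)^2, and a rational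
   inequality remains. *)
pose N := 4 + 9 * m + 10 * m ^+ 2 + 4 * m ^+ 3.
have N0 : 0 < N by rewrite /N; have := exprn_gt0 2 m0; have := exprn_gt0 3 m0; lra.
have EN : 1 - E / 2 = N / (4 * (1 + m) * D).
  by rewrite /E /N /D; field; rewrite -/D !gt_eqF.
have eE : (1 - E / 2) ^+ 2 <= expR (- E).
  rewrite [X in expR X](_ : _ = - (E / 2) + - (E / 2)); last by lra.
  rewrite expRD -expr2; apply: lerXn2r; rewrite ?nnegrE ?expR_ge0//.
    by rewrite EN divr_ge0 ?ltW// !mulr_gt0.
  exact: expR_ge1Dx.
have q0 : 0 < (1 + 2 * m) / D by rewrite divr_gt0//; lra.
apply: (le_trans _ (ler_wpM2l (ltW q0) eE)).
rewrite EN expr_div_n.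
have -> : (1 + 2 * m) / D * (N ^+ 2 / (4 * (1 + m) * D) ^+ 2) =
   ((1 + 2 * m) * N ^+ 2) / (16 * (1 + m) ^+ 2 * D ^+ 3).
  by field; rewrite !gt_eqF.
have h0 : 0 < 16 * (1 + m) ^+ 2 * D ^+ 3.
  by rewrite mulr_gt0 ?exprn_gt0// mulr_gt0 ?exprn_gt0.
rewrite ler_pdivlMr// ler_pdivrMl; last by lra.
rewrite -subr_ge0.
(* With denominators cleared, every coefficient of the difference is positive. *)
have -> : (1 + 4 * m) * ((1 + 2 * m) * N ^+ 2) - 16 * (1 + m) ^+ 2 * D ^+ 3 =
    40 * m + 225 * m ^+ 2 + 570 * m ^+ 3 + 844 * m ^+ 4 + 760 * m ^+ 5 +
    400 * m ^+ 6 + 96 * m ^+ 7 by rewrite /N /D; ring.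
have h k : 0 <= m ^+ k by rewrite exprn_ge0 ?ltW.
have := (h 2%N, h 3%N, h 4%N); have := (h 5%N, h 6%N, h 7%N); case=> -[h5 h6] h7 -[[h2 h3] h4]; lra.
Qed.

End finite_sums.

(** * The product Student density on tuples, its moments and its mixture form *)

Section student_tuple.
Variables (R : realType) (tau : R) (d : nat).
Hypothesis tau0 : (0 < tau)%R.
Local Notation leb := (@lebesgue_real R).
Local Notation lebd := (@lebesgue_tuple R d).
Local Open Scope ring_scope.
Implicit Types x y u : d.-tuple R.

Definition student_mass : R := tau ^- 3 * (pi / 2).

Lemma student_mass_gt0 : 0 < student_mass.
Proof. by rewrite mulr_gt0 ?invr_gt0 ?exprn_gt0// divr_gt0 ?pi_gt0. Qed.

(** The density of U / sqrt 2 when U has the Student density: the same total mass and half the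
    second moment. *)
Definition student2 (y : R) : R :=
  Num.sqrt 2 * (tau ^+ 2 + (Num.sqrt 2 * y) ^+ 2) ^- 2.

Lemma student2_ge0 (y : R) : 0 <= student2 y.
Proof. by rewrite mulr_ge0 ?sqrtr_ge0// invr_ge0 sqr_ge0. Qed.

Let student_ge0 (u : R) : 0 <= (tau ^+ 2 + u ^+ 2) ^- 2.
Proof. by rewrite invr_ge0 sqr_ge0. Qed.

Let continuous_sqr_student :
  continuous (fun u : R => u ^+ 2 * (tau ^+ 2 + u ^+ 2) ^- 2).
Proof.
by move=> u; apply: cvgM; [exact: exprn_continuous|exact: continuous_student].
Qed.

Lemma continuous_student2 : continuous student2.
Proof.
move=> y; apply: cvgM; first exact: cvg_cst.
apply: (@continuous_comp _ _ _ (fun y : R => Num.sqrt 2 * y)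
  (fun u : R => (tau ^+ 2 + u ^+ 2) ^- 2)); last exact: continuous_student.
by apply: cvgM; [exact: cvg_cst|exact: cvg_id].
Qed.

Lemma measurable_student2 : measurable_fun setT student2.
Proof. exact: continuous_measurable_fun continuous_student2. Qed.

Lemma integral_student2 : (\int[leb]_y (student2 y)%:E)%E = student_mass%:E.
Proof.
rewrite /student_mass -integral_student// [RHS](@ge0_integral_affine R (Num.sqrt 2) 0)//.
- by apply: eq_integral => y _; rewrite addr0.
- exact: continuous_student.
Qed.

Lemma integral_sqr_student2 :
  (\int[leb]_y (y ^+ 2 * student2 y)%:E)%E = (tau ^+ 2 / 2 * student_mass)%:E.
Proof.
transitivity (2^-1%:E * \int[leb]_u (u ^+ 2 * (tau ^+ 2 + u ^+ 2) ^- 2)%:E)%E.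
  rewrite -ge0_integralZR ?invr_ge0//; last 2 first.
  - by apply: continuous_measurable_fun; exact: continuous_sqr_student.
  - by move=> u; apply: mulr_ge0; [exact: sqr_ge0|exact: student_ge0].
  rewrite [RHS](@ge0_integral_affine R (Num.sqrt 2) 0)//; last 2 first.
  - by move=> u; apply: cvgM; [exact: cvg_cst|exact: continuous_sqr_student].
  - move=> u; apply: mulr_ge0; first by rewrite invr_ge0.
    by apply: mulr_ge0; [exact: sqr_ge0|exact: student_ge0].
  apply: eq_integral => y _; congr EFin; rewrite addr0 /student2.
  set S := _ ^- 2; rewrite exprMn sqr_sqrtr//.
  by field.
rewrite integral_sqr_student// -EFinM; congr EFin; rewrite /student_mass.
move: (pi / 2) => P; field.
by rewrite gt_eqF.
Qed.

(** By Tonelli both sides are the double integral of [smix_mass tau x * smix tau x y]. This norm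
    later turns the mass into a unit vector for Cauchy-Schwarz. *)
Lemma integral_sqr_smix_mass :
  (\int[leb]_x (smix_mass tau x ^+ 2)%:E)%E = student_mass%:E.
Proof.
rewrite -integral_student2.
under [RHS]eq_integral do rewrite -integral_smix_mass_smix//.
have m1 : measurable_fun [set: R * R] (fun z => z.1) by exact: measurable_fst.
have m2 : measurable_fun [set: R * R] (fun z => z.2) by exact: measurable_snd.
rewrite -(fubini_tonelli (fun z => (smix_mass tau z.1 * smix tau z.1 z.2)%:E)); last 2 first.
- apply/measurable_EFinP; apply: measurable_funM; first exact: measurable_smix_mass.
  exact: measurable_smix.
- by move=> z; rewrite lee_fin mulr_ge0 ?smix_mass_ge0 ?smix_ge0.
apply: eq_integral => x _ /=; rewrite ge0_integralZR ?smix_mass_ge0//; last 2 first.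
- exact: measurable_smix.
- by move=> y; exact: smix_ge0.
by rewrite integral_smix -EFinM expr2.
Qed.

Definition studentd u : R := \prod_(i < d) (tau ^+ 2 + tnth u i ^+ 2) ^- 2.
Definition student2d y : R := \prod_(i < d) student2 (tnth y i).
Definition smixd x y : R := \prod_(i < d) smix tau (tnth x i) (tnth y i).
Definition smix_massd x : R := \prod_(i < d) smix_mass tau (tnth x i).

Lemma studentd_ge0 u : 0 <= studentd u.
Proof. by apply: prodr_ge0 => i _. Qed.

Lemma student2d_ge0 y : 0 <= student2d y.
Proof. by apply: prodr_ge0 => i _; exact: student2_ge0. Qed.

Lemma smixd_ge0 x y : 0 <= smixd x y.
Proof. by apply: prodr_ge0 => i _; exact: smix_ge0. Qed.

Lemma smix_massd_ge0 x : 0 <= smix_massd x.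
Proof. by apply: prodr_ge0 => i _; exact: smix_mass_ge0. Qed.

Lemma measurable_studentd : measurable_fun setT studentd.
Proof.
apply: (@measurable_prod_tnth _ _ _ d (fun=> (fun u : R => (tau ^+ 2 + u ^+ 2) ^- 2))) => i.
by apply: continuous_measurable_fun; exact: continuous_student.
Qed.

Lemma measurable_student2d : measurable_fun setT student2d.
Proof.
by apply: (@measurable_prod_tnth _ _ _ d (fun=> student2)) => i; exact: measurable_student2.
Qed.

Let mtnth (i : 'I_d) : measurable_fun [set: d.-tuple R] (fun u => tnth u i).
Proof. exact: measurable_tnth. Qed.

Lemma measurable_smixd dY (Y : measurableType dY) (x y : Y -> d.-tuple R) :
  measurable_fun setT x -> measurable_fun setT y ->
  measurable_fun setT (fun t => smixd (x t) (y t)).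
Proof.
move=> mx my; apply: measurable_prod => i _; apply: measurable_smix.
  exact: measurableT_comp (mtnth i) mx.
exact: measurableT_comp (mtnth i) my.
Qed.

Lemma measurable_smix_massd : measurable_fun setT smix_massd.
Proof.
apply: measurable_prod => i _; apply: measurable_smix_mass; exact: mtnth.
Qed.

Lemma prodEFin (I : finType) (f : I -> R) :
  (\prod_i (f i)%:E)%E = (\prod_i f i)%:E.
Proof.
by elim/big_rec2 : _ => // i a b _ ->; rewrite EFinM.
Qed.

Lemma integral_studentd : (\int[lebd]_u (studentd u)%:E)%E = (student_mass ^+ d)%:E.
Proof.
rewrite (@ge0_integral_mpower_prod _ _ _ _ d (fun=> (fun u : R => (tau ^+ 2 + u ^+ 2) ^- 2)))//.
  under eq_bigr do rewrite integral_student//.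
  by rewrite prodEFin prodr_const card_ord.
by move=> i; apply: continuous_measurable_fun; exact: continuous_student.
Qed.

Lemma integral_student2d : (\int[lebd]_y (student2d y)%:E)%E = (student_mass ^+ d)%:E.
Proof.
rewrite (@ge0_integral_mpower_prod _ _ _ _ d (fun=> student2)).
- under eq_bigr do rewrite integral_student2//.
  by rewrite prodEFin prodr_const card_ord.
- by move=> i; exact: measurable_student2.
- by move=> i y; exact: student2_ge0.
Qed.

Lemma integral_sqr_smix_massd :
  (\int[lebd]_x (smix_massd x ^+ 2)%:E)%E = (student_mass ^+ d)%:E.
Proof.
under eq_integral do rewrite /smix_massd -prodrXl.
rewrite (@ge0_integral_mpower_prod _ _ _ _ d (fun=> (fun x : R => smix_mass tau x ^+ 2))).
- under eq_bigr do rewrite integral_sqr_smix_mass//.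
  by rewrite prodEFin prodr_const card_ord.
- by move=> i; apply: measurable_funX; exact: measurable_smix_mass.
- by move=> i y; exact: sqr_ge0.
Qed.

Lemma integral_smix_massd_smixd y :
  (\int[lebd]_x (smix_massd x * smixd x y)%:E)%E = (student2d y)%:E.
Proof.
under eq_integral do rewrite /smix_massd -big_split/=.
rewrite (@ge0_integral_mpower_prod _ _ _ _ d
  (fun i (x : R) => smix_mass tau x * smix tau x (tnth y i))).
- by under eq_bigr do rewrite integral_smix_mass_smix//; rewrite prodEFin.
- by move=> i; apply: measurable_funM; [exact: measurable_smix_mass|exact: measurable_smix].
- by move=> i x; rewrite mulr_ge0 ?smix_ge0 ?smix_mass_ge0.
Qed.

Lemma studentd_smixd u :
  (\int[lebd]_x \int[lebd]_y (smixd x y * smixd x (tadd y u))%:E)%E = (studentd u)%:E.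
Proof.
transitivity (\int[lebd]_x (\prod_(i < d) (`|tnth x i| ^+ 3 *
    expR (- ((tau ^+ 2 + tnth u i ^+ 2) * tnth x i ^+ 2))))%:E)%E.
  apply: eq_integral => x _.
  under eq_integral do rewrite /smixd -big_split/=.
  transitivity (\int[lebd]_y (\prod_(i < d) (smix tau (tnth x i) (tnth y i) *
      smix tau (tnth x i) (tnth u i + tnth y i)))%:E)%E.
    apply: eq_integral => y _; congr EFin; apply: eq_bigr => i _.
    by rewrite tnth_mktuple addrC.
  rewrite (@ge0_integral_mpower_prod _ _ _ _ d (fun i (y : R) => smix tau (tnth x i) y *
      smix tau (tnth x i) (tnth u i + y))).
  - by under eq_bigr do rewrite integral_smix_mul; rewrite prodEFin.
  - by move=> i; apply: measurable_funM; apply: measurable_smix => //; exact: measurable_funD.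
  - by move=> i y; rewrite mulr_ge0 ?smix_ge0.
have q0 i : 0 < tau ^+ 2 + tnth u i ^+ 2 by rewrite ltr_pwDl ?exprn_gt0// sqr_ge0.
rewrite (@ge0_integral_mpower_prod _ _ _ _ d (fun i (x : R) => `|x| ^+ 3 *
    expR (- ((tau ^+ 2 + tnth u i ^+ 2) * x ^+ 2)))).
- by under eq_bigr do rewrite integral_cube_gauss//; rewrite prodEFin.
- move=> i; apply: measurable_funM; first by apply: measurable_funX; exact: normr_measurable.
  apply: measurableT_comp => //; apply: measurableT_comp => //.
  by apply: measurable_funM => //; exact: measurable_funX.
- by move=> i x; rewrite mulr_ge0 ?expR_ge0// exprn_ge0.
Qed.

Lemma integral_sqnorm_student2d :
  (\int[lebd]_y ((\sum_(j < d) tnth y j ^+ 2) * student2d y)%:E)%E =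
  (d%:R * (tau ^+ 2 / 2) * student_mass ^+ d)%:E.
Proof.
have mphi (j i : 'I_d) : measurable_fun setT
    (fun y : R => (if i == j then y ^+ 2 else 1) * student2 y).
  apply: measurable_funM; last exact: measurable_student2.
  by case: (i == j) => //; exact: measurable_funX.
have phi0 (j i : 'I_d) (y : R) : 0 <= (if i == j then y ^+ 2 else 1) * student2 y.
  by rewrite mulr_ge0 ?student2_ge0//; case: (i == j) => //; exact: sqr_ge0.
transitivity (\sum_(j < d) \int[lebd]_y (\prod_(i < d)
    ((if i == j then tnth y i ^+ 2 else 1) * student2 (tnth y i)))%:E)%E.
  rewrite -ge0_integral_sum//; last 2 first.
  - move=> j; apply/measurable_EFinP.
    exact: (@measurable_prod_tnth _ _ _ d (fun i (y : R) => (if i == j then y ^+ 2 else 1) * student2 y)).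
  - by move=> j y _; rewrite lee_fin prodr_ge0.
  apply: eq_integral => y _; rewrite sumEFin; congr EFin; rewrite mulr_suml.
  apply: eq_bigr => j _; rewrite big_split/= (bigD1 j)//= eqxx big1 ?mulr1//.
  by move=> i /negbTE ->.
rewrite (eq_bigr (fun=> (tau ^+ 2 / 2 * student_mass ^+ d)%:E)); last first.
  move=> j _; rewrite (@ge0_integral_mpower_prod _ _ _ _ d
    (fun i (y : R) => (if i == j then y ^+ 2 else 1) * student2 y))//.
  rewrite (eq_bigr (fun i => ((if i == j then tau ^+ 2 / 2 else 1) * student_mass)%:E)); last first.
    move=> i _; case: (i == j); first exact: integral_sqr_student2.
    by under eq_integral do rewrite mul1r; rewrite integral_student2 mul1r.
  rewrite prodEFin big_split/= prodr_const card_ord (bigD1 j)//= eqxx big1 ?mulr1//.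
  by move=> i /negbTE ->.
by rewrite sumEFin sumr_const card_ord; congr EFin; rewrite -[LHS]mulr_natl !mulrA.
Qed.

End student_tuple.

(** * Lower bound on the evidence under the centred Student density *)

Section evidence.
Variables (R : realType) (tau : R) (d : nat).
Hypotheses (tau0 : (0 < tau)%R) (d0 : (0 < d)%N).
Local Notation lebd := (@lebesgue_tuple R d).
Local Notation Z := (student_mass tau ^+ d)%R.
Local Open Scope ring_scope.
Implicit Types y u w : d.-tuple R.

Lemma ge0_le_integral_real dT (T : measurableType dT) (mu : {measure set T -> \bar R})
    (f g : T -> R) (r : R) : (forall x, 0 <= f x) -> (forall x, f x <= g x) ->
  (\int[mu]_x (g x)%:E)%E = r%:E -> exists2 s, 0 <= s & (\int[mu]_x (f x)%:E)%E = s%:E.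
Proof.
move=> f0 fg gr.
have I0 : (0 <= \int[mu]_x (f x)%:E)%E by apply: integral_ge0 => x _; rewrite lee_fin.
have : (\int[mu]_x (f x)%:E <= r%:E)%E.
  by rewrite -gr; apply: ge0_le_integral_nomeas => x; rewrite lee_fin.
move: I0; case: (\int[mu]_x _)%E => // s; rewrite !lee_fin => s0 _.
by exists s.
Qed.

Let Z0 : 0 < Z.
Proof. by rewrite exprn_gt0// student_mass_gt0. Qed.

Let ball_ind y : R := \1_(@l1_ball R d (d%:R * tau)) y.

Let ball_indE y : ball_ind y = if norm1 y <= d%:R * tau then 1 else 0.
Proof.
rewrite /ball_ind indicE; case: ifPn => [h|/negP h]; first by rewrite mem_set.
by rewrite memNset.
Qed.

Let ball_ind_le1 y : ball_ind y <= 1.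
Proof. by rewrite /ball_ind indicE; case: (_ \in _). Qed.

Let measurable_ball_ind : measurable_fun setT ball_ind.
Proof. by apply: measurable_indic; exact: measurable_l1_ball. Qed.

Let sqnorm y := \sum_(j < d) tnth y j ^+ 2.

Let sqnorm_ge0 y : 0 <= sqnorm y.
Proof. by apply: sumr_ge0 => j _; exact: sqr_ge0. Qed.

Let measurable_sqnorm : measurable_fun setT sqnorm.
Proof. by apply: measurable_sum => j; apply: measurable_funX; exact: measurable_tnth. Qed.

Let dtau0 : 0 < d%:R * tau.
Proof. by rewrite mulr_gt0// ltr0n. Qed.

(* Jensen's inequality for [student2d] conditioned on the l1 ball, whose       *)
(* probability is at least 1/2 by Markov's inequality for the squared norm.    *)
Lemma student2d_gauss_ge (C : R) : 0 <= C ->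
  ((expR (- (C * (d%:R * tau ^+ 2))) * (Z / 2))%:E <=
   \int[lebd]_y (ball_ind y * expR (- (C * sqnorm y)) * student2d tau y)%:E)%E.
Proof.
move=> C0; have M0 := @student2d_ge0 R tau d.
have mM : measurable_fun setT (@student2d R tau d) by exact: measurable_student2d.
have IM := @integral_student2d R tau d tau0.
have mS : measurable_fun setT (fun y => sqnorm y * student2d tau y).
  exact: measurable_funM.
have IS : (\int[lebd]_y (sqnorm y * student2d tau y)%:E)%E =
  (d%:R * (tau ^+ 2 / 2) * Z)%:E by exact: integral_sqnorm_student2d.
have mE : measurable_fun setT (fun y => expR (- (C * sqnorm y))).
  apply: measurableT_comp => //; apply: measurableT_comp => //.
  exact: measurable_funM.
have [I1 I10 I1E] : exists2 s, 0 <= s &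
    (\int[lebd]_y (ball_ind y * student2d tau y)%:E)%E = s%:E.
  apply: (ge0_le_integral_real _ _ IM) => y; first by rewrite mulr_ge0.
  by rewrite ler_piMl.
have [I2 I20 I2E] : exists2 s, 0 <= s & (\int[lebd]_y
    (ball_ind y * expR (- (C * sqnorm y)) * student2d tau y)%:E)%E = s%:E.
  apply: (ge0_le_integral_real _ _ IM) => y.
    by rewrite !mulr_ge0 ?expR_ge0.
  rewrite ler_piMl// mulr_ile1 ?expR_ge0//.
  by rewrite -expR0 ler_expR oppr_le0 mulr_ge0.
set a := C * (d%:R * tau ^+ 2).
have a0 : 0 <= a by rewrite mulr_ge0// mulr_ge0 ?ler0n ?sqr_ge0.
have k0 : 0 < d%:R * tau ^+ 2 by rewrite pmulr_rgt0 ?ltr0n// exprn_gt0.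
(* Markov's inequality: outside the ball, [norm1_sqr_le] forces the squared norm to be at least d
   tau^2, twice its mean d tau^2 / 2. *)
have h1 : Z <= I1 + Z / 2.
  have -> : Z / 2 = (d%:R * tau ^+ 2)^-1 * (d%:R * (tau ^+ 2 / 2) * Z).
    by rewrite mulrA -[X in X * Z]mulrA; field; rewrite pnatr_eq0 -lt0n d0 gt_eqF.
  rewrite -lee_fin EFinD EFinM -IS -I1E -IM -ge0_integralZR ?invr_ge0 ?(ltW k0)//; last first.
    by move=> y; rewrite mulr_ge0.
  rewrite -ge0_integralD//; last 4 first.
  - by move=> y _; rewrite lee_fin mulr_ge0.
  - by apply/measurable_EFinP; exact: measurable_funM.
  - by move=> y _; rewrite lee_fin mulr_ge0 ?invr_ge0 ?(ltW k0)// mulr_ge0.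
  - by apply/measurable_EFinP; exact: measurable_funM.
  apply: ge0_le_integral_nomeas => y; first by rewrite lee_fin.
  rewrite -EFinD lee_fin mulrA -mulrDl ler_peMl//.
  rewrite ball_indE; case: (leP (norm1 y)) => [_|].
    by rewrite lerDl mulr_ge0 ?invr_ge0 ?(ltW k0).
  rewrite add0r ler_pdivlMl// mulr1.
  move=> ylt; have := norm1_sqr_le y; rewrite -/(sqnorm y) => y1.
  have : (d%:R * tau) ^+ 2 <= norm1 y ^+ 2.
    by apply: lerXn2r; rewrite ?nnegrE ?(ltW dtau0) ?(ltW (lt_trans dtau0 ylt)) ?(ltW ylt).
  move=> /le_trans/(_ y1); rewrite exprMn expr2 -mulrA ler_pM2l// ltr0n//.
(* On the ball this is exp(a - C |y|^2) >= 1 + a - C |y|^2. The moment term equals a Z/2, so [h1]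
   leaves exp(a) I2 >= (1 + a) Z/2 - a Z/2 = Z/2. *)
have h2 : (1 + a) * I1 <= expR a * I2 + C * (d%:R * (tau ^+ 2 / 2) * Z).
  have m1 : measurable_fun setT (fun y => ball_ind y * student2d tau y) by exact: measurable_funM.
  have m2 : measurable_fun setT (fun y => ball_ind y * expR (- (C * sqnorm y)) * student2d tau y).
    by apply: measurable_funM => //; exact: measurable_funM.
  have g1 y : 0 <= ball_ind y * student2d tau y by rewrite mulr_ge0.
  have g2 y : 0 <= ball_ind y * expR (- (C * sqnorm y)) * student2d tau y.
    by rewrite !mulr_ge0 ?expR_ge0.
  have g3 y : 0 <= sqnorm y * student2d tau y by rewrite mulr_ge0.
  have a10 : 0 <= 1 + a by rewrite addr_ge0.
  rewrite -lee_fin EFinD EFinM [(expR a * I2)%:E]EFinM [(C * _)%:E]EFinM -IS -I1E -I2E.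
  rewrite -(ge0_integralZR _ a10 m1 g1) -(ge0_integralZR _ (expR_ge0 a) m2 g2).
  rewrite -(ge0_integralZR _ C0 mS g3) -ge0_integralD//; last 4 first.
  - by move=> y _; rewrite lee_fin mulr_ge0 ?expR_ge0.
  - by apply/measurable_EFinP; exact: measurable_funM.
  - by move=> y _; rewrite lee_fin mulr_ge0.
  - by apply/measurable_EFinP; exact: measurable_funM.
  apply: ge0_le_integral_nomeas => y; first by rewrite lee_fin mulr_ge0.
  rewrite -EFinD lee_fin !mulrA -mulrDl ler_wpM2r//.
  rewrite ball_indE; case: (leP (norm1 y)) => [_|_]; last first.
    by rewrite !mulr0 mul0r add0r mulr_ge0.
  rewrite !mulr1 -expRD.
  by have := expR_ge1Dx (a + - (C * sqnorm y)); lra.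
rewrite I2E lee_fin expRN -/a ler_pdivrMl ?expR_gt0//.
have e : C * (d%:R * (tau ^+ 2 / 2) * Z) = a * (Z / 2) by rewrite /a; ring.
rewrite e in h2; nra.
Qed.


Lemma measurable_tadd2 dY (Y : measurableType dY) (y u : Y -> d.-tuple R) :
  measurable_fun setT y -> measurable_fun setT u ->
  measurable_fun setT (fun t => tadd (y t) (u t)).
Proof.
move=> my mu; apply/measurable_fun_tnthP => i.
rewrite (_ : _ \o _ = fun t => tnth (y t) i + tnth (u t) i); last first.
  by apply/funext => t; rewrite /= tnth_mktuple.
apply: measurable_funD; first exact: measurableT_comp (measurable_tnth i) my.
exact: measurableT_comp (measurable_tnth i) mu.
Qed.

Lemma dot_tadd w y u : dot w (tadd y u) = dot w y + dot w u.
Proof.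
rewrite /dot -big_split/=; apply: eq_bigr => i _.
by rewrite tnth_mktuple mulrDr.
Qed.

Lemma norm1_tadd_le y u : norm1 u <= norm1 (tadd y u) + norm1 y.
Proof.
rewrite /norm1 -big_split/=; apply: ler_sum => i _.
rewrite tnth_mktuple; apply: le_trans (ler_normB _ _).
by rewrite addrAC subrr add0r.
Qed.

Section points.
Variables (n : nat) (x : 'I_n -> d.-tuple R) (b : 'I_n -> R) (lam : R).
Hypotheses (lam0 : 0 < lam) (b0 : forall i, 0 < b i).
Hypothesis xb : forall i, norm2 (x i) ^+ 2 * (d%:R * tau ^+ 2) <= b i ^+ 2.

Let m i := lam * b i.
Let m0 i : 0 < m i. Proof. exact: mulr_gt0. Qed.
Let p i := lam ^+ 2 * (1 + m i) / (2 * m i).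
Let q i := (1 + 2 * m i)^-1.
(** [c i] and [r i] are the exponent and the squared prefactor of [gfeature (p i) (q i)]. *)
Let c i := 2 * p i * q i ^+ 2 / (1 + q i ^+ 2).
Let r i := 2 * q i / (1 + q i ^+ 2).

Let p0 i : 0 < p i.
Proof.
have := m0 i => mi; rewrite divr_gt0 ?pmulr_rgt0 ?exprn_gt0//; lra.
Qed.

Let q0 i : 0 < q i.
Proof. by rewrite invr_gt0; have := m0 i; lra. Qed.

Let q1 i : 0 < 1 + q i ^+ 2.
Proof. by rewrite addr_gt0// exprn_gt0. Qed.

Let r0 i : 0 < r i.
Proof. by rewrite divr_gt0// pmulr_rgt0. Qed.

Let c0 i : 0 <= c i.
Proof. by rewrite divr_ge0 ?(ltW (q1 i))// mulr_ge0 ?sqr_ge0// mulr_ge0 ?(ltW (p0 i)). Qed.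

(** The share of one observation in the squared lower bound: the price of replacing exp(-lam |v|) by
    a Gaussian, the squared prefactor of the feature, and its squared Gaussian bound at |y|^2 = d
    tau^2. *)
Let point_factor i : (1 + 4 * m i)^-1 <=
  expR (- (lam ^+ 2 / (4 * p i))) * r i *
  expR (- (2 * (c i * norm2 (x i) ^+ 2 * (d%:R * tau ^+ 2)))).
Proof.
have := m0 i => mi; apply: le_trans (point_loss_le mi) _.
set D := 1 + 2 * m i + 2 * m i ^+ 2.
have D0 : 0 < D by rewrite /D; nra.
have m10 : 0 < 1 + m i by lra.
have m20 : 0 < 1 + 2 * m i by lra.
have q2 : 1 + q i ^+ 2 = 2 * D / (1 + 2 * m i) ^+ 2.
  by rewrite /q /D; field; rewrite gt_eqF.
have rE : r i = (1 + 2 * m i) / D.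
  by rewrite /r q2 /q; field; rewrite !gt_eqF.
have cE : 2 * c i * b i ^+ 2 = m i * (1 + m i) / D.
  rewrite /c q2 /p /q /m; field.
  by rewrite -/(m i) !gt_eqF.
have pE : lam ^+ 2 / (4 * p i) = m i / (2 * (1 + m i)).
  by rewrite /p; field; rewrite !gt_eqF.
have rr0 : 0 < (1 + 2 * m i) / D by rewrite divr_gt0.
rewrite rE; move: rr0; set rr := (1 + 2 * m i) / D => rr0.
rewrite [_ * rr]mulrC -[leRHS]mulrA ler_pM2l// -expRD ler_expR pE -opprD lerN2 lerD2l.
rewrite -cE (_ : 2 * (c i * _ * _) = 2 * c i * (norm2 (x i) ^+ 2 * (d%:R * tau ^+ 2))).
  by rewrite ler_wpM2l// mulr_ge0.
by ring.
Qed.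

(** Half of the price lam^2 / (4 p_i), because one copy of [e0] goes with each of the two points of
    the double integral. *)
Let e0 : R := \prod_i expR (- (lam ^+ 2 / (8 * p i))).
Let Phi w y : R := e0 * (ball_ind y * smixd tau w y).
Let psi y : R := \prod_i gfeature (p i) (q i) (dot (x i) y).
Let kern y u : R := \prod_i expR (- (p i * (dot (x i) y - dot (x i) u) ^+ 2)).
Let slab u : R := \1_(@l1_ball R d (2 * d%:R * tau)) u *
  \prod_i expR (- (lam * `|dot (x i) u|)).

Let e00 : 0 <= e0. Proof. by apply: prodr_ge0 => i _; exact: expR_ge0. Qed.

Let Phi_ge0 w y : 0 <= Phi w y.
Proof. by apply: mulr_ge0 => //; apply: mulr_ge0 => //; exact: smixd_ge0. Qed.

Let psi_ge0 y : 0 <= psi y.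
Proof. by apply: prodr_ge0 => i _; exact: gfeature_ge0. Qed.

Let kern_ge0 y u : 0 <= kern y u.
Proof. by apply: prodr_ge0 => i _; exact: expR_ge0. Qed.

Let measurable_Phi dY (Y : measurableType dY) (w y : Y -> d.-tuple R) :
  measurable_fun setT w -> measurable_fun setT y ->
  measurable_fun setT (fun t => Phi (w t) (y t)).
Proof.
move=> mw my; apply: measurable_funM => //; apply: measurable_funM.
  exact: measurableT_comp measurable_ball_ind my.
exact: measurable_smixd.
Qed.

Let measurable_psi : measurable_fun setT psi.
Proof.
by apply: measurable_prod => i _; apply: measurable_gfeature; exact: measurable_dot.
Qed.

(** Two points of the ball of radius d tau differ by a vector of l1 norm at most 2 d tau. Each
    factor is then compared by AM-GM, lam |t| <= p t^2 + lam^2 / (4 p). *)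
Let slab_ge y u :
  (e0 * ball_ind y) * (e0 * ball_ind (tadd y u)) * kern y (tadd y u) <= slab u.
Proof.
have k0 : 0 <= e0 * e0 * kern y (tadd y u) by rewrite !mulr_ge0.
rewrite (_ : _ * _ = ball_ind y * ball_ind (tadd y u) * (e0 * e0 * kern y (tadd y u))); last by ring.
rewrite !ball_indE /slab indicE.
case: (leP (norm1 y)) => [y1|_]; last by rewrite !mul0r mulr_ge0//; apply: prodr_ge0 => i _; exact: expR_ge0.
case: (leP (norm1 (tadd y u))) => [yu1|_]; last by rewrite mulr0 mul0r mulr_ge0//; apply: prodr_ge0 => i _; exact: expR_ge0.
rewrite !mul1r mem_set ?mul1r; last first.
  rewrite /l1_ball/=; apply: le_trans (norm1_tadd_le y u) _.
  by rewrite (_ : 2 * d%:R * tau = d%:R * tau + d%:R * tau) ?lerD//; ring.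
rewrite ?mul1r /e0 /kern -!big_split/=; apply: ler_prod => i _.
rewrite mulr_ge0 ?expR_ge0 ?mulr_ge0 ?expR_ge0//= -!expRD ler_expR.
rewrite dot_tadd opprD addNKr sqrrN.
have pi0 := p0 i; set t := dot (x i) u.
have -> : lam * `|t| = 2 * (lam / 2 * `|t|) by field.
have h : 2 * (lam / 2 * `|t|) <= p i * `|t| ^+ 2 + lam ^+ 2 / (4 * p i).
  rewrite -subr_ge0 (_ : _ - _ = (2 * p i * `|t| - lam) ^+ 2 / (4 * p i)); last first.
    by field; rewrite gt_eqF.
  by rewrite divr_ge0 ?sqr_ge0// mulr_ge0 ?(ltW pi0).
rewrite real_normK ?num_real// in h.
have e8 : lam ^+ 2 / (4 * p i) = lam ^+ 2 / (8 * p i) + lam ^+ 2 / (8 * p i).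
  by field; rewrite gt_eqF.
by rewrite e8 in h; lra.
Qed.

Let H (z : d.-tuple R * d.-tuple R * d.-tuple R) : R :=
  Phi z.1.1 z.1.2 * Phi z.1.1 z.2 * kern z.1.2 z.2.

Let H_ge0 z : 0 <= H z. Proof. by rewrite /H mulr_ge0// mulr_ge0. Qed.

Let measurable_H dY (Y : measurableType dY) (w y u : Y -> d.-tuple R) :
  measurable_fun setT w -> measurable_fun setT y -> measurable_fun setT u ->
  measurable_fun setT (fun t => (H (w t, y t, u t))%:E).
Proof.
move=> mw my mu; apply/measurable_EFinP; apply: measurable_funM.
  by apply: measurable_funM; apply: measurable_Phi.
apply: measurable_prod => i _; apply: measurableT_comp => //; apply: measurableT_comp => //.
apply: measurable_funM => //; apply: measurable_funX; apply: measurable_funB.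
  exact: measurableT_comp (measurable_dot (x i)) my.
exact: measurableT_comp (measurable_dot (x i)) mu.
Qed.

Let T3 := (d.-tuple R * d.-tuple R * d.-tuple R)%type.
Let m1 : measurable_fun [set: T3] (fun z => z.1.1).
Proof. exact: measurableT_comp measurable_fst measurable_fst. Qed.
Let m2 : measurable_fun [set: T3] (fun z => z.1.2).
Proof. exact: measurableT_comp measurable_snd measurable_fst. Qed.
Let m3 : measurable_fun [set: T3] (fun z => z.2).
Proof. exact: measurable_snd. Qed.

(** Substitute y + u for the second point, exchange the integrals by Tonelli, apply [slab_ge]
    pointwise, and recognise [studentd tau u] through [studentd_smixd]. *)
Let H_le_slab :
  (\int[lebd]_w \int[lebd]_y \int[lebd]_u (H (w, y, u))%:E <=
   \int[lebd]_u (slab u * studentd tau u)%:E)%E.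
Proof.
have mfst : measurable_fun [set: d.-tuple R * d.-tuple R] (fun z => z.1) by exact: measurable_fst.
have msnd : measurable_fun [set: d.-tuple R * d.-tuple R] (fun z => z.2) by exact: measurable_snd.
have mc w : measurable_fun [set: d.-tuple R * d.-tuple R] (fun=> w) by exact: measurable_cst.
have -> : (\int[lebd]_w \int[lebd]_y \int[lebd]_u (H (w, y, u))%:E =
    \int[lebd]_u \int[lebd]_w \int[lebd]_y (H (w, y, tadd y u))%:E)%E.
  pose G1 (z : d.-tuple R * d.-tuple R) := (\int[lebd]_y (H (z.2, y, tadd y z.1))%:E)%E.
  have mG1 : measurable_fun setT G1.
    apply: (measurable_fun_fubini_tonelli_F (fun z : T3 => (H (z.1.2, z.2, tadd z.2 z.1.1))%:E)).
      by apply: measurable_H => //; exact: measurable_tadd2.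
    by move=> z; rewrite lee_fin.
  have G10 z : (0 <= G1 z)%E by apply: integral_ge0 => y _; rewrite lee_fin.
  apply/esym; apply: (etrans (@fubini_tonelli _ _ _ _ _ lebd lebd G1 mG1 G10)).
  apply: eq_integral => w _.
  pose G2 (z : d.-tuple R * d.-tuple R) := (H (w, z.2, tadd z.2 z.1))%:E.
  have mG2 : measurable_fun setT G2.
    by apply: measurable_H => //; exact: measurable_tadd2.
  have G20 z : (0 <= G2 z)%E by rewrite lee_fin.
  apply: (etrans (@fubini_tonelli _ _ _ _ _ lebd lebd G2 mG2 G20)).
  apply: eq_integral => y _.
  apply: (@ge0_integral_tadd R d y (fun u => (H (w, y, u))%:E)).
    by apply: measurable_H => //; exact: measurable_cst.
  by move=> u; rewrite lee_fin.
apply: ge0_le_integral_nomeas => u.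
  by apply: integral_ge0 => w _; apply: integral_ge0 => y _; rewrite lee_fin.
have slab0 : 0 <= slab u.
  rewrite /slab indicE mulr_ge0//; apply: prodr_ge0 => i _; exact: expR_ge0.
have mS : measurable_fun [set: d.-tuple R * d.-tuple R]
    (fun z => smixd tau z.1 z.2 * smixd tau z.1 (tadd z.2 u)).
  by apply: measurable_funM; apply: measurable_smixd => //; exact: measurable_tadd2.
rewrite EFinM -studentd_smixd// -ge0_integralZl//; last 2 first.
- apply: (measurable_fun_fubini_tonelli_F (fun z => (smixd tau z.1 z.2 * smixd tau z.1 (tadd z.2 u))%:E)).
    exact/measurable_EFinP.
  by move=> z; rewrite lee_fin mulr_ge0 ?smixd_ge0.
- by move=> w _; apply: integral_ge0 => y _; rewrite lee_fin mulr_ge0 ?smixd_ge0.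
apply: ge0_le_integral_nomeas => w.
  by apply: integral_ge0 => y _; rewrite lee_fin.
rewrite -ge0_integralZR//; last 2 first.
- exact: (measurableT_comp mS (pair1_measurable w)).
- by move=> y; rewrite mulr_ge0 ?smixd_ge0.
apply: ge0_le_integral_nomeas => y; rewrite lee_fin//.
rewrite /H /Phi /=.
rewrite (_ : _ * _ = (e0 * ball_ind y) * (e0 * ball_ind (tadd y u)) * kern y (tadd y u) *
    (smixd tau w y * smixd tau w (tadd y u))); last by ring.
by rewrite ler_wpM2r ?mulr_ge0 ?smixd_ge0// slab_ge.
Qed.

(** Cauchy-Schwarz on each x_i . y puts a single isotropic Gaussian below [psi], the form that
    [student2d_gauss_ge] integrates. *)
Let psi_ge : exists2 C : R, 0 <= C & exists2 Q : R, 0 <= Q &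
  (forall y, Q * expR (- (C * sqnorm y)) <= psi y) /\
  \prod_i (1 + 4 * m i)^-1 <= (e0 * Q * expR (- (C * (d%:R * tau ^+ 2)))) ^+ 2.
Proof.
exists (\sum_i c i * norm2 (x i) ^+ 2).
  by apply: sumr_ge0 => i _; rewrite mulr_ge0 ?sqr_ge0.
exists (\prod_i Num.sqrt (r i)); first by apply: prodr_ge0 => i _; exact: sqrtr_ge0.
have sumE t : expR (- ((\sum_i c i * norm2 (x i) ^+ 2) * t)) =
    \prod_i expR (- (c i * norm2 (x i) ^+ 2 * t)).
  by rewrite -expR_sum mulr_suml sumrN.
split=> [y|].
  rewrite sumE -big_split/=; apply: ler_prod => i _.
  rewrite mulr_ge0 ?sqrtr_ge0 ?expR_ge0//= /gfeature -/(r i) -/(c i).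
  rewrite ler_wpM2l ?sqrtr_ge0// ler_expR lerN2 -mulrA ler_wpM2l//.
  exact: dot_sqr_le.
rewrite sumE /e0 -!big_split/= -prodrXl; apply: ler_prod => i _.
rewrite invr_ge0; have := m0 i => mi; apply/andP; split; first by lra.
apply: le_trans (point_factor i) _.
have sr : Num.sqrt (r i) ^+ 2 = r i by rewrite sqr_sqrtr ?(ltW (r0 i)).
rewrite !exprMn sr.
set E1 := c i * _ * _.
have -> : expR (- (2 * E1)) = expR (- E1) ^+ 2.
  by rewrite [RHS]expr2 -expRD; congr expR; ring.
have -> : expR (- (lam ^+ 2 / (4 * p i))) = expR (- (lam ^+ 2 / (8 * p i))) ^+ 2.
  by rewrite [RHS]expr2 -expRD; congr expR; field; rewrite gt_eqF.
by [].
Qed.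

(** Cauchy-Schwarz is used at two levels: in [gauss_kernel_prod_ge], for each fixed scale w, to
    reach a square, and then in w, to turn the mixture into [student2d]. The 1/4 is the square of
    the 1/2 in [student2d_gauss_ge]. *)
Lemma slab_student_ge :
  ((Z / 4 * \prod_i (1 + 4 * (lam * b i))^-1)%:E <=
  \int[lebd]_u (slab u * studentd tau u)%:E)%E.
Proof.
apply: le_trans H_le_slab.
apply: (@le_trans _ _ (\int[lebd]_w (\int[lebd]_y (Phi w y * psi y)%:E) ^+ 2)%E); last first.
  apply: ge0_le_integral_nomeas => w.
    by apply: expe_ge0; apply: integral_ge0 => y _; rewrite lee_fin mulr_ge0.
  apply: gauss_kernel_prod_ge => //.
  - by move=> i; exact: measurable_dot.
  - by apply: measurable_Phi => //; exact: measurable_cst.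
have mmass : measurable_fun setT (@smix_massd R tau d) by exact: measurable_smix_massd.
(* The unit vector for Cauchy-Schwarz in w; integrating [smixd] against it produces [student2d] by
   [integral_smix_massd_smixd]. *)
pose h w := (Num.sqrt Z)^-1 * smix_massd tau w.
have h0 w : 0 <= h w by rewrite mulr_ge0 ?invr_ge0 ?sqrtr_ge0 ?smix_massd_ge0.
have mh : measurable_fun setT h by exact: measurable_funM.
have h1 : (\int[lebd]_w (h w ^+ 2)%:E <= 1)%E.
  under eq_integral do rewrite exprMn exprVn sqr_sqrtr ?(ltW Z0)//.
  rewrite ge0_integralZR ?invr_ge0 ?(ltW Z0)//; last 2 first.
  - exact: measurable_funX.
  - by move=> w; rewrite sqr_ge0.
  by rewrite integral_sqr_smix_massd// -EFinM mulVf// gt_eqF.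
have mPp : measurable_fun [set: d.-tuple R * d.-tuple R] (fun z => Phi z.1 z.2 * psi z.2).
  apply: measurable_funM; last exact: measurableT_comp measurable_psi measurable_snd.
  by apply: measurable_Phi; [exact: measurable_fst|exact: measurable_snd].
have Pp0 w y : 0 <= Phi w y * psi y by rewrite mulr_ge0.
apply: le_trans; last apply: (cauchy_schwarz_unit _ mh _ h0 h1); last 2 first.
- apply: (measurable_fun_fubini_tonelli_F (fun z => (Phi z.1 z.2 * psi z.2)%:E)) => //.
    exact/measurable_EFinP.
  by move=> z; rewrite lee_fin.
- by move=> w; apply: integral_ge0 => y _; rewrite lee_fin.
have [C C0 [Q Q0 [psiCQ prodCQ]]] := psi_ge.
pose L := e0 * Q * expR (- (C * (d%:R * tau ^+ 2))) * (Num.sqrt Z / 2).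
have L0 : 0 <= L.
  by rewrite mulr_ge0 ?divr_ge0 ?sqrtr_ge0// mulr_ge0 ?expR_ge0// mulr_ge0.
suff : (L%:E <= \int[lebd]_w ((\int[lebd]_y (Phi w y * psi y)%:E) * (h w)%:E))%E.
  move=> LI; apply: (@le_trans _ _ (L%:E ^+ 2)%E).
    have sZ : Num.sqrt Z ^+ 2 = Z by rewrite sqr_sqrtr// ltW.
    rewrite -EFin_expe lee_fin /L; set X := e0 * Q * _.
    rewrite (_ : (X * _) ^+ 2 = Z / 4 * X ^+ 2); last by rewrite -[in RHS]sZ; field.
    by rewrite ler_wpM2l// divr_ge0// ltW.
  by rewrite !expe2; apply: lee_pmul; rewrite ?lee_fin.
pose G (z : d.-tuple R * d.-tuple R) := ((Phi z.1 z.2 * psi z.2) * h z.1)%:E.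
have mG : measurable_fun setT G.
  apply/measurable_EFinP; apply: measurable_funM => //.
  exact: measurableT_comp mh measurable_fst.
have G0 z : (0 <= G z)%E by rewrite lee_fin mulr_ge0.
have -> : (\int[lebd]_w ((\int[lebd]_y (Phi w y * psi y)%:E) * (h w)%:E) =
   \int[lebd]_w \int[lebd]_y G (w, y))%E.
  apply: eq_integral => w _.
  have mw : measurable_fun setT (fun y => Phi w y * psi y).
    exact: (measurableT_comp mPp (pair1_measurable w)).
  rewrite muleC -(ge0_integralZR lebd (h0 w) mw (Pp0 w)).
  by apply: eq_integral => y _; rewrite /G/= mulrC.
rewrite (@fubini_tonelli _ _ _ _ _ lebd lebd G mG G0).
have -> : (\int[lebd]_y \int[lebd]_w G (w, y) = \int[lebd]_y
    (e0 * (Num.sqrt Z)^-1 * ball_ind y * psi y * student2d tau y)%:E)%E.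
  apply: eq_integral => y _.
  have k0 : 0 <= e0 * (Num.sqrt Z)^-1 * ball_ind y * psi y.
    by apply: mulr_ge0 => //; apply: mulr_ge0 => //; rewrite mulr_ge0 ?invr_ge0 ?sqrtr_ge0.
  have mw : measurable_fun setT (fun w => smix_massd tau w * smixd tau w y).
    by apply: measurable_funM => //; apply: measurable_smixd => //; exact: measurable_cst.
  have w0 w : 0 <= smix_massd tau w * smixd tau w y.
    by rewrite mulr_ge0 ?smixd_ge0 ?smix_massd_ge0.
  rewrite EFinM -integral_smix_massd_smixd// -(ge0_integralZR lebd k0 mw w0).
  by apply: eq_integral => w _; rewrite /G /Phi /h /=; congr EFin; ring.
have k0 : 0 <= e0 * (Num.sqrt Z)^-1 * Q by rewrite !mulr_ge0 ?invr_ge0 ?sqrtr_ge0.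
apply: (@le_trans _ _ ((e0 * (Num.sqrt Z)^-1 * Q)%:E * \int[lebd]_y
    (ball_ind y * expR (- (C * sqnorm y)) * student2d tau y)%:E)%E).
  apply: le_trans; last by apply: lee_wpmul2l; [rewrite lee_fin|exact: student2d_gauss_ge].
  have s0 : 0 < Num.sqrt Z by rewrite sqrtr_gt0.
  have sZ : Num.sqrt Z ^+ 2 = Z by rewrite sqr_sqrtr// ltW.
  rewrite -EFinM lee_fin /L -[X in _ <= _ * (_ * (X / 2))]sZ.
  move: (Num.sqrt Z) s0 (expR _) => t t0 E.
  by rewrite le_eqVlt; apply/orP; left; apply/eqP; field; rewrite gt_eqF.
have mE : measurable_fun setT
    (fun y => ball_ind y * expR (- (C * sqnorm y)) * student2d tau y).
  apply: measurable_funM; last exact: measurable_student2d.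
  apply: measurable_funM => //; apply: measurableT_comp => //; apply: measurableT_comp => //.
  exact: measurable_funM.
have E0 y : 0 <= ball_ind y * expR (- (C * sqnorm y)) * student2d tau y.
  by rewrite mulr_ge0 ?student2d_ge0// mulr_ge0 ?expR_ge0.
rewrite -(ge0_integralZR lebd k0 mE E0).
apply: ge0_le_integral_nomeas => y; rewrite lee_fin.
  by rewrite mulr_ge0// mulr_ge0 ?student2d_ge0// mulr_ge0 ?expR_ge0.
rewrite mulrA ler_wpM2r ?student2d_ge0//.
have sq0 : 0 <= e0 * (Num.sqrt Z)^-1 * ball_ind y by rewrite !mulr_ge0 ?invr_ge0 ?sqrtr_ge0.
apply: le_trans (ler_wpM2l sq0 (psiCQ y)).
by rewrite le_eqVlt; apply/orP; left; apply/eqP; ring.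
Qed.

End points.
End evidence.

(** * Prior mass near the true parameter *)

Section prior_mass.
Variables (R : realType) (d : nat) (C1 tau : R) (theta0 : d.-tuple R).
Hypotheses (tau0 : (0 < tau)%R) (d0 : (0 < d)%N).
Hypothesis theta0C : (norm1 theta0 <= C1 - 2 * d%:R * tau)%R.
Hypothesis s0 : (0 < norm0 theta0)%N.
Local Notation lebd := (@lebesgue_tuple R d).
Local Notation s := (norm0 theta0).
Local Open Scope ring_scope.

Let C0 : 0 < C1.
Proof.
have n0 : 0 <= norm1 theta0 by apply: sumr_ge0 => i _.
have dt : 0 < d%:R * tau by rewrite mulr_gt0// ltr0n.
by move: theta0C; rewrite -mulrA; lra.
Qed.

(** Coordinates off the support contribute 1, so AM-GM over s factors gives (1 + |theta0|_1 / (s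
    tau))^s. Since s tau <= 2 d tau, the bound on |theta0|_1 yields s tau + |theta0|_1 <= C1. *)
Let prod_shift_le : \prod_(i < d) (1 + `|tnth theta0 i| / tau) <= (C1 / (s%:R * tau)) ^+ s.
Proof.
have sn0 : s%:R != 0 :> R by rewrite pnatr_eq0 -lt0n.
have sR0 : 0 < s%:R :> R by rewrite ltr0n.
pose S := [set i | tnth theta0 i != 0]%SET.
have sE : s = #|S|.
  by apply: eq_card => i; rewrite [RHS]inE; apply/idP/idP => [/set_mem|h]; last exact: mem_set.
have -> : \prod_(i < d) (1 + `|tnth theta0 i| / tau) = \prod_(i in S) (1 + `|tnth theta0 i| / tau).
  rewrite [RHS]big_mkcond; apply: eq_bigr => i _; rewrite inE.
  by case: eqP => [->|//]; rewrite normr0 mul0r addr0.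
pose E i := (1 + `|tnth theta0 i| / tau) / s%:R.
have E0 : {in S, forall i, 0 <= E i *+ s}.
  move=> i _; rewrite mulrn_wge0// divr_ge0 ?ler0n// addr_ge0// divr_ge0//.
  exact: ltW.
rewrite sE in E0; have [+ _] := leif_AGM_scaled E0; rewrite -sE.
have -> : \prod_(i in S) (E i *+ s) = \prod_(i in S) (1 + `|tnth theta0 i| / tau).
  by apply: eq_bigr => i _; rewrite /E -mulr_natr mulfVK.
move=> /le_trans; apply; apply: lerXn2r.
- rewrite nnegrE; apply: sumr_ge0 => i _; rewrite divr_ge0 ?ler0n// addr_ge0// divr_ge0//.
  exact: ltW.
- by rewrite nnegrE divr_ge0 ?(ltW C0)// mulr_ge0 ?ler0n ?(ltW tau0).
rewrite /E -mulr_suml big_split/= sumr_const -sE -mulr_suml.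
have -> : \sum_(i in S) `|tnth theta0 i| = norm1 theta0.
  rewrite /norm1 [LHS]big_mkcond; apply: eq_bigr => i _; rewrite inE.
  by case: eqP => [->|//]; rewrite normr0.
have sd : s%:R <= d%:R :> R.
  by rewrite ler_nat -[X in (_ <= X)%N]card_ord max_card.
rewrite invfM mulrA [_ / s%:R / tau]mulrAC ler_pM2r ?invr_gt0//.
rewrite ler_pdivlMr// mulrDl mulfVK ?gt_eqF//.
have dt : 0 < d%:R * tau by rewrite mulr_gt0// ltr0n.
by have := ler_wpM2r (ltW tau0) sd; move: theta0C; rewrite -mulrA; lra.
Qed.

(** In each coordinate tau^2 + (a + v)^2 <= (1 + |a| / tau)^2 (tau^2 + v^2); the density is an
    inverse square, hence the exponent 4 s. *)
Let student_shift_le u : studentd tau u <=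
  (C1 / (s%:R * tau)) ^+ (4 * s) * studentd tau (tadd theta0 u).
Proof.
have q0 (v : R) : 0 < tau ^+ 2 + v ^+ 2 by rewrite ltr_pwDl ?exprn_gt0// sqr_ge0.
have P0 : 0 <= \prod_(i < d) (1 + `|tnth theta0 i| / tau).
  by apply: prodr_ge0 => i _; rewrite addr_ge0// divr_ge0// ltW.
apply: (@le_trans _ _ ((\prod_(i < d) (1 + `|tnth theta0 i| / tau)) ^+ 4 *
    studentd tau (tadd theta0 u))); last first.
  rewrite ler_wpM2r ?studentd_ge0// mulnC exprM; apply: lerXn2r => //.
  by rewrite nnegrE exprn_ge0// divr_ge0 ?(ltW C0)// mulr_ge0 ?ler0n ?(ltW tau0).
rewrite -prodrXl -big_split/=; apply: ler_prod => i _.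
rewrite invr_ge0 exprn_ge0 ?(ltW (q0 _))//= tnth_mktuple.
set a := tnth theta0 i; set v := tnth u i.
rewrite ler_pdivlMr ?exprn_gt0// ler_pdivrMl ?exprn_gt0//.
rewrite (_ : (tau ^+ 2 + v ^+ 2) ^+ 2 * _ =
    ((`|a| / tau + 1) ^+ 2 * (tau ^+ 2 + v ^+ 2)) ^+ 2); last by ring.
apply: lerXn2r.
- by rewrite nnegrE ltW.
- by rewrite nnegrE mulr_ge0 ?sqr_ge0// ltW.
have -> : (`|a| / tau + 1) ^+ 2 * (tau ^+ 2 + v ^+ 2) =
  tau ^+ 2 + v ^+ 2 + `|a| ^+ 2 + (`|a| / tau * v) ^+ 2 + 2 * (`|a| / tau) * (tau ^+ 2 + v ^+ 2).
  by field; rewrite gt_eqF.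
have av : 2 * (a * v) <= 2 * (`|a| / tau) * (tau ^+ 2 + v ^+ 2).
  rewrite -mulrA ler_pM2l// -mulrA; apply: le_trans (ler_norm _) _.
  rewrite normrM ler_wpM2l// ler_pdivlMl// -(real_normK (num_real v)).
  by have := sqr_ge0 (tau - `|v|); have := sqr_ge0 `|v|; nra.
rewrite real_normK ?num_real//.
by have := sqr_ge0 (`|a| / tau * v); lra.
Qed.

Let norm1_tadd u : norm1 (tadd theta0 u) <= norm1 theta0 + norm1 u.
Proof.
rewrite /norm1 -big_split/=; apply: ler_sum => i _.
by rewrite tnth_mktuple ler_normD.
Qed.

Let prior_weightE : prior_weight C1 tau = fun theta => \1_(@l1_ball R d C1) theta * studentd tau theta.
Proof. by []. Qed.

(** The margin 2 d tau in the bound on |theta0|_1 keeps theta0 + u inside the support of the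
    prior. *)
Let weight_shift_ge u : (C1 / (s%:R * tau)) ^- (4 * s) *
    (\1_(@l1_ball R d (2 * d%:R * tau)) u * studentd tau u) <=
  prior_weight C1 tau (tadd theta0 u).
Proof.
have k0 : 0 < C1 / (s%:R * tau) by rewrite divr_gt0// mulr_gt0// ltr0n.
rewrite ler_pdivrMl ?exprn_gt0// prior_weightE/= !indicE.
have [u1|u1] := leP (norm1 u) (2 * d%:R * tau); last first.
  rewrite memNset ?mul0r; last by move=> /(le_lt_trans)/(_ u1); rewrite ltxx.
  by rewrite !mulr_ge0 ?exprn_ge0 ?(ltW k0) ?studentd_ge0.
have tB : l1_ball C1 (tadd theta0 u).
  by rewrite /l1_ball/=; apply: le_trans (norm1_tadd u) _; move: theta0C u1; lra.
rewrite !mem_set// !mul1r.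
exact: student_shift_le.
Qed.

Variables (n : nat) (x : 'I_n -> d.-tuple R) (b : 'I_n -> R) (lam : R).
Hypotheses (lam0 : 0 < lam) (b0 : forall i, 0 < b i).
Hypothesis xb : forall i, norm2 (x i) ^+ 2 * (d%:R * tau ^+ 2) <= b i ^+ 2.

Let lower := (C1 / (s%:R * tau)) ^- (4 * s) *
  (student_mass tau ^+ d / 4 * \prod_i (1 + 4 * (lam * b i))^-1).

Let lower_gt0 : 0 < lower.
Proof.
apply: mulr_gt0.
  by rewrite invr_gt0 exprn_gt0// divr_gt0// mulr_gt0// ltr0n.
apply: mulr_gt0; first by rewrite divr_gt0// exprn_gt0// student_mass_gt0.
by apply: prodr_gt0 => i _; rewrite invr_gt0; have := mulr_gt0 lam0 (b0 i); lra.
Qed.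

Let weight_integral_ge (f : d.-tuple R -> R) :
  measurable_fun setT f -> (forall t, 0 <= f t) ->
  (forall u, \prod_i expR (- (lam * `|dot (x i) u|)) <= f (tadd theta0 u)) ->
  (lower%:E <= \int[lebd]_t (prior_weight C1 tau t * f t)%:E)%E.
Proof.
move=> mf f0 fge.
have k0 : 0 <= (C1 / (s%:R * tau)) ^- (4 * s).
  by rewrite invr_ge0 exprn_ge0// divr_ge0 ?(ltW C0)// mulr_ge0 ?ler0n// ltW.
rewrite -(ge0_integral_tadd theta0 (f := fun t => (prior_weight C1 tau t * f t)%:E)); last 2 first.
- apply/measurable_EFinP; apply: measurable_funM => //; exact: measurable_prior_weight.
- by move=> t; rewrite lee_fin mulr_ge0// prior_weight_ge0.
rewrite /lower EFinM.
apply: le_trans (lee_wpmul2l _ (slab_student_ge tau0 d0 lam0 b0 xb)) _; first by rewrite lee_fin.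
rewrite -ge0_integralZR//; last 2 first.
- apply: measurable_funM; last exact: measurable_studentd.
  apply: measurable_funM; first by apply: measurable_indic; exact: measurable_l1_ball.
  apply: measurable_prod => i _; apply: measurableT_comp => //; apply: measurableT_comp => //.
  apply: measurable_funM => //; apply: measurableT_comp; first exact: normr_measurable.
  exact: measurable_dot.
- move=> u; rewrite mulr_ge0 ?studentd_ge0// mulr_ge0 ?indicE//.
  by apply: prodr_ge0 => i _; exact: expR_ge0.
have P0 u : 0 <= \prod_i expR (- (lam * `|dot (x i) u|)).
  by apply: prodr_ge0 => i _; exact: expR_ge0.
have S0 u : 0 <= \1_(@l1_ball R d (2 * d%:R * tau)) u * studentd tau u.
  by rewrite mulr_ge0 ?studentd_ge0 ?indicE.
apply: ge0_le_integral_nomeas => u; rewrite lee_fin.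
  by rewrite mulr_ge0// mulr_ge0 ?studentd_ge0// mulr_ge0 ?indicE.
rewrite (_ : _ * _ = (C1 / (s%:R * tau)) ^- (4 * s) *
    (\1_(@l1_ball R d (2 * d%:R * tau)) u * studentd tau u) *
    \prod_i expR (- (lam * `|dot (x i) u|))); last by ring.
by apply: ler_pM; [exact: mulr_ge0|exact: P0|exact: weight_shift_ge|exact: fge].
Qed.

(** Truncation to the l1 ball can only decrease the normalising constant, so dividing by it instead
    of by the full Student mass preserves the lower bound. *)
Lemma prior_integral_ge (f : d.-tuple R -> R) :
  measurable_fun setT f -> (forall t, 0 <= f t) ->
  (forall u, \prod_i expR (- (lam * `|dot (x i) u|)) <= f (tadd theta0 u)) ->
  (((C1 / (s%:R * tau)) ^- (4 * s) / 4 * \prod_i (1 + 4 * (lam * b i))^-1)%:E <=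
   \int[prior d C1 tau]_t (f t)%:E)%E.
Proof.
move=> mf f0 fge; have Z0 : 0 < student_mass tau ^+ d by rewrite exprn_gt0// student_mass_gt0.
have [M M0 ME] : exists2 M, 0 <= M & (\int[lebd]_t (prior_weight C1 tau t)%:E)%E = M%:E.
  apply: (ge0_le_integral_real _ _ (integral_studentd d tau0)) => t.
    exact: prior_weight_ge0.
  by rewrite prior_weightE ler_piMl ?studentd_ge0// indicE; case: (_ \in _).
have MZ : M <= student_mass tau ^+ d.
  rewrite -lee_fin -ME -integral_studentd//; apply: ge0_le_integral_nomeas => t; rewrite lee_fin.
    exact: prior_weight_ge0.
  by rewrite prior_weightE ler_piMl ?studentd_ge0// indicE; case: (_ \in _).
(* The lower bound with f = 1 shows that the mass is positive, so [mnormalize] really normalises. *)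
have Mgt0 : 0 < M.
  apply: lt_le_trans lower_gt0 _; rewrite -lee_fin -ME.
  have := @weight_integral_ge (fun=> 1) _ _ _.
  under eq_integral do rewrite mulr1.
  apply => // u; rewrite -[leRHS](@expR0 R) -expR_sum ler_expR.
  by apply: sumr_le0 => i _; rewrite oppr_le0 mulr_ge0// ltW.
have mw := @measurable_prior_weight R d C1 tau.
have w0 := @prior_weight_ge0 R d C1 tau.
rewrite (ge0_integral_mnormalize _ Mgt0)//; last exact/measurable_EFinP.
rewrite ge0_integral_mdensity//; last exact/measurable_EFinP.
under eq_integral do rewrite -EFinM.
apply: le_trans (lee_wpmul2l _ (weight_integral_ge mf f0 fge)); last by rewrite lee_fin invr_ge0.
rewrite -EFinM lee_fin /lower.
set K := (C1 / _) ^- _; set P := \prod_i _.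
have KP0 : 0 <= K * P / 4.
  rewrite divr_ge0// mulr_ge0//.
    by rewrite invr_ge0 exprn_ge0// divr_ge0 ?(ltW C0)// mulr_ge0 ?ler0n// ltW.
  by apply: prodr_ge0 => i _; rewrite invr_ge0; have := mulr_gt0 lam0 (b0 i); lra.
rewrite (_ : M^-1 * _ = K * P / 4 * (M^-1 * student_mass tau ^+ d)); last by ring.
rewrite (_ : K / 4 * P = K * P / 4); last by ring.
by rewrite ler_peMr// ler_pdivlMl// mulr1.
Qed.

End prior_mass.

(** * Likelihood ratios and distances *)

Section logistic_model.
Variables (R : realType) (d : nat) (PX : probability (d.-tuple R) R).
Local Open Scope ring_scope.
Implicit Types (theta x : d.-tuple R) (z : bool * d.-tuple R).

Lemma logistic_gt0 theta y x : 0 < logistic theta y x.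
Proof. by rewrite logisticE invr_gt0 addr_gt0 ?expR_gt0. Qed.

Lemma measurable_logistic dY (Y : measurableType dY) (t x : Y -> d.-tuple R) (y : Y -> bool) :
  measurable_fun setT t -> measurable_fun setT y -> measurable_fun setT x ->
  measurable_fun setT (fun u => logistic (t u) (y u) (x u)).
Proof.
move=> mt my mx.
have -> : (fun u => logistic (t u) (y u) (x u)) = (@powR R ^~ (-1)) \o
    (fun u => 1 + expR (- (label R (y u) * dot (x u) (t u)))).
  by apply/funext => u /=; rewrite logisticE powR_inv1// addr_ge0// expR_ge0.
apply: measurableT_comp => //; apply: measurable_funD => //.
apply: measurableT_comp => //; apply: measurableT_comp => //.
apply: measurable_funM.
  have ml : measurable_fun [set: bool] (label R) by [].
  exact: measurableT_comp ml my.
apply: measurable_sum => i; apply: measurable_funM.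
  exact: measurableT_comp (measurable_tnth i) mx.
exact: measurableT_comp (measurable_tnth i) mt.
Qed.

Lemma ge0_integral_joint_law theta (g : bool * d.-tuple R -> \bar R) :
  measurable_fun setT g -> (forall z, (0 <= g z)%E) ->
  (\int[joint_law PX theta]_z g z =
   \int[PX]_x \sum_(y : bool) (logistic theta y x)%:E * g (y, x))%E.
Proof.
move=> mg g0.
apply: (@ge0_integral_mixture _ _ _ _ _ _ PX (joint_law PX theta)
  (fun y x => logistic theta y x) (fun y x => (y, x))) => //.
- by move=> y; exact: measurable_logisticr.
- by move=> y x; exact: logistic_ge0.
- by move=> y; exact: pair1_measurable.
Qed.

Variable theta0 : d.-tuple R.
Local Notation P0 := (joint_law PX theta0).

Definition lratio theta z : R := logistic theta z.1 z.2 / logistic theta0 z.1 z.2.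

Lemma lratio_gt0 theta z : 0 < lratio theta z.
Proof. by rewrite divr_gt0 ?logistic_gt0. Qed.

Lemma measurable_lratio dY (Y : measurableType dY) (t : Y -> d.-tuple R)
    (z : Y -> bool * d.-tuple R) :
  measurable_fun setT t -> measurable_fun setT z ->
  measurable_fun setT (fun u => lratio (t u) (z u)).
Proof.
move=> mt mz.
have m1 : measurable_fun setT (fun u => (z u).1) by exact: measurableT_comp measurable_fst mz.
have m2 : measurable_fun setT (fun u => (z u).2) by exact: measurableT_comp measurable_snd mz.
apply: measurable_funM; first exact: measurable_logistic.
have -> : (fun u => (logistic theta0 (z u).1 (z u).2)^-1) = (@powR R ^~ (-1)) \o
    (fun u => logistic theta0 (z u).1 (z u).2).
  by apply/funext => u /=; rewrite powR_inv1// ltW// logistic_gt0.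
apply: measurableT_comp => //; apply: measurable_logistic => //.
Qed.

(** The logistic log-likelihood is 1-Lipschitz in x . theta, since 1 + exp(-a - v) <= exp |v| (1 +
    exp(-a)). *)
Lemma lratio_tadd_ge u z : expR (- `|dot z.2 u|) <= lratio (tadd theta0 u) z.
Proof.
rewrite /lratio !logisticE invrK ler_pdivlMl ?addr_gt0 ?expR_gt0//.
rewrite dot_tadd mulrDr; set a := label R z.1 * _; set v := label R z.1 * _.
have vle : - v <= `|dot z.2 u|.
  apply: le_trans (ler_norm _) _; rewrite normrN /v normrM /label.
  by case: z.1; rewrite ?normrN normr1 mul1r.
have := expR_gt0 `|dot z.2 u|; rewrite (expRN `|_|) => e0.
rewrite ler_pdivrMr// opprD expRD.
have e1 : 1 <= expR `|dot z.2 u| by rewrite -expR0 ler_expR.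
have := expR_gt0 (- a); have : expR (- v) <= expR `|dot z.2 u| by rewrite ler_expR.
nra.
Qed.

Let mlr theta : measurable_fun setT (lratio theta).
Proof. by apply: measurable_lratio => //; exact: measurable_cst. Qed.

Lemma joint_lawE theta A : measurable A ->
  (joint_law PX theta A = \int[P0]_(z in A) (lratio theta z)%:E)%E.
Proof.
move=> mA; rewrite integral_mkcond ge0_integral_joint_law; last 2 first.
- by apply/(measurable_restrictT _ mA)/measurable_funTS/measurable_EFinP; exact: mlr.
- by move=> z; rewrite erestrict_ge0// => t _; rewrite lee_fin ltW// lratio_gt0.
apply: eq_integral => x _; rewrite -sumEFin; apply: eq_bigr => y _.
rewrite patchE indicE; case: ifP => _; rewrite ?mulr0 ?mule0// mulr1 -EFinM; congr EFin.
by rewrite /lratio/= mulrC mulfVK// gt_eqF// logistic_gt0.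
Qed.

Lemma hellinger2_lratio theta :
  (hellinger2 (joint_law PX theta) P0 =
   \int[P0]_z ((Num.sqrt (lratio theta z) - 1) ^+ 2)%:E)%E.
Proof.
rewrite (@hellinger2E _ _ R (joint_law PX theta) P0 P0 (lratio theta) (fun=> 1))//.
- by apply: eq_integral => z _; rewrite sqrtr1.
- by move=> z; rewrite ltW// lratio_gt0.
- exact: joint_lawE.
- by move=> A mA; rewrite integral_cst// mul1e.
Qed.

Lemma measurable_hellinger2_joint_law :
  measurable_fun setT (fun theta => hellinger2 (joint_law PX theta) P0).
Proof.
under eq_fun do rewrite hellinger2_lratio.
pose G (p : d.-tuple R * (bool * d.-tuple R)) : \bar R :=
  ((Num.sqrt (lratio p.1 p.2) - 1) ^+ 2)%:E.
have mG : measurable_fun setT G.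
  apply/measurable_EFinP; apply: measurable_funX; apply: measurable_funB => //.
  apply: measurableT_comp; last exact: measurable_lratio.
  by apply: continuous_measurable_fun => x; exact: sqrt_continuous.
apply: (@measurable_fun_fubini_tonelli_F _ _ _ _ _ P0 G) => //.
by move=> p; rewrite lee_fin sqr_ge0.
Qed.

Lemma integral_lratio theta : (\int[P0]_z (lratio theta z)%:E = 1)%E.
Proof. by rewrite -joint_lawE// probability_setT. Qed.

Lemma hellinger2_joint_law_fin theta :
  exists2 h, 0 <= h & (hellinger2 (joint_law PX theta) P0 = h%:E)%E.
Proof.
rewrite hellinger2_lratio.
have i2 : (\int[P0]_z (lratio theta z + 1)%:E = 2%:E)%E.
  under eq_integral do rewrite EFinD.
  rewrite ge0_integralD//.
  - rewrite integral_lratio integral_cst// mul1e [X in (_ + X)%E]probability_setT.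
    by rewrite -EFinD.
  - by move=> z _; rewrite lee_fin ltW// lratio_gt0.
  - exact/measurable_EFinP.
have [||s s0 ->] := ge0_le_integral_real
    (f := fun z => (Num.sqrt (lratio theta z) - 1) ^+ 2) _ _ i2.
- by move=> z; exact: sqr_ge0.
- move=> z; have r0 := lratio_gt0 theta z.
  rewrite -[in leRHS](sqr_sqrtr (ltW r0)); have := sqrtr_ge0 (lratio theta z).
  move: (Num.sqrt _) => w w0; nra.
by exists s.
Qed.

Lemma fine_hellinger2K theta :
  (fine (hellinger2 (joint_law PX theta) P0))%:E = hellinger2 (joint_law PX theta) P0.
Proof. by have [h _ ->] := hellinger2_joint_law_fin theta. Qed.

Lemma fine_hellinger2_ge0 theta : 0 <= fine (hellinger2 (joint_law PX theta) P0).
Proof. by have [h h0 ->] := hellinger2_joint_law_fin theta. Qed.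

(** Weighted AM-GM for 1 and w: two instances of exp t >= 1 + t, with weights 1 - g and g that
    cancel the logarithms. *)
Lemma le_powR_tangent (w g : R) : 0 < w -> 0 <= g <= 1 ->
  w `^ g <= 1 - g + g * w.
Proof.
move=> w0 /andP[g0 g1]; rewrite /powR gt_eqF//.
have : w = expR (ln w) by rewrite lnK// posrE.
set L := ln w => ->; have m0 := expR_gt0 (g * L).
have e1 : expR (g * L) * (1 - g * L) <= 1.
  rewrite [leRHS](_ : _ = expR (g * L) * expR (- (g * L))); last first.
    by rewrite expRN mulfV// gt_eqF.
  by rewrite ler_pM2l// expR_ge1Dx.
have e2 : expR (g * L) * (1 + (1 - g) * L) <= expR L.
  have -> : expR L = expR (g * L) * expR ((1 - g) * L).
    by rewrite -expRD -mulrDl addrCA subrr addr0 mul1r.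
  by rewrite ler_pM2l// expR_ge1Dx.
move: e1 e2; set m := expR (g * L); set W := expR L => e1 e2.
have e3 : (1 - g) * (m * (1 - g * L)) <= (1 - g) * 1 by rewrite ler_wpM2l// subr_ge0.
have e4 : g * (m * (1 + (1 - g) * L)) <= g * W by rewrite ler_wpM2l.
have -> : m = (1 - g) * (m * (1 - g * L)) + g * (m * (1 + (1 - g) * L)) by ring.
lra.
Qed.

(* Tangent line of [w |-> w `^ g] at [1], with [w = sqrt r] and [g] equal to    *)
(* [2 a] or [2 a - 1].                                                         *)
Lemma powR_sqrt_le (r a : R) : 0 < r -> 0 < a < 1 ->
  r `^ a + Num.min a (1 - a) * (Num.sqrt r - 1) ^+ 2 <= a * r + (1 - a).
Proof.
move=> r0 /andP[a0 a1].
have w0 : 0 < Num.sqrt r by rewrite sqrtr_gt0.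
rewrite -{1 3}(sqr_sqrtr (ltW r0)); move: (Num.sqrt r) w0 => w w0.
have -> : (w ^+ 2) `^ a = w `^ (2 * a) by rewrite -(powR_mulrn 2 (ltW w0)) -powRrM.
case: (leP a (1 - a)) => ha.
  have := @le_powR_tangent w (2 * a) w0.
  have -> : 0 <= 2 * a <= 1 by apply/andP; split; lra.
  by move=> /(_ isT) h; nra.
have -> : 2 * a = 1 + (2 * a - 1) by ring.
rewrite powRD; last by rewrite (gt_eqF w0) implybT.
rewrite powRr1; last exact: ltW.
have := @le_powR_tangent w (2 * a - 1) w0.
have -> : 0 <= 2 * a - 1 <= 1 by apply/andP; split; lra.
move=> /(_ isT) /(ler_wpM2l (ltW w0)) h.
nra.
Qed.

(** Multiply [powR_sqrt_le] by f and integrate; f >= 1 keeps the Hellinger term intact. Given X, the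
    weights a p_theta + (1 - a) p_theta0 sum to 1 over the labels, which leaves the mean of f. *)
Lemma integral_lratio_power_le theta (a : R) (f : d.-tuple R -> R) : 0 < a < 1 ->
  measurable_fun setT f -> (forall x, 1 <= f x) ->
  (\int[P0]_z (lratio theta z `^ a * f z.2)%:E +
   (Num.min a (1 - a))%:E * hellinger2 (joint_law PX theta) P0 <=
   \int[PX]_x (f x)%:E)%E.
Proof.
move=> a01 mf f1; have f0 x : 0 <= f x by exact: le_trans (f1 x).
have [a0 a1] := andP a01.
have c0 : 0 <= Num.min a (1 - a) by rewrite le_min !ltW// subr_gt0.
have mf2 : measurable_fun setT (fun z : bool * d.-tuple R => f z.2).
  exact: measurableT_comp.
have mg : measurable_fun setT (fun z => lratio theta z `^ a * f z.2).
  by apply: measurable_funM => //; exact: (measurableT_comp (measurable_powR a) (mlr theta)).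
have ms : measurable_fun setT (fun z => (Num.sqrt (lratio theta z) - 1) ^+ 2).
  apply: measurable_funX; apply: measurable_funB => //.
  apply: measurableT_comp; last exact: mlr.
  by apply: continuous_measurable_fun => x; exact: sqrt_continuous.
rewrite hellinger2_lratio -ge0_integralZR//; last by move=> z; exact: sqr_ge0.
rewrite -ge0_integralD//; last first.
- by apply/measurable_EFinP; exact: measurable_funM.
- by move=> z _; rewrite lee_fin mulr_ge0// sqr_ge0.
- by apply/measurable_EFinP.
- by move=> z _; rewrite lee_fin mulr_ge0// powR_ge0.
have mR : measurable_fun setT (fun z => ((a * lratio theta z + (1 - a)) * f z.2)%:E).
  apply/measurable_EFinP; apply: measurable_funM => //; apply: measurable_funD => //.
  by apply: measurable_funM => //; exact: mlr.
apply: (@le_trans _ _ (\int[P0]_z ((a * lratio theta z + (1 - a)) * f z.2)%:E)%E).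
  apply: ge0_le_integral_nomeas => z.
    by rewrite -EFinD lee_fin addr_ge0// mulr_ge0// ?powR_ge0 ?sqr_ge0.
  rewrite -EFinD lee_fin; have := powR_sqrt_le (lratio_gt0 theta z) a01.
  have : 0 <= Num.min a (1 - a) * (Num.sqrt (lratio theta z) - 1) ^+ 2.
    by rewrite mulr_ge0// sqr_ge0.
  have := f1 z.2; nra.
rewrite ge0_integral_joint_law//; last first.
  move=> z; rewrite lee_fin mulr_ge0// addr_ge0// ?subr_ge0 ?ltW// mulr_gt0//.
  exact: lratio_gt0.
rewrite le_eqVlt; apply/orP; left; apply/eqP; apply: eq_integral => x _.
under eq_bigr do rewrite -EFinM.
rewrite sumEFin; congr EFin.
rewrite (eq_bigr (fun y => (a * logistic theta y x + (1 - a) * logistic theta0 y x) * f x)).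
  by rewrite -mulr_suml big_split/= -!mulr_sumr !logistic_sum !mulr1 addrC subrK mul1r.
move=> y _; rewrite /lratio/=; have := logistic_gt0 theta0 y x.
move: (logistic theta0 y x) (logistic theta y x) => p q p0.
by field; rewrite gt_eqF.
Qed.

End logistic_model.

(** * Total variation through tests, and its comparison with Hellinger distance *)

Section probability_pair.
Context dT (T : measurableType dT) (R : realType).
Variables P Q : probability T R.
Local Open Scope ring_scope.

Lemma tv_distance_ge0 : (0 <= tv_distance P Q)%E.
Proof.
apply: ereal_sup_ubound; exists set0 => //.
by rewrite !measure0 sube0 abse0.
Qed.

Lemma fine_probability_setC (N : probability T R) A : measurable A ->
  fine (N (~` A)) = 1 - fine (N A).
Proof.
by move=> mA; rewrite probability_setC// fineB// fin_num_measure.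
Qed.

Lemma tv_distance_le (h : R) :
  (forall A, measurable A -> fine (P A) - fine (Q A) <= h) ->
  (tv_distance P Q <= h%:E)%E.
Proof.
move=> half; apply: ge_ereal_sup => _ [A mA <-].
have := half _ (measurableC mA); have := half _ mA.
rewrite !fine_probability_setC//.
rewrite -(fineK (fin_num_measure P A mA)) -(fineK (fin_num_measure Q A mA)) /=.
by rewrite lee_fin ler_norml => a1 a2; apply/andP; split; lra.
Qed.

Lemma probability_test_le A (e : R) : measurable A ->
  (P A + Q (~` A) <= Q A + P (~` A) + e%:E)%E ->
  2 * (fine (P A) - fine (Q A)) <= e.
Proof.
move=> mA; have mAC := measurableC mA.
rewrite -(fineK (fin_num_measure P A mA)) -(fineK (fin_num_measure Q A mA)).
rewrite -(fineK (fin_num_measure P _ mAC)) -(fineK (fin_num_measure Q _ mAC)).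
by rewrite -!EFinD lee_fin !fine_probability_setC//= => H; lra.
Qed.

End probability_pair.

Section total_variation.
Variables (R : realType) (d : nat) (PX : probability (d.-tuple R) R).
Variables theta0 theta : d.-tuple R.
Local Open Scope ring_scope.
Local Notation P0 := (joint_law PX theta0).
Local Notation P1 := (joint_law PX theta).
Local Notation rho := (lratio theta0 theta).

Let rho0 z : 0 <= rho z. Proof. by rewrite ltW// lratio_gt0. Qed.

Let mrho : measurable_fun setT rho.
Proof. by apply: measurable_lratio => //; exact: measurable_cst. Qed.

(* AM-GM for |sqrt r - 1| (sqrt r + 1) = |r - 1|. *)
Let le_lratio_dist (e r : R) : 0 < e -> 0 <= r ->
  `|r - 1| <= (2 * e)^-1 * (Num.sqrt r - 1) ^+ 2 + e * (r + 1).
Proof.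
move=> e0 r0; rewrite -{1 3}(sqr_sqrtr r0).
have := sqrtr_ge0 r; move: (Num.sqrt r) => w w0.
have -> : (2 * e)^-1 * (w - 1) ^+ 2 = e * (2 * ((w - 1) / (2 * e)) ^+ 2).
  by field; rewrite gt_eqF.
have -> : w ^+ 2 - 1 = 2 * e * ((w - 1) / (2 * e)) * (w + 1).
  by field; rewrite gt_eqF.
move: (_ / _) => t.
have h1 : 0 <= e * ((2 * t - (w + 1)) ^+ 2 + (w - 1) ^+ 2).
  by apply: mulr_ge0; [exact: ltW|apply: addr_ge0; exact: sqr_ge0].
have h2 : 0 <= e * ((2 * t + (w + 1)) ^+ 2 + (w - 1) ^+ 2).
  by apply: mulr_ge0; [exact: ltW|apply: addr_ge0; exact: sqr_ge0].
by rewrite ler_norml; apply/andP; split; nra.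
Qed.

Let integral_test (A : set (bool * d.-tuple R)) (f g : bool * d.-tuple R -> R) :
  measurable A -> measurable_fun setT f -> measurable_fun setT g ->
  (forall z, 0 <= f z) -> (forall z, 0 <= g z) ->
  (\int[P0]_z (if z \in A then f z else g z)%:E =
   \int[P0]_(z in A) (f z)%:E + \int[P0]_(z in ~` A) (g z)%:E)%E.
Proof.
move=> mA mf mg f0 g0; have mAC : measurable (~` A) by exact: measurableC.
rewrite -(setUv A) ge0_integral_setU//.
- congr (_ + _)%E; apply: eq_integral => z; first by move=> ->.
  by rewrite in_setC => /negbTE ->.
- apply/measurable_EFinP; rewrite setUv; apply: measurable_fun_ifT => //.
  by apply: (measurable_fun_bool true); rewrite setTI preimage_mem_true.
- by move=> z _; rewrite lee_fin; case: ifP.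
- by rewrite /disj_set setICr.
Qed.

Lemma lratio_test_le (A : set (bool * d.-tuple R)) (e h : R) : measurable A ->
  0 < e -> hellinger2 P1 P0 = h%:E ->
  (P1 A + P0 (~` A) <= P0 A + P1 (~` A) + ((2 * e)^-1 * h + 2 * e)%:E)%E.
Proof.
move=> mA e0 hE; have mAC : measurable (~` A) by exact: measurableC.
have P0E B : measurable B -> (P0 B = \int[P0]_(z in B) ((fun=> 1 : R) z)%:E)%E.
  by move=> mB; rewrite integral_cst// mul1e.
rewrite !(joint_lawE PX theta0 theta)// (P0E A)// (P0E (~` A))//.
rewrite -!integral_test//.
pose D z := (2 * e)^-1 * (Num.sqrt (rho z) - 1) ^+ 2 + e * (rho z + 1).
have msq : measurable_fun setT (fun z => (Num.sqrt (rho z) - 1) ^+ 2).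
  apply: measurable_funX; apply: measurable_funB => //.
  apply: measurableT_comp mrho.
  by apply: continuous_measurable_fun => x; exact: sqrt_continuous.
have mr1 : measurable_fun setT (fun z => rho z + 1) by exact: measurable_funD.
have e20 : 0 <= (2 * e)^-1 by rewrite invr_ge0 mulr_ge0// ltW.
have D0 z : 0 <= D z.
  apply: addr_ge0; first by apply: mulr_ge0 => //; exact: sqr_ge0.
  by apply: mulr_ge0; [exact: ltW|exact: addr_ge0].
have mD : measurable_fun setT D by apply: measurable_funD; exact: measurable_funM.
have ID : (\int[P0]_z (D z)%:E = ((2 * e)^-1 * h + 2 * e)%:E)%E.
  under eq_integral do rewrite EFinD.
  rewrite ge0_integralD//.
  - rewrite (ge0_integralZR P0 e20 msq) => [|z]; last exact: sqr_ge0.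
    rewrite -hellinger2_lratio hE (ge0_integralZR P0 (ltW e0) mr1) => [|z]; last first.
      by rewrite addr_ge0.
    under [X in (_ + _ * X)%E]eq_integral do rewrite EFinD.
    rewrite ge0_integralD//.
    + rewrite integral_lratio integral_cst// mul1e [X in (_ + _ * (_ + X))%E]probability_setT.
      by rewrite -!EFinD; congr EFin; ring.
    + by move=> z _; rewrite lee_fin.
    + exact/measurable_EFinP.
  - by move=> z _; rewrite lee_fin mulr_ge0// sqr_ge0.
  - by apply/measurable_EFinP; exact: measurable_funM.
  - by move=> z _; rewrite lee_fin mulr_ge0 ?addr_ge0// ltW.
  - by apply/measurable_EFinP; exact: measurable_funM.
have mif (f g : bool * d.-tuple R -> R) : measurable_fun setT f -> measurable_fun setT g ->
    measurable_fun setT (fun z => (if z \in A then f z else g z)%:E).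
  move=> mf mg; apply/measurable_EFinP/measurable_fun_ifT => //.
  by apply: (measurable_fun_bool true); rewrite setTI preimage_mem_true.
have L := @le_lratio_dist e.
rewrite -ID -ge0_integralD//; last 4 first.
- by move=> z _; rewrite lee_fin; case: ifP.
- exact: mif.
- by move=> z _; rewrite lee_fin.
- exact/measurable_EFinP.
apply: ge0_le_integral_nomeas => z; first by rewrite lee_fin; case: ifP.
rewrite -EFinD lee_fin.
have := L (rho z) e0 (rho0 z); rewrite -/(D z) ler_norml => /andP[].
by case: ifP => _; lra.
Qed.

Lemma tv_distance_sqr_le :
  (tv_distance P1 P0 ^+ 2 <= hellinger2 P1 P0)%E.
Proof.
have [h h0 hE] := hellinger2_joint_law_fin PX theta0 theta.
have half A : measurable A -> fine (P1 A) - fine (P0 A) <= Num.sqrt h.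
  move=> mA; set x := _ - _.
  case: (ltP 0 x) => x0; last by apply: le_trans (sqrtr_ge0 _).
  rewrite -[leLHS](gtr0_norm x0) -sqrtr_sqr ler_sqrt//.
  (* With e = x/2 the test inequality 2 x <= h / (2 e) + 2 e becomes x^2 <= h. *)
  have x20 : 0 < x / 2 by rewrite divr_gt0.
  have := probability_test_le mA (lratio_test_le mA x20 hE).
  rewrite -/x; have -> : 2 * (x / 2) = x by field.
  move=> H; have {H} : x <= x^-1 * h by lra.
  by rewrite mulrC ler_pdivlMr// expr2.
have hs : hellinger2 P1 P0 = ((Num.sqrt h)%:E ^+ 2)%E.
  by rewrite -EFin_expe sqr_sqrtr// hE.
have tv0 := tv_distance_ge0 P1 P0; have tvh := tv_distance_le half.
by rewrite hs !expe2; exact: lee_pmul.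
Qed.

End total_variation.

(** * Fractional posterior *)

Section fractional_posterior_bounds.
Variables (R : realType) (d n : nat) (PX : probability (d.-tuple R) R).
Variables (theta0 : d.-tuple R) (pi : probability (d.-tuple R) R) (a : R).
Local Open Scope ring_scope.
Local Notation P0 := (joint_law PX theta0).
Local Notation obs := (n.-tuple (bool * d.-tuple R)).
Hypothesis a0 : 0 < a.
Implicit Types (z : obs) (theta : d.-tuple R).

Definition lratio_prod z theta : R :=
  \prod_(i < n) (lratio theta0 theta (tnth z i) `^ a).

Lemma lratio_prod_ge0 z theta : 0 <= lratio_prod z theta.
Proof. by apply: prodr_ge0 => i _; exact: powR_ge0. Qed.

Lemma measurable_lratio_prod z : measurable_fun setT (lratio_prod z).
Proof.
apply: measurable_prod => i _; apply: (measurableT_comp (measurable_powR a)).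
by apply: measurable_lratio => //; exact: measurable_cst.
Qed.

Lemma powR_prod (I : finType) (r : I -> R) : (forall i, 0 <= r i) ->
  (\prod_i r i) `^ a = \prod_i (r i `^ a).
Proof.
move=> r0; suff: (\prod_i r i) `^ a = \prod_i (r i `^ a) /\ 0 <= \prod_i r i by case.
apply: (big_ind2 (fun x y => x `^ a = y /\ 0 <= x)) => //.
  by rewrite powR1.
by move=> x1 y1 x2 y2 [<- x10] [<- x20]; rewrite powRM// mulr_ge0.
Qed.

Lemma likelihood_gt0 z theta : 0 < likelihood z theta.
Proof. by apply: prodr_gt0 => i _; exact: logistic_gt0. Qed.

Lemma likelihood_power_lratio z theta :
  likelihood_power a z theta = likelihood_power a z theta0 * lratio_prod z theta.
Proof.
rewrite /likelihood_power /likelihood !powR_prod; last 2 first.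
- by move=> i; exact: logistic_ge0.
- by move=> i; exact: logistic_ge0.
rewrite -big_split/=; apply: eq_bigr => i _.
rewrite -powRM ?logistic_ge0//; last by rewrite ltW// lratio_gt0.
by rewrite /lratio mulrC divfK// gt_eqF// logistic_gt0.
Qed.

Lemma likelihood_power_le1 z theta : likelihood_power a z theta <= 1.
Proof.
have L1 : likelihood z theta <= 1.
  apply: prodr_ile1 => i _; rewrite logistic_ge0/= logisticE invf_le1.
    by rewrite lerDl expR_ge0.
  by rewrite addr_gt0// expR_gt0.
have <- : (1 : R) `^ a = 1 by rewrite powR1.
apply: ge0_ler_powR => //; rewrite ?nnegrE//.
  exact: ltW.
by rewrite ltW// likelihood_gt0.
Qed.

(** Integrate the tangent inequality h + 1 <= ln c + exp(h) / c; integrability of [h] is a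
    consequence, not an assumption. *)
Lemma jensen_expR (P : probability (d.-tuple R) R) (h : d.-tuple R -> R) (c : R) :
  measurable_fun setT h -> (forall t, 0 <= h t) ->
  (\int[P]_t (expR (h t))%:E <= c%:E)%E -> (\int[P]_t (h t)%:E <= (ln c)%:E)%E.
Proof.
move=> mh h0 hc.
have i1 (k : \bar R) : (\int[P]_t (cst k t) = k)%E.
  by rewrite integral_cst// [X in (_ * X)%E]probability_setT mule1.
have c1 : 1 <= c.
  rewrite -lee_fin; apply: le_trans hc; rewrite -[leLHS](i1 1%E).
  apply: ge0_le_integral_nomeas => t; first exact: lee01.
  by rewrite lee_fin -expR0 ler_expR.
have c0 : 0 < c by exact: lt_le_trans c1.
have me : measurable_fun setT (fun t => expR (h t)) by exact: measurableT_comp.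
have ci0 : 0 <= c^-1 by rewrite invr_ge0 ltW.
have lc0 : 0 <= ln c by rewrite ln_ge0.
have le1 : (\int[P]_t (h t)%:E + 1 <= (ln c)%:E + 1)%E.
  have -> : (\int[P]_t (h t)%:E + 1 = \int[P]_t (h t + 1)%:E)%E.
    under [RHS]eq_integral do rewrite EFinD.
    rewrite ge0_integralD//; last exact/measurable_EFinP.
      by rewrite (i1 1%E).
    by move=> t _; rewrite lee_fin.
  apply: (@le_trans _ _ (\int[P]_t (ln c + c^-1 * expR (h t))%:E)%E).
    apply: ge0_le_integral_nomeas => t; rewrite lee_fin ?addr_ge0//.
    have := expR_ge1Dx (h t - ln c); rewrite expRD expRN lnK ?posrE// mulrC; lra.
  under eq_integral do rewrite EFinD.
  rewrite ge0_integralD//; last 2 first.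
  - by move=> t _; rewrite lee_fin mulr_ge0// expR_ge0.
  - by apply/measurable_EFinP; exact: measurable_funM.
  rewrite (i1 (ln c)%:E) leeD2l//.
  rewrite (ge0_integralZR P ci0 me) => [|t]; last exact: expR_ge0.
  have -> : 1%E = (c^-1%:E * c%:E)%E by rewrite -EFinM mulVf ?gt_eqF.
  by rewrite lee_wpmul2l.
by move: le1; rewrite leeD2rE.
Qed.

(** The power of the likelihood at [theta0] is common to the posterior weight and its normalising
    constant, so only likelihood ratios remain. *)
Lemma fractional_posterior_expR_le z (h : d.-tuple R -> R) (k M : R) :
  measurable_fun setT h -> (forall t, 0 <= h t) -> 0 < k ->
  (k%:E <= \int[pi]_t (lratio_prod z t)%:E)%E ->
  (\int[pi]_t (lratio_prod z t * expR (h t))%:E <= M%:E)%E ->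
  (\int[fractional_posterior pi a z]_t (h t)%:E <= (ln (M / k))%:E)%E.
Proof.
move=> mh h0 k0 kF FM; apply: jensen_expR => //.
have me : measurable_fun setT (fun t => expR (h t)) by exact: measurableT_comp.
have mr := measurable_lratio_prod z; have r0 := lratio_prod_ge0 z.
have mre : measurable_fun setT (fun t => lratio_prod z t * expR (h t)).
  exact: measurable_funM.
have re0 t : 0 <= lratio_prod z t * expR (h t) by rewrite mulr_ge0// expR_ge0.
have L0 : 0 < likelihood_power a z theta0 by rewrite powR_gt0// likelihood_gt0.
(* The total mass is finite because likelihoods are at most 1, and positive because of [k]; the
   fallback of [mnormalize] is not reached. *)
have [m [m0 mk mE]] : exists m, [/\ 0 < m, likelihood_power a z theta0 * k <= m &
    (\int[pi]_t (likelihood_power a z t)%:E = m%:E)%E].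
  have := ge0_le_integral_real (f := likelihood_power a z) (g := fun=> 1) (mu := pi) (r := 1).
  move=> /(_ (likelihood_power_ge0 _ _) (likelihood_power_le1 z)).
  rewrite integral_cst// mul1e => /(_ (probability_setT _)) [m _ mE].
  have mk : likelihood_power a z theta0 * k <= m.
    rewrite -lee_fin -mE; under eq_integral do rewrite likelihood_power_lratio.
    by rewrite (ge0_integralZR pi (ltW L0) mr r0) EFinM lee_wpmul2l// lee_fin ltW.
  by exists m; split => //; apply: lt_le_trans mk; rewrite mulr_gt0.
rewrite /fractional_posterior (@ge0_integral_mnormalize _ _ _ _ _ _ m)//;
  last exact/measurable_EFinP.
rewrite ge0_integral_mdensity//; last exact/measurable_EFinP.
under eq_integral do rewrite -EFinM likelihood_power_lratio -mulrA.
rewrite (ge0_integralZR pi (ltW L0) mre re0) muleA -EFinM.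
have F0 : (0 <= \int[pi]_t (lratio_prod z t * expR (h t))%:E)%E.
  by apply: integral_ge0 => t _; rewrite lee_fin.
have M0 : 0 <= M by rewrite -lee_fin; exact: le_trans FM.
apply: (@le_trans _ _ ((m^-1 * likelihood_power a z theta0)%:E * M%:E)%E).
  by rewrite lee_wpmul2l// lee_fin mulr_ge0 ?ltW// invr_gt0.
rewrite -EFinM lee_fin mulrC ler_wpM2l//.
by rewrite mulrC ler_pdivrMr// ler_pdivlMl// mulrC.
Qed.

Variable f : d.-tuple R -> R.
Hypotheses (mf : measurable_fun setT f) (f1 : forall x, 1 <= f x) (a1 : a < 1).
Local Notation h2 theta := (fine (hellinger2 (joint_law PX theta) P0)).
Local Notation c := (Num.min a (1 - a)).

Let f0 x : 0 <= f x. Proof. exact: le_trans (f1 x). Qed.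

(** The factors f(X_i) compensate in advance for the sample-dependent loss in the lower bound on the
    evidence. *)
Definition tilted_evidence z : \bar R :=
  (\int[pi]_t (expR (n%:R * (c * h2 t)) *
     \prod_(i < n) (lratio theta0 t (tnth z i) `^ a * f (tnth z i).2))%:E)%E.

Let mh2 : measurable_fun setT (fun t => h2 t).
Proof. by apply: measurableT_comp => //; exact: measurable_hellinger2_joint_law. Qed.

Let G (p : obs * d.-tuple R) : \bar R :=
  (expR (n%:R * (c * h2 p.2)) *
     \prod_(i < n) (lratio theta0 p.2 (tnth p.1 i) `^ a * f (tnth p.1 i).2))%:E.

Let G0 p : (0 <= G p)%E.
Proof.
rewrite lee_fin mulr_ge0// ?expR_ge0// prodr_ge0// => i _.
by rewrite mulr_ge0// powR_ge0.
Qed.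

Let mG : measurable_fun setT G.
Proof.
apply/measurable_EFinP; apply: measurable_funM.
  apply: measurableT_comp => //; apply: measurable_funM => //.
  apply: measurable_funM => //.
  exact: (measurableT_comp mh2 measurable_snd).
apply: measurable_prod => i _.
have mi : measurable_fun setT (fun p : obs * d.-tuple R => tnth p.1 i).
  exact: (measurableT_comp (measurable_tnth i) measurable_fst).
apply: measurable_funM.
  apply: (measurableT_comp (measurable_powR a)).
  exact: measurable_lratio.
apply: (measurableT_comp mf).
exact: (measurableT_comp measurable_snd mi).
Qed.

Lemma measurable_tilted_evidence : measurable_fun setT tilted_evidence.
Proof. exact: (@measurable_fun_fubini_tonelli_F _ _ _ _ _ pi G). Qed.

Lemma tilted_evidence_ge0 z : (0 <= tilted_evidence z)%E.
Proof. by apply: integral_ge0 => t _; exact: (G0 (z, t)). Qed.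

(** Tonelli and independence reduce to one observation, whose factor has mean at most 1 + e - c h <=
    exp(e - c h); its n-th power cancels exp(n c h). *)
Lemma integral_tilted_evidence_le (e : R) :
  (\int[PX]_x (f x)%:E = (1 + e)%:E)%E ->
  (\int[mpower P0 n]_z tilted_evidence z <= (expR (n%:R * e))%:E)%E.
Proof.
move=> fe.
have -> : (\int[mpower P0 n]_z tilted_evidence z =
           \int[pi]_t \int[mpower P0 n]_z G (z, t))%E.
  exact: (@fubini_tonelli _ _ _ _ _ (mpower P0 n) pi G mG G0).
rewrite -[leRHS]mule1 -(probability_setT pi) -integral_cst//.
apply: ge0_le_integral_nomeas => t.
  by apply: integral_ge0 => z _.
have mphi : measurable_fun setT (fun u => lratio theta0 t u `^ a * f u.2).
  apply: measurable_funM; last exact: (measurableT_comp mf measurable_snd).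
  apply: (measurableT_comp (measurable_powR a)).
  by apply: measurable_lratio => //; exact: measurable_cst.
have phi0 u : 0 <= lratio theta0 t u `^ a * f u.2 by rewrite mulr_ge0// powR_ge0.
have e0 : 0 <= expR (n%:R * (c * h2 t)) by exact: expR_ge0.
pose g z := \prod_(i < n) (lratio theta0 t (tnth z i) `^ a * f (tnth z i).2).
have g0 z : 0 <= g z by rewrite prodr_ge0.
have mg : measurable_fun setT g by exact: (measurable_prod_tnth (fun=> mphi)).
have -> : (fun z => G (z, t)) = fun z => (expR (n%:R * (c * h2 t)) * g z)%:E by [].
rewrite (ge0_integralZR (mpower P0 n) e0 mg g0).
rewrite [X in (_ * X)%E](ge0_integral_mpower_prod P0 (fun=> mphi) (fun=> phi0)).
have a01 : 0 < a < 1 by rewrite a0.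
have := integral_lratio_power_le PX theta0 t a01 mf f1.
rewrite fe -fine_hellinger2K -EFinM; set y := c * _.
have : (0 <= \int[P0]_u (lratio theta0 t u `^ a * f u.2)%:E)%E.
  by apply: integral_ge0 => z _; rewrite lee_fin.
case: (integral _ _ _) => [I| |]//=.
rewrite lee_fin -EFinD lee_fin => I0 IM.
rewrite prodEFin prodr_const card_ord -EFinM lee_fin.
have -> : n%:R * e = n%:R * y + (e - y) *+ n by rewrite -mulr_natl; ring.
rewrite expRD ler_wpM2l ?expR_ge0// -[in leRHS]mulr_natl expRM_natl.
rewrite lerXn2r ?nnegrE ?expR_ge0//.
by apply: le_trans (expR_ge1Dx _); lra.
Qed.

Lemma mpower_probability_setT : (mpower P0 n setT = 1)%E.
Proof.
have := @mpower_box _ _ _ P0 n (fun=> setT) (fun=> measurableT).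
rewrite big1; last by move=> i _; exact: probability_setT.
by move=> <-; congr (mpower P0 n _); apply/seteqP; split.
Qed.

Lemma tilted_evidence_markov (e K : R) : 0 < K ->
  (\int[PX]_x (f x)%:E = (1 + e)%:E)%E ->
  ((1 - expR (n%:R * e) / K)%:E <=
   mpower P0 n [set z | (tilted_evidence z <= K%:E)%E])%E.
Proof.
move=> K0 fe; have mU := measurable_tilted_evidence.
pose B := [set: obs] `&` [set z | (K%:E <= `|tilted_evidence z|)%E].
have mB : measurable B.
  by apply: emeasurable_fun_c_infty => //; exact: measurableT_comp.
have BK : (K%:E * mpower P0 n B <= (expR (n%:R * e))%:E)%E.
  apply: le_trans (integral_tilted_evidence_le fe).
  apply: le_trans (le_integral_abse (mpower P0 n) measurableT mU K0) _.
  apply: ge0_le_integral_nomeas => z; first exact: abse_ge0.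
  by rewrite gee0_abs// tilted_evidence_ge0.
have B1 : (mpower P0 n B + mpower P0 n (~` B) = 1)%E.
  rewrite -mpower_probability_setT -measureU// ?setUv// ?setICr//.
  exact: measurableC.
have BA : (mpower P0 n (~` B) <=
    mpower P0 n [set z | (tilted_evidence z <= K%:E)%E])%E.
  apply: le_mpower => z /=; rewrite /B setTI /= => /negP.
  by rewrite -ltNge gee0_abs ?tilted_evidence_ge0// => /ltW.
apply: le_trans BA; move: BK B1.
case: (mpower P0 n B) => [p| |]; case: (mpower P0 n (~` B)) => [q| |]//=.
rewrite -EFinM lee_fin => pK [pq].
have : p <= expR (n%:R * e) / K by rewrite ler_pdivlMr// mulrC.
by rewrite lee_fin; lra.
Qed.

End fractional_posterior_bounds.

Lemma measurable_norm2 (R : realType) (d : nat) : measurable_fun setT (@norm2 R d).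
Proof.
apply: measurableT_comp; first by apply: continuous_measurable_fun => x; exact: sqrt_continuous.
by apply: measurable_sum => i; apply: measurable_funX; exact: measurable_tnth.
Qed.

(** Since |x| <= 1 + |x|^2, the first moment is finite, so the [fine] in the definition of K1
    returns the true mean. *)
Lemma integral_norm2_fin (R : realType) (d : nat) (PX : probability (d.-tuple R) R) :
  'E_PX[fun x => (norm2 x ^+ 2)%R] < +oo ->
  exists2 N : R, (0 <= N)%R & \int[PX]_x (norm2 x)%:E = N%:E.
Proof.
rewrite unlock => X2.
have norm2_ge0 (x : d.-tuple R) : (0 <= norm2 x)%R by exact: sqrtr_ge0.
have [r rE] : exists r : R, \int[PX]_x (1 + norm2 x ^+ 2)%:E = r%:E.
  have I0 : 0 <= \int[PX]_x (norm2 x ^+ 2)%:E.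
    by apply: integral_ge0 => x _; rewrite lee_fin sqr_ge0.
  exists (1 + fine (\int[PX]_x (norm2 x ^+ 2)%:E))%R.
  under eq_integral do rewrite EFinD.
  rewrite ge0_integralD//.
  - rewrite integral_cst// mul1e [X in X + _]probability_setT EFinD fineK//.
    by rewrite ge0_fin_numE.
  - by move=> x _; rewrite lee_fin sqr_ge0.
  - by apply/measurable_EFinP; apply: measurable_funX; exact: measurable_norm2.
apply: (ge0_le_integral_real norm2_ge0 _ rE) => x.
by have := norm2_ge0 x; move: (norm2 x) => y y0; have := sqr_ge0 (y - 1); nra.
Qed.

(** * The concentration event and the choice of constants *)

Section posterior_concentration.
Variables (R : realType) (n d : nat) (PX : probability (d.-tuple R) R).
Variables (C1 tau : R) (theta0 : d.-tuple R) (a : R).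
Local Open Scope ring_scope.
Local Notation P0 := (joint_law PX theta0).
Local Notation s := (norm0 theta0).
Local Notation post z := (fractional_posterior (prior d C1 tau) a z).
Hypotheses (n0 : (0 < n)%N) (s0 : (0 < s)%N) (a0 : 0 < a) (a1 : a < 1).
Hypothesis tauE : tau = (n%:R * Num.sqrt d%:R)^-1.
Hypothesis theta0C : norm1 theta0 <= C1 - 2 * d%:R * tau.

Let sd : (s <= d)%N.
Proof. by rewrite -[leqRHS]card_ord max_card. Qed.

Let d0 : (0 < d)%N. Proof. exact: leq_trans sd. Qed.

Let nR0 : 0 < n%:R :> R. Proof. by rewrite ltr0n. Qed.

Let tau0 : 0 < tau.
Proof. by rewrite tauE invr_gt0 mulr_gt0// sqrtr_gt0 ltr0n. Qed.

(* The extra (32 n)^-1 keeps the loss bound positive for covariates equal to 0. *)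
Let b (x : d.-tuple R) : R := norm2 x / n%:R + (32 * n%:R)^-1.

Let b0 x : 0 < b x.
Proof.
by apply: ltr_wpDl; [apply: divr_ge0 => //; exact: sqrtr_ge0|rewrite invr_gt0 mulr_gt0].
Qed.

(** The reciprocal of the loss per observation in [prior_integral_ge] at lam = a, so that the two
    products cancel. *)
Let f x : R := 1 + 4 * (a * b x).

Let f1 x : 1 <= f x.
Proof. by rewrite lerDl mulr_ge0// mulr_ge0 ?ltW// b0. Qed.

Let mf : measurable_fun setT f.
Proof.
apply: measurable_funD => //; apply: measurable_funM => //; apply: measurable_funM => //.
apply: measurable_funD => //; apply: measurable_funM => //.
exact: measurable_norm2.
Qed.

Let integral_f (N : R) : (\int[PX]_x (norm2 x)%:E = N%:E)%E ->
  (\int[PX]_x (f x)%:E = (1 + 4 * a * (N + 32^-1) / n%:R)%:E)%E.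
Proof.
move=> NE; have i1 (k : \bar R) : (\int[PX]_t (cst k t) = k)%E.
  by rewrite integral_cst// [X in (_ * X)%E]probability_setT mule1.
have nn (x : d.-tuple R) : 0 <= norm2 x by exact: sqrtr_ge0.
have k0 : 0 <= 4 * a / n%:R :> R by rewrite divr_ge0// mulr_ge0// ltW.
transitivity (\int[PX]_x ((1 + a / (8 * n%:R))%:E + ((4 * a / n%:R) * norm2 x)%:E))%E.
  apply: eq_integral => x _; rewrite -EFinD; congr EFin.
  by rewrite /f /b; field; rewrite gt_eqF.
rewrite ge0_integralD//; first last.
- apply/measurable_EFinP; apply: measurable_funM => //; exact: measurable_norm2.
- by move=> x _; rewrite lee_fin mulr_ge0.
- by move=> x _; rewrite lee_fin addr_ge0// divr_ge0 ?ltW// mulr_gt0.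
rewrite (i1 (1 + a / (8 * n%:R))%:E) (ge0_integralZR PX k0 (@measurable_norm2 R d) nn) NE.
by rewrite -EFinM -EFinD; congr EFin; field; rewrite gt_eqF.
Qed.

Let prior_lratio_prod_ge (z : n.-tuple (bool * d.-tuple R)) :
  (((C1 / (s%:R * tau)) ^- (4 * s) / 4 * \prod_(i < n) (f (tnth z i).2)^-1)%:E <=
   \int[prior d C1 tau]_t (lratio_prod theta0 a z t)%:E)%E.
Proof.
apply: (prior_integral_ge tau0 d0 theta0C s0 (x := fun i => (tnth z i).2)
  (b := fun i => b (tnth z i).2) a0).
- by move=> i; exact: b0.
- move=> i; move: (_.2) => x; have nx : 0 <= norm2 x by exact: sqrtr_ge0.
  have -> : d%:R * tau ^+ 2 = n%:R^-1 ^+ 2.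
    have r0 : 0 < Num.sqrt d%:R :> R by rewrite sqrtr_gt0 ltr0n.
    rewrite tauE -{1}(@sqr_sqrtr R d%:R)//; move: (Num.sqrt _) r0 => r r0.
    by field; rewrite !gt_eqF.
  rewrite -exprMn ler_sqr ?nnegrE; last 2 first.
  - by rewrite mulr_ge0// invr_ge0 ltW.
  - exact/ltW/b0.
  by rewrite lerDl invr_ge0 mulr_ge0// ltW.
- exact: measurable_lratio_prod.
- exact: lratio_prod_ge0.
- move=> u; apply: ler_prod => i _; rewrite expR_ge0/=.
  rewrite -mulrN mulrC expRM; apply: ge0_ler_powR; rewrite ?nnegrE ?expR_ge0//.
  - exact: ltW.
  - exact/ltW/lratio_gt0.
  - exact: lratio_tadd_ge.
Qed.

Let q_gt1 : 1 < C1 / (s%:R * tau).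
Proof.
have n1 : 0 <= norm1 theta0 by apply: sumr_ge0 => i _.
have st0 : 0 < s%:R * tau by rewrite mulr_gt0// ltr0n.
rewrite ltr_pdivlMr// mul1r.
have : s%:R * tau <= d%:R * tau by rewrite ler_wpM2r ?ler_nat// ltW.
by move: theta0C; rewrite -mulrA; lra.
Qed.

(** From exp(A - 1) >= A and exp(7/8) >= (1 + 7/16)^2 >= 2. The 1/8 to spare pays for the term (32
    n)^-1 in [b]. *)
Let two_le_expR (A : R) : 0 < A -> 2 * A <= expR (A - 8^-1).
Proof.
move=> A0; have -> : A - 8^-1 = (2%:R * (7 / 16)) + (A - 1) by field.
have h : (1 + 7 / 16) ^+ 2 <= expR (7 / 16) ^+ 2 :> R.
  by rewrite lerXn2r ?nnegrE ?expR_ge0 ?expR_ge1Dx// addr_ge0// divr_ge0.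
rewrite expRD expRM_natl; apply: ler_pM => //; first exact: ltW.
  by apply: le_trans h; lra.
by have := expR_ge1Dx (A - 1); rewrite addrC subrK.
Qed.

Lemma posterior_hellinger2_event (N A : R) :
  (\int[PX]_x (norm2 x)%:E = N%:E)%E -> 2 * N <= A ->
  4 * s%:R * ln (C1 / (s%:R * tau)) <= A ->
  exists E : set (n.-tuple (bool * d.-tuple R)),
    ((1 - 2 / A)%:E <= mpower P0 n E)%E /\
    forall z, E z ->
      (\int[post z]_t hellinger2 (joint_law PX t) P0 <=
       (2 * (a + 1) / Num.min a (1 - a) * (A / n%:R))%:E)%E.
Proof.
move=> NE NA BA; set q := C1 / _ in BA *.
have q0 : 0 < q by apply: lt_trans q_gt1.
have c0 : 0 < Num.min a (1 - a) by rewrite lt_min a0 subr_gt0.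
have A0 : 0 < A.
  by apply: lt_le_trans BA; rewrite mulr_gt0 ?ln_gt0 ?q_gt1// mulr_gt0// ltr0n.
pose e := 4 * a * (N + 32^-1) / n%:R.
(* The Markov threshold for which the exceptional probability exp(n e) / K is exactly 2 / A. *)
pose K := expR (n%:R * e) * (A / 2).
have K0 : 0 < K by rewrite mulr_gt0 ?expR_gt0// divr_gt0.
have ne : n%:R * e <= 2 * a * A + 8^-1.
  have -> : n%:R * e = 4 * a * N + a / 8 by rewrite /e; field; rewrite gt_eqF.
  have : a * (2 * N) <= a * A by rewrite ler_wpM2l// ltW.
  by have := a1; have := a0; nra.
exists [set z | (tilted_evidence PX theta0 (prior d C1 tau) a f z <= K%:E)%E]; split.
  have := tilted_evidence_markov n theta0 (prior d C1 tau) a0 mf f1 a1 K0 (integral_f NE).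
  rewrite -/e; have -> // : expR (n%:R * e) / K = 2 / A.
  rewrite /K; have := expR_gt0 (n%:R * e); move: (expR _) => x x0.
  by field; rewrite !gt_eqF.
move=> z /= UK.
pose F := \prod_(i < n) f (tnth z i).2.
have F0 : 0 < F by apply: prodr_gt0 => i _; apply: lt_le_trans (f1 _).
pose k := q ^- (4 * s) / 4 * F^-1.
have k0 : 0 < k by rewrite mulr_gt0 ?invr_gt0// divr_gt0// invr_gt0 exprn_gt0.
have kF : (k%:E <= \int[prior d C1 tau]_t (lratio_prod theta0 a z t)%:E)%E.
  by have := prior_lratio_prod_ge z; rewrite prodfV.
pose h2 t := fine (hellinger2 (joint_law PX t) P0).
have h20 t : 0 <= h2 t by exact: fine_hellinger2_ge0.
have mh2 : measurable_fun setT h2.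
  by apply: measurableT_comp => //; exact: measurable_hellinger2_joint_law.
pose h t := n%:R * Num.min a (1 - a) * h2 t.
have nc0 : 0 < n%:R * Num.min a (1 - a) by rewrite mulr_gt0.
have mh : measurable_fun setT h by exact: measurable_funM.
have h0 t : 0 <= h t by rewrite mulr_ge0// ltW.
have FM : (\int[prior d C1 tau]_t (lratio_prod theta0 a z t * expR (h t))%:E <= (K / F)%:E)%E.
  rewrite -(lee_pmul2l (x := F%:E)) ?lte_fin// -EFinM mulrC divfK ?gt_eqF//.
  apply: le_trans UK.
  rewrite -(ge0_integralZR (prior d C1 tau) (ltW F0)).
  - rewrite le_eqVlt; apply/orP; left; apply/eqP; apply: eq_integral => t _.
    have -> : h t = n%:R * (Num.min a (1 - a) * h2 t) by rewrite /h mulrA.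
    by rewrite big_split/= -/F -/(lratio_prod theta0 a z t); congr EFin; ring.
  - apply: measurable_funM; first exact: measurable_lratio_prod.
    exact: measurableT_comp.
  - by move=> t; rewrite mulr_ge0 ?lratio_prod_ge0// expR_ge0.
have := fractional_posterior_expR_le a0 mh h0 k0 kF FM.
have -> : (\int[post z]_t (h t)%:E = (n%:R * Num.min a (1 - a))%:E *
    \int[post z]_t hellinger2 (joint_law PX t) P0)%E.
  rewrite (ge0_integralZR (post z) (ltW nc0) mh2 h20); congr (_ * _)%E.
  by apply: eq_integral => t _; rewrite fine_hellinger2K.
(* [F] cancels, leaving exp(n e), 2 A (the A/2 of [K] times the 4 of [k]) and q^(4 s), bounded by
   the exponentials of 2 a A + 1/8, A - 1/8 and A. *)
have lnle : ln (K / F / k) <= 2 * (a + 1) * A.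
  have Mk0 : 0 < K / F / k by apply: divr_gt0 => //; exact: divr_gt0.
  rewrite -[leRHS]expRK ler_ln ?posrE ?expR_gt0//.
  have -> : K / F / k = expR (n%:R * e) * (2 * A) * q ^+ (4 * s).
    rewrite /K /k; have := exprn_gt0 (4 * s) q0; move: (q ^+ _) (expR _) => y x y0.
    by field; rewrite !gt_eqF.
  have -> : 2 * (a + 1) * A = (2 * a * A + 8^-1) + (A - 8^-1) + A by ring.
  rewrite [leRHS]expRD expRD; apply: ler_pM.
  - by rewrite mulr_ge0 ?expR_ge0// mulr_ge0// ltW.
  - by rewrite exprn_ge0// ltW.
  - apply: ler_pM; rewrite ?expR_ge0 ?ler_expR ?two_le_expR//.
    by rewrite mulr_ge0// ltW.
  - by rewrite -[q in leLHS]lnK ?posrE// -expRM_natl ler_expR natrM.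
move=> H; rewrite -(lee_pmul2l (x := (n%:R * Num.min a (1 - a))%:E)) ?lte_fin//.
apply: (le_trans H); rewrite -EFinM lee_fin; apply: (le_trans lnle).
rewrite le_eqVlt; apply/orP; left; apply/eqP.
by move: c0; move: (Num.min _ _) => c c0; field; rewrite !gt_eqF.
Qed.

End posterior_concentration.

Theorem corollary3p2 (R : realType) (n d : nat)
    (PX : probability (d.-tuple R) R) (C1 : R) (theta0 : d.-tuple R) :
  'E_PX[fun x => (norm2 x ^+ 2)%R] < +oo ->
  (0 < C1)%R ->
  let K1 : R := (2 * fine 'E_PX[@norm2 R d])%R in
  let tau : R := (n%:R * Num.sqrt d%:R)^-1%R in
  (2 * d%:R * tau < C1)%R ->
  (norm1 theta0 <= C1 - 2 * d%:R * tau)%R ->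
  let s := norm0 theta0 in
  (1 <= s)%N -> (s < n)%N ->
  let eps : R :=
    (Num.max K1 (4 * s%:R * ln (C1 * n%:R * Num.sqrt d%:R / s%:R)) / n%:R)%R in
  forall alpha : R, (0 < alpha)%R -> (alpha < 1)%R ->
  let H : R :=
    (if 1 / 2 <= alpha then 2 * (alpha + 1) / (1 - alpha)
     else 2 * (alpha + 1) / alpha)%R in
  let Pn := mpower (joint_law PX theta0) n in
  let post (z : n.-tuple (bool * d.-tuple R)) :=
    fractional_posterior (prior d C1 tau) alpha z in
  (1 - 2 / (n%:R * eps))%:E <=
    Pn [set z | \int[post z]_theta
                  hellinger2 (joint_law PX theta) (joint_law PX theta0)
                <= (H * eps)%:E] /\
  (1 - 2 / (n%:R * eps))%:E <=
    Pn [set z | \int[post z]_theta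
                  tv_distance (joint_law PX theta) (joint_law PX theta0) ^+ 2
                <= (4 * (alpha + 1) / ((1 - alpha) * alpha) * eps)%:E].

Proof.
move=> X2 C10 K1 tau C1d theta0C s s1 sn eps alpha al0 al1 H Pn post.
have n0 : (0 < n)%N by exact: leq_ltn_trans sn.
have nR : (n%:R != 0 :> R)%R by rewrite pnatr_eq0 -lt0n.
have [N N0 NE] := integral_norm2_fin X2.
have K1E : K1 = (2 * N)%R by rewrite /K1 unlock NE.
pose A : R := Num.max K1 (4 * s%:R * ln (C1 / (s%:R * tau)))%R.
have epsE : eps = (A / n%:R)%R.
  rewrite /eps /A /tau; congr (Num.max _ (_ * ln _) / _)%R.
  by rewrite invfM invrK; ring.
have -> : (n%:R * eps = A)%R by rewrite epsE mulrC divfK.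
have [E [PE E_hel]] := posterior_hellinger2_event n0 s1 al0 al1 erefl theta0C NE (A := A)
  ltac:(by rewrite -K1E le_max lexx) ltac:(by rewrite le_max lexx orbT).
have HE : (H = 2 * (alpha + 1) / Num.min alpha (1 - alpha))%R.
  rewrite /H; case: ifP => [|/negbT]; rewrite -?ltNge => h; congr (_ / _)%R;
    by case: (leP alpha (1 - alpha))%R; lra.
have A0 : (0 <= A)%R by rewrite le_max K1E mulr_ge0.
split; apply: (le_trans PE); apply: le_mpower => z /E_hel.
  by rewrite -epsE -HE.
(* The same event serves for total variation: its constant dominates [H] because alpha (1 - alpha)
   <= 2 min(alpha, 1 - alpha). *)
move=> hel; apply: le_trans (_ : _ <= (H * eps)%:E) _; last first.
  rewrite lee_fin epsE HE ler_wpM2r ?divr_ge0//.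
  have c0 : (0 < Num.min alpha (1 - alpha))%R by rewrite lt_min al0 subr_gt0.
  have aa0 : (0 < (1 - alpha) * alpha)%R by rewrite mulr_gt0// subr_gt0.
  rewrite ler_pdivrMr// mulrAC ler_pdivlMr//.
  by case: (leP alpha (1 - alpha)%R) => h; nra.
rewrite HE epsE; apply: le_trans hel.
apply: ge0_le_integral_nomeas => t.
  by rewrite expe_ge0// tv_distance_ge0.
exact: tv_distance_sqr_le.
Qed.
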